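(* Let $I=[\alpha_0,\alpha_1]\subset(0,1)$ be a compact interval, let $\varphi,h\in H$, and let $M_\alpha(t)=\langle u_\alpha(t),h\rangle$. Suppose that for some $m\in\mathbb{N}$, $m\ge1$, $$\langle\mathcal{A}^{-k}\varphi,h\rangle=0\quad(1\le k\le m-1),\qquad\langle\mathcal{A}^{-m}\varphi,h\rangle\ne0,$$ where the vanishing condition is void when $m=1$. Assume also that $c_m(\alpha)=\frac{(-1)^{m+1}}{\Gamma(1-m\alpha)}\ne0$ for all $\alpha\in I$. Then one sufficiently late value of $\langle u_\alpha(t),h\rangle$ determines at most one $\alpha\in I$: there exists $T_I>1$ such that for every $t_0\ge T_I$ and every $d_0\in\mathbb{R}$ the equation $\langle u_\alpha(t_0),h\rangle=d_0$ has at most one solution $\alpha\in I$.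
   Context: Let $H$ be a real separable Hilbert space with inner product $\langle\cdot,\cdot\rangle$ and $\mathcal{A}:\operatorname{Dom}(\mathcal{A})\subset H\to H$ a self-adjoint, strictly positive operator with compact resolvent, with eigenvalues counted with multiplicity $0<\lambda_1\le\lambda_2\le\cdots$ and an orthonormal eigenbasis $\{v_n\}$, $\mathcal{A}v_n=\lambda_nv_n$; in infinite dimensions $\lambda_n\to\infty$, and in finite dimensions the list of eigenvalues is finite and all spectral sums terminate accordingly. For $\alpha\in(0,1)$, $u_\alpha$ denotes the mild solution of the Caputo problem $\partial_t^\alpha u_\alpha(t)+\mathcal{A}u_\alpha(t)=0$ for $t>0$, $u_\alpha(0)=\varphi$, given by $u_\alpha(t)=\sum_n\langle\varphi,v_n\rangle E_{\alpha,1}(-\lambda_nt^\alpha)v_n$, where $E_{\alpha,1}(z)=\sum_{i\ge0}z^i/\Gamma(\alpha i+1)$ is the Mittag-Leffler function. The function $1/\Gamma$ is the entire reciprocal gamma function, vanishing at non-positive integers. *)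

(* Defs.v *)
From HB Require Import structures.
From mathcomp Require Import all_boot all_order all_algebra.
From mathcomp Require Import all_classical all_reals all_analysis.

Set Implicit Arguments.
Unset Strict Implicit.
Unset Printing Implicit Defensive.

Import Order.TTheory GRing.Theory Num.Theory.
Import numFieldNormedType.Exports.

Local Open Scope classical_set_scope.
Local Open Scope ring_scope.

Section SpecialFunctions.
Context {R : realType}.
Implicit Types (alpha beta s x z : R).

(* Only meaningful for 0 < s, where the integral converges. *)
Definition euler_gamma s : R :=
  \int[lebesgue_measure]_(t in `]0, +oo[) (t `^ (s - 1) * expR (- t)).

(* The number of steps [n] needed to bring [x + n] into the domain of Euler's
   integral: the least [n] such that [0 < x + n]. *)
Definition gamma_shift x : nat :=
  if 0 < x then 0%N else (Num.truncn (- x)).+1.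

(* The entire function 1/Gamma on the real line, extended from Euler's integral
   by 1/Gamma(x) = x (x + 1) ... (x + n - 1) / Gamma(x + n).  The product has
   a zero factor exactly when [x] is a non-positive integer. *)
Definition rgamma x : R :=
  (\prod_(i < gamma_shift x) (x + i%:R))
    / euler_gamma (x + (gamma_shift x)%:R).

Definition mittag_leffler alpha beta z : R :=
  limn (series (fun i : nat => z ^+ i * rgamma (alpha * i%:R + beta))).

End SpecialFunctions.

Section Operators.
Context {R : realType} {H : completeNormedModType R}.
(* A real Hilbert space is a complete normed space whose norm is induced by a
   symmetric positive definite form: [norm_induced dot]. *)
Variable dot : {dot H for (idfun : R -> R)}.

Definition norm_induced := forall x : H, dot x x = `|x| ^+ 2.

(* An unbounded operator is a pair of a domain [D] and a function [A], whose
   values outside [D] are irrelevant. *)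
Variables (D : set H) (A : H -> H).

Definition linear_on_domain :=
  D 0 /\
  forall (a : R) (x y : H), D x -> D y ->
    D (a *: x + y) /\ A (a *: x + y) = a *: A x + A y.

(* [(y, z)] belongs to the graph of the adjoint A^*. *)
Definition adjoint_graph (y z : H) :=
  forall x, D x -> dot (A x) y = dot x z.

(* A densely defined linear operator with A = A^*, domains included. *)
Definition self_adjoint :=
  [/\ linear_on_domain, dense D &
      forall y z, adjoint_graph y z <-> D y /\ A y = z].

Definition strictly_positive :=
  forall x, D x -> x != 0 -> 0 < dot (A x) x.

Definition compact_operator (S : H -> H) :=
  forall B : set H, bounded_set B -> precompact (S @` B).

(* [S] is the resolvent (A - z)^-1, an everywhere defined bounded operator. *)
Definition is_resolvent (z : R) (S : {linear H -> H}) :=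
  [/\ continuous (S : H -> H),
      forall x, D (S x) /\ A (S x) - z *: S x = x &
      forall x, D x -> S (A x - z *: x) = x].

Definition compact_resolvent :=
  exists (z : R) (S : {linear H -> H}), is_resolvent z S /\ compact_operator S.

(* The inverse of [A : D -> H], set to 0 off the range of [A]; [inv_pow k] is
   A^-k. *)
Definition inv_op (x : H) : H := xget 0 [set y | D y /\ A y = x].

Definition inv_pow (k : nat) : H -> H := iter k inv_op.

(* The eigenvalues are numbered from 0.  [N] is the dimension of [H], with
   [None] for infinite dimension; [lambda n] and [v n] are irrelevant unless
   [eigen_index N n]. *)
Definition eigen_index (N : option nat) (n : nat) : bool :=
  if N is Some d then (n < d)%N else true.

Definition spectral_series (N : option nat) (v : nat -> H) (c : nat -> R) :
    nat -> H :=
  series (fun n => if eigen_index N n then c n *: v n else 0).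

Definition orthonormal_basis (N : option nat) (v : nat -> H) :=
  (forall i j, eigen_index N i -> eigen_index N j ->
     dot (v i) (v j) = (i == j)%:R) /\
  (forall x, spectral_series N v (fun n => dot x (v n)) @ \oo --> x).

Definition spectral_decomposition (N : option nat) (lambda : nat -> R)
    (v : nat -> H) :=
  [/\ orthonormal_basis N v,
      forall n, eigen_index N n -> D (v n) /\ A (v n) = lambda n *: v n,
      forall n, eigen_index N n -> 0 < lambda n,
      forall i j, eigen_index N j -> (i <= j)%N -> lambda i <= lambda j &
      N = None -> lambda @ \oo --> +oo].

(* u_alpha(t), for the initial datum [phi]. *)
Definition mild_solution (N : option nat) (lambda : nat -> R) (v : nat -> H)
    (phi : H) (alpha t : R) : H :=
  limn (spectral_series N v (fun n =>
    dot phi (v n) * mittag_leffler alpha 1 (- lambda n * t `^ alpha))).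

End Operators.

Definition separable_space (T : topologicalType) :=
  exists2 S : set T, countable S & dense S.

(* Main.v *)
Require Import Defs.
From HB Require Import structures.
From mathcomp Require Import all_boot all_order all_algebra.
From mathcomp Require Import all_classical all_reals all_analysis measurable_realfun.
From mathcomp Require Import ring lra.

Set Implicit Arguments.
Unset Strict Implicit.
Unset Printing Implicit Defensive.

Import Order.TTheory GRing.Theory Num.Theory.
Import numFieldNormedType.Exports.
From mathcomp Require Import complex.

(** Write [q n = <phi, v_n> <h, v_n>] and [b k = <A^-k phi, h>].  The weights [q n]
    are absolutely summable, and pairing the spectral series with [h] gives
    [b k = sum_n q n / lambda_n ^ k] and
    [<u_alpha (t), h> = sum_n q n * E_alpha (- lambda_n t ^ alpha)].

    The Mittag-Leffler function expands at infinity as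
    [E_alpha (- x) = sum_(1 <= k <= m) (-1) ^ (k + 1) x ^ (- k) / Gamma (1 - k alpha)
                     + (- x) ^ (- m) r_m (alpha, x)]
    with a small remainder ([mlg_expansion], where [r_m] is [mlg m]).  Summation
    against [q n] turns the powers of [x] into [t ^ (- k alpha) b k], and all of them
    vanish except the last: with
    [G (alpha, t) = sum_n q n * lambda_n ^ (- m) r_m (alpha, lambda_n t ^ alpha)],
    [P (alpha) := (-1) ^ (m + 1) t ^ (m alpha) <u_alpha (t), h>
                = b m / Gamma (1 - m alpha) - G (alpha, t)].
    If two orders [alpha < beta] give the same value at time [t], then
    [P (beta) = t ^ (m (beta - alpha)) P (alpha)], so that
    [|P (beta) - P (alpha)| >= (beta - alpha) (ln t) |P (alpha)|].  On the other hand
    [|P|] is bounded below for late [t], because [1 / Gamma (1 - m alpha)] has no zero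
    on the compact interval, and [P] is Lipschitz in [alpha] with a constant that is
    bounded in [t], because [G] is bounded by a multiple of [t ^ (- alpha0)] and
    Lipschitz with constant a multiple of [(1 + ln t) t ^ (- alpha0)].  For [ln t] large
    enough this is a contradiction ([observation_injective]).

    The estimates on the remainder have to be uniform in [alpha] and in [lambda_n].
    They follow from an integral on a contour that depends on neither.  In the
    variable [z] with [zeta = z ^ 2], Hankel's contour becomes a vertical line in
    the right half-plane, and along [z = 1 + i y]
    [1 / Gamma (b) = (2 / pi) int_(y > 0) Re (exp (z ^ 2) z ^ (1 - 2 b)) dy]
    ([rgamma_hankel]).  It is proved for [b > 1 / 2] by writing the power of [z] as a
    Laplace integral, exchanging the integrals, evaluating a Gaussian and applying
    the duplication formula of Gamma; a recursion covers the other [b].  Summing a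
    geometric series under the integral sign ([mittag_lefflerE]) then gives, with
    [w = z ^ (2 alpha)],
    [r_m (alpha, x) = (2 / pi) int_(y > 0) Re (exp (z ^ 2) z ^ (- 1) w ^ (m + 1) / (w + x)) dy].
    Since the argument of [w] is at most [alpha pi] in absolute value,
    [|w + x| >= cos (alpha pi / 2) (|w| + x)], and everything else is dominated by the
    Gaussian decay of [exp (z ^ 2)] ([mlg_estimates], [rgamma_lipschitz]). *)

Local Open Scope classical_set_scope.
Local Open Scope ring_scope.
Local Open Scope complex_scope.

(** * Complex functions and their derivatives *)

Section RealDerivatives.
Context {R : realType}.
Implicit Types (f g : R -> R) (t a b : R).

(** The differentiation rules for eta-expanded functions: in this form proofs of
    [is_derive] compose as terms, without unifying function operators. *)
Lemma is_derive_add f g t a b : is_derive t 1 f a -> is_derive t 1 g b ->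
  is_derive t 1 (fun s => f s + g s) (a + b).
Proof. by move=> df dg; exact: is_deriveD. Qed.

Lemma is_derive_sub f g t a b : is_derive t 1 f a -> is_derive t 1 g b ->
  is_derive t 1 (fun s => f s - g s) (a - b).
Proof. by move=> df dg; exact: is_deriveB. Qed.

Lemma is_derive_mul f g t a b : is_derive t 1 f a -> is_derive t 1 g b ->
  is_derive t 1 (fun s => f s * g s) (f t * b + g t * a).
Proof. by move=> df dg; exact: is_deriveM. Qed.

Lemma is_derive_inv f t a : is_derive t 1 f a -> f t != 0 ->
  is_derive t 1 (fun s => (f s)^-1) (- (a / f t ^+ 2)).
Proof.
move=> df f0; apply: (is_derive_eq (is_deriveV f0 df)).
by rewrite /GRing.scale /= mulNr mulrC.
Qed.

Lemma is_derive_compose f g t a b : is_derive t 1 g b ->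
  is_derive (g t) 1 f a -> is_derive t 1 (fun s => f (g s)) (a * b).
Proof. by move=> dg df; exact: is_derive1_comp. Qed.

Lemma is_derive_derivable f t a : is_derive t 1 f a -> derivable f t 1.
Proof. by case. Qed.

Lemma is_derive_continuous f t a : is_derive t 1 f a -> {for t, continuous f}.
Proof.
by move=> /is_derive_derivable df; apply/differentiable_continuous/derivable1_diffP.
Qed.

End RealDerivatives.

Section ComplexCalculus.
Context {R : realType}.
Local Notation C := R[i].
Implicit Types (z p d e : C) (t a : R).

Lemma ReD z p : Re (z + p) = Re z + Re p. Proof. by case: z; case: p. Qed.
Lemma ImD z p : Im (z + p) = Im z + Im p. Proof. by case: z; case: p. Qed.
Lemma ReN z : Re (- z) = - Re z. Proof. by case: z. Qed.
Lemma ImN z : Im (- z) = - Im z. Proof. by case: z. Qed.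
Lemma ReM z p : Re (z * p) = Re z * Re p - Im z * Im p.
Proof. by case: z; case: p. Qed.
Lemma ImM z p : Im (z * p) = Re z * Im p + Im z * Re p.
Proof. by case: z; case: p. Qed.
Lemma ReV z : Re z^-1 = Re z / (Re z ^+ 2 + Im z ^+ 2).
Proof. by case: z. Qed.
Lemma ImV z : Im z^-1 = - (Im z / (Re z ^+ 2 + Im z ^+ 2)).
Proof. by case: z. Qed.
Definition ReImE := (ReD, ImD, ReN, ImN, ReM, ImM).

Lemma complexP z p : Re z = Re p -> Im z = Im p -> z = p.
Proof. by case: z; case: p => ? ? ? ? /= -> ->. Qed.

Lemma sqnormc_gt0 z : z != 0 -> 0 < Re z ^+ 2 + Im z ^+ 2.
Proof.
case: z => x y; rewrite eq_complex /= => xy.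
rewrite lt_def addr_ge0 ?sqr_ge0// andbT.
by apply: contra xy; rewrite paddr_eq0 ?sqr_ge0// !sqrf_eq0.
Qed.

Definition cexp z : C :=
  (expR (Re z) * cos (Im z)) +i* (expR (Re z) * sin (Im z)).

(** The principal logarithm, on the half-plane [0 < Re z] where the argument is the
    arctangent of a quotient. *)
Definition clog z : C :=
  (ln (Re z ^+ 2 + Im z ^+ 2) / 2) +i* atan (Im z / Re z).

Lemma cexp0 : cexp 0 = 1.
Proof. by apply: complexP; rewrite /= expR0 ?cos0 ?sin0 ?mulr1 ?mulr0. Qed.

Lemma cexpD z p : cexp (z + p) = cexp z * cexp p.
Proof.
by apply: complexP; rewrite !ReImE /= !ReImE expRD ?cosD ?sinD; ring.
Qed.

Lemma cexp_neq0 z : cexp z != 0.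
Proof.
apply/negP => /eqP e0; have : cexp z * cexp (- z) = 0 by rewrite e0 mul0r.
by rewrite -cexpD subrr cexp0 => /eqP; rewrite oner_eq0.
Qed.

Lemma cexpN z : cexp (- z) = (cexp z)^-1.
Proof.
by apply: (mulfI (cexp_neq0 z)); rewrite -cexpD subrr cexp0 divff// cexp_neq0.
Qed.

Lemma cexpXn z n : cexp z ^+ n = cexp (z *+ n).
Proof.
by elim: n => [|n IHn]; rewrite ?cexp0// exprS IHn -cexpD mulrS.
Qed.

Definition cderiv (f : R -> C) t d : Prop :=
  is_derive t 1 (fun s => Re (f s)) (Re d) /\
  is_derive t 1 (fun s => Im (f s)) (Im d).

Lemma cderiv_cst z t : cderiv (fun=> z) t 0.
Proof. by split; exact: is_derive_cst. Qed.

Lemma cderivD f g t d e : cderiv f t d -> cderiv g t e ->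
  cderiv (fun s => f s + g s) t (d + e).
Proof.
move=> [fr fi] [gr gi]; split; rewrite !ReImE.
  under eq_fun do rewrite ReD.
  exact: is_derive_add.
under eq_fun do rewrite ImD.
exact: is_derive_add.
Qed.

Lemma cderivM f g t d e : cderiv f t d -> cderiv g t e ->
  cderiv (fun s => f s * g s) t (f t * e + g t * d).
Proof.
move=> [fr fi] [gr gi]; split.
  under eq_fun do rewrite ReM.
  apply: (is_derive_eq (is_derive_sub (is_derive_mul fr gr) (is_derive_mul fi gi))).
  by rewrite !ReImE; ring.
under eq_fun do rewrite ImM.
apply: (is_derive_eq (is_derive_add (is_derive_mul fr gi) (is_derive_mul fi gr))).
by rewrite !ReImE; ring.
Qed.

Lemma cderiv_eq f t d e : cderiv f t d -> d = e -> cderiv f t e.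
Proof. by move=> ? <-. Qed.

Lemma cderivV f t d : f t != 0 -> cderiv f t d ->
  cderiv (fun s => (f s)^-1) t (- (d / f t ^+ 2)).
Proof.
move=> f0 [fr fi]; have /lt0r_neq0 n0 := sqnormc_gt0 f0.
have dq := is_derive_add (is_derive_mul fr fr) (is_derive_mul fi fi).
have q0 : Re (f t) * Re (f t) + Im (f t) * Im (f t) != 0 by rewrite -!expr2.
have dqV := is_derive_inv dq q0.
have n1 : ((Re (f t) * Re (f t) - Im (f t) * Im (f t)) ^+ 2 +
   (Re (f t) * Im (f t) + Im (f t) * Re (f t)) ^+ 2) != 0.
  rewrite (_ : _ + _ = (Re (f t) * Re (f t) + Im (f t) * Im (f t)) ^+ 2).
    by rewrite sqrf_eq0.
  by ring.
split.
  under eq_fun do rewrite ReV !expr2.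
  apply: (is_derive_eq (is_derive_mul fr dqV)).
  rewrite ReN ReM ReV ImV !(expr2 (f t)) !ReM !ImM.
  by field; rewrite n1 q0.
under eq_fun do rewrite ImV !expr2 -mulNr.
have dN := is_derive_sub (is_derive_cst (0 : R) t 1) fi.
under [X in is_derive _ _ X]eq_fun do rewrite -[- Im _]sub0r.
apply: (is_derive_eq (is_derive_mul dN dqV)).
rewrite ImN ImM ReV ImV !(expr2 (f t)) !ReM !ImM /cst.
by field; rewrite n1 q0.
Qed.

Lemma cderiv_cexp f t d : cderiv f t d ->
  cderiv (fun s => cexp (f s)) t (cexp (f t) * d).
Proof.
move=> [fr fi].
have de := is_derive_compose fr (is_derive_expR _).
have dc := is_derive_compose fi (is_derive_cos _).
have ds := is_derive_compose fi (is_derive_sin _).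
split => /=.
  apply: (is_derive_eq (is_derive_mul de dc)).
  by rewrite ReM /=; ring.
apply: (is_derive_eq (is_derive_mul de ds)).
by rewrite ImM /=; ring.
Qed.

Lemma cderiv_clog f t d : 0 < Re (f t) -> cderiv f t d ->
  cderiv (fun s => clog (f s)) t (d / f t).
Proof.
move=> f0 [fr fi].
have n0 : 0 < Re (f t) ^+ 2 + Im (f t) ^+ 2.
  by rewrite ltr_wpDr ?sqr_ge0 ?exprn_gt0.
have dq := is_derive_add (is_derive_mul fr fr) (is_derive_mul fi fi).
have q0 : 0 < Re (f t) * Re (f t) + Im (f t) * Im (f t) by rewrite -!expr2.
have r0 : Re (f t) != 0 by rewrite gt_eqF.
split => /=.
  under eq_fun do rewrite !expr2.
  apply: (is_derive_eq (is_derive_mul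
    (is_derive_compose dq (is_derive1_ln q0)) (is_derive_cst (2^-1 : R) t 1))).
  rewrite ReM ReV ImV /cst.
  by field; rewrite ?gt_eqF // !expr2 gt_eqF.
apply: (is_derive_eq (is_derive_compose
  (is_derive_mul fi (is_derive_inv fr r0)) (is_derive1_atan _))).
rewrite ImM ReV ImV.
have n1 : Re (f t) * Re (f t) + Im (f t) * Im (f t) != 0 by rewrite gt_eqF.
by field; rewrite n1 r0.
Qed.

(** Complex differentiability, encoded as the chain rule along all differentiable
    curves through [z].  Contour integrals only differentiate along horizontal
    and vertical lines, so this is all they need, and every rule below follows
    from the one for real functions. *)
Definition cdiff (F : C -> C) z d : Prop :=
  forall (c : R -> C) t e, c t = z -> cderiv c t e -> cderiv (fun s => F (c s)) t (d * e).

Lemma cdiff_eq F z d e : cdiff F z d -> d = e -> cdiff F z e.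
Proof. by move=> ? <-. Qed.

Lemma cdiff_id z : cdiff id z 1.
Proof. by move=> c t e _; rewrite mul1r. Qed.

Lemma cdiff_cst p z : cdiff (fun=> p) z 0.
Proof. by move=> c t e _ _; rewrite mul0r; exact: cderiv_cst. Qed.

Lemma cdiffD F G z d e : cdiff F z d -> cdiff G z e ->
  cdiff (fun s => F s + G s) z (d + e).
Proof.
move=> dF dG c t e' cz dc; rewrite mulrDl.
by apply: cderivD; [exact: dF|exact: dG].
Qed.

Lemma cdiffM F G z d e : cdiff F z d -> cdiff G z e ->
  cdiff (fun s => F s * G s) z (F z * e + G z * d).
Proof.
move=> dF dG c t e' cz dc; rewrite mulrDl -!mulrA -cz.
by apply: cderivM; [exact: dF|exact: dG].
Qed.

Lemma cdiffV F z d : cdiff F z d -> F z != 0 ->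
  cdiff (fun s => (F s)^-1) z (- (d / F z ^+ 2)).
Proof.
move=> dF F0 c t e' cz dc; rewrite mulNr mulrAC -cz.
by apply: (@cderivV (fun s => F (c s))); [rewrite cz|exact: dF].
Qed.

Lemma cdiff_cexp F z d : cdiff F z d ->
  cdiff (fun s => cexp (F s)) z (cexp (F z) * d).
Proof.
move=> dF c t e' cz dc; rewrite -mulrA -cz.
by apply: (@cderiv_cexp (fun s => F (c s))); exact: dF.
Qed.

Lemma cdiff_clog z : 0 < Re z -> cdiff clog z z^-1.
Proof.
move=> z0 c t e' cz dc; rewrite mulrC -cz.
by apply: cderiv_clog; rewrite ?cz.
Qed.

Lemma cderiv_continuous_Re f t d : cderiv f t d ->
  {for t, continuous (fun s => Re (f s))}.
Proof.
by move=> [fr _]; exact: is_derive_continuous fr.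
Qed.

Lemma cderiv_horizontal a (b : R) : cderiv (fun s => s +i* b) a 1.
Proof. by split => /=; [exact: is_derive_id|exact: is_derive_cst]. Qed.

Lemma cderiv_vertical a (b : R) : cderiv (fun s => b +i* s) a 'i%C.
Proof. by split => /=; [exact: is_derive_cst|exact: is_derive_id]. Qed.

Definition cmod z : R := Normc.normc z.

Lemma cmodE z : cmod z = Num.sqrt (Re z ^+ 2 + Im z ^+ 2).
Proof. by case: z. Qed.

Lemma cmod_ge0 z : 0 <= cmod z. Proof. by rewrite cmodE sqrtr_ge0. Qed.

Lemma cmodM z p : cmod (z * p) = cmod z * cmod p.
Proof. exact: Normc.normcM. Qed.

Lemma cmodV z : cmod z^-1 = (cmod z)^-1.
Proof. exact: Normc.normcV. Qed.

Lemma cmodD z p : cmod (z + p) <= cmod z + cmod p.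
Proof.
have : `|z + p| <= `|z| + `|p| := ler_normD z p.
by case: z => a b; case: p => c d; rewrite lecE /= => /andP[_].
Qed.

Lemma cmodN z : cmod (- z) = cmod z.
Proof. by rewrite !cmodE ReN ImN !sqrrN. Qed.

Lemma cmodB z p : cmod (z - p) <= cmod z + cmod p.
Proof. by rewrite -(cmodN p); exact: cmodD. Qed.

Lemma cmod_cexp z : cmod (cexp z) = expR (Re z).
Proof.
rewrite cmodE /= !exprMn -mulrDr cos2Dsin2 mulr1 sqrtr_sqr ger0_norm//.
Qed.

Lemma cmod_real a : cmod a%:C = `|a|.
Proof. by rewrite cmodE /= expr0n addr0 sqrtr_sqr. Qed.

Lemma normRe_le z : `|Re z| <= cmod z.
Proof. by rewrite cmodE -sqrtr_sqr ler_wsqrtr// lerDl sqr_ge0. Qed.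

Lemma normIm_le z : `|Im z| <= cmod z.
Proof. by rewrite cmodE -sqrtr_sqr ler_wsqrtr// lerDr sqr_ge0. Qed.

Lemma cmod_le z : cmod z <= `|Re z| + `|Im z|.
Proof.
rewrite cmodE -[leRHS]ger0_norm ?addr_ge0// -sqrtr_sqr ler_wsqrtr//.
rewrite sqrrD !real_normK ?num_real// -addrA lerD2l lerDr.
by rewrite mulrn_wge0// mulr_ge0.
Qed.

Lemma cmod_eq0 z : (cmod z == 0) = (z == 0).
Proof.
apply/eqP/eqP => [/Normc.eq0_normc//|->].
by rewrite cmodE /= expr0n addr0 sqrtr0.
Qed.

Lemma cmod_gt0 z : (0 < cmod z) = (z != 0).
Proof. by rewrite lt_def cmod_ge0 andbT cmod_eq0. Qed.

Lemma cmodX z n : cmod (z ^+ n) = cmod z ^+ n.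
Proof.
elim: n => [|n IHn]; last by rewrite !exprS cmodM IHn.
by rewrite !expr0 (cmod_real 1) normr1.
Qed.

Lemma clogK z : 0 < Re z -> cexp (clog z) = z.
Proof.
move=> z0.
have n0 : 0 < Re z ^+ 2 + Im z ^+ 2 by rewrite ltr_wpDr ?sqr_ge0 ?exprn_gt0.
have e : expR (ln (Re z ^+ 2 + Im z ^+ 2) / 2) = cmod z.
  by rewrite cmodE -powR12_sqrt ?ltW// /powR gt_eqF// mulrC.
have z0' : Re z != 0 by rewrite gt_eqF.
have m : Re z * Num.sqrt (1 + (Im z / Re z) ^+ 2) = cmod z.
  rewrite -{1}(gtr0_norm z0) -sqrtr_sqr -sqrtrM ?sqr_ge0// cmodE.
  by congr Num.sqrt; field.
have m0 : cmod z != 0 by rewrite cmod_eq0; apply: contraNneq z0' => ->.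
have s0 : Num.sqrt (1 + (Im z / Re z) ^+ 2) != 0.
  by apply: contraNneq m0 => s0; rewrite -m s0 mulr0.
have c : cos (atan (Im z / Re z)) = Re z / cmod z.
  by rewrite cos_atan -m; field; rewrite s0.
have s : sin (atan (Im z / Re z)) = Im z / cmod z.
  have a0 : cos (atan (Im z / Re z)) != 0 by rewrite c mulf_neq0// invr_eq0.
  have := atanK (Im z / Re z); rewrite /tan => /(congr1 (fun u => u * cos (atan (Im z / Re z)))).
  rewrite divfK// => ->; rewrite c.
  by field; rewrite m0.
by apply: complexP; rewrite /clog /= e ?c ?s mulrC divfK.
Qed.

End ComplexCalculus.

Arguments cdiff_id {R} z.
Arguments cdiff_cst {R} p z.

(** * Integration over the positive half-line *)

Section HalfLine.
Context {R : realType}.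
Local Notation mu := (@lebesgue_measure R).
Local Notation pos := (`]0%R, +oo[%classic : set R).
Implicit Types (f g k v : R -> R) (t : R).

Lemma in_pos t : pos t <-> 0 < t.
Proof. by rewrite /= in_itv /= andbT. Qed.

Lemma measurable_pos_continuous f :
  (forall t, 0 < t -> {for t, continuous f}) -> measurable_fun pos f.
Proof.
move=> cf; apply: open_continuous_measurable_fun => //.
by move=> t; rewrite inE => /in_pos; exact: cf.
Qed.

Lemma integrable_pos_dominated f g : measurable_fun pos f ->
  (forall t, 0 < t -> `|f t| <= g t) -> mu.-integrable pos (EFin \o g) ->
  mu.-integrable pos (EFin \o f).
Proof.
move=> mf fg; apply: le_integrable => //; first exact/measurable_EFinP.
move=> t /in_pos t0 /=; rewrite lee_fin (le_trans (fg _ t0))//.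
exact: ler_norm.
Qed.

(** Compact intervals increasing to the open half-line: integrands may be
    singular at 0, so calculus on segments has to avoid both ends. *)
Definition exhaustion n : set R := `[n.+2%:R^-1, n.+2%:R]%classic.

Lemma exhaustion_bounds n : 0 < (n.+2%:R^-1 : R) < n.+2%:R.
Proof.
rewrite invr_gt0 ltr0n /= (@lt_trans _ _ 1)// ?invf_lt1 ?ltr1n ?ltr0n//.
Qed.

Lemma exhaustion_gt0 n t : exhaustion n t -> 0 < t.
Proof.
have /andP[a0 _] := exhaustion_bounds n.
by rewrite /exhaustion /= in_itv /= => /andP[+ _]; exact: lt_le_trans.
Qed.

Lemma exhaustion_near t : 0 < t -> \forall n \near \oo, exhaustion n t.
Proof.
move=> t0; near=> n; rewrite /exhaustion /= in_itv /=; apply/andP; split.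
  rewrite invf_ple ?posrE ?ltr0n// -natr1 -natr1 -addrA ler_wpDr//.
  by near: n; exact: nbhs_infty_ger.
rewrite -natr1 -natr1 -addrA ler_wpDr//.
by near: n; exact: nbhs_infty_ger.
Unshelve. all: by end_near. Qed.

Lemma exhaustion_cover : \bigcup_n exhaustion n = pos.
Proof.
apply/seteqP; split => t; first by move=> [n _ /exhaustion_gt0/in_pos].
move=> /in_pos/exhaustion_near[n _ /(_ n)]; rewrite /= leqnn => /(_ isT) h.
by exists n.
Qed.

Lemma exhaustion_homo : {homo exhaustion : n m / (n <= m)%N >-> (n <= m)%O}.
Proof.
move=> n m nm; apply/subsetPset => t; rewrite /exhaustion /= !in_itv /=.
move=> /andP[h1 h2]; apply/andP; split.
  by rewrite (le_trans _ h1)// lef_pV2 ?posrE ?ltr0n// ler_nat !ltnS.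
by rewrite (le_trans h2)// ler_nat !ltnS.
Qed.

Lemma integral_exhaustion v k n :
  (forall t, 0 < t -> is_derive t 1 v (k t)) ->
  (forall t, 0 < t -> {for t, continuous k}) ->
  (\int[mu]_(t in exhaustion n) (k t)%:E)%E =
  (v n.+2%:R - v (n.+2%:R^-1))%:E.
Proof.
move=> dv ck; have /andP[a0 ab] := exhaustion_bounds n.
have inA t : t \in `[n.+2%:R^-1, n.+2%:R] -> 0 < t.
  by rewrite in_itv /= => /andP[+ _]; exact: lt_le_trans.
have cv t : 0 < t -> {for t, continuous v}.
  by move=> t0; exact: is_derive_continuous (dv t t0).
rewrite EFinB; apply: continuous_FTC2 => //.
- by apply: continuous_in_subspaceT => t; rewrite inE => /inA; exact: ck.
- split.
  + move=> t tab; have /dv dvt : 0 < t by exact/inA/subset_itv_oo_cc.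
    exact: is_derive_derivable.
  + apply: cvg_at_right_filter; apply: cv; exact: a0.
  + apply: cvg_at_left_filter; apply: cv; exact: lt_trans a0 ab.
- move=> t tab; have /dv dvt : 0 < t by exact/inA/subset_itv_oo_cc.
  by rewrite derive1E derive_val.
Qed.

Lemma cvg_exhaustion v (l0 l1 : R) :
  v t @[t --> 0^'+] --> l0 -> v t @[t --> +oo] --> l1 ->
  (v n.+2%:R - v (n.+2%:R^-1))%:E @[n --> \oo] --> (l1 - l0)%:E.
Proof.
move=> v0 voo; apply: cvg_EFin; first exact: nearW.
apply: cvgB.
  apply: (cvg_comp (fun n => n.+2%:R) v _ voo).
  apply/cvgryPge => M; near=> n.
  rewrite -natr1 -natr1 -addrA ler_wpDr//.
  by near: n; exact: nbhs_infty_ger.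
move: v0 => /cvg_at_rightP; apply; split.
  by move=> n; have /andP[] := exhaustion_bounds n.
by have := @cvg_harmonic R; rewrite -cvg_shiftS.
Unshelve. all: by end_near. Qed.

(** Dominated convergence carries the fundamental theorem of calculus over from
    segments to the half-line. *)
Lemma Rintegral_FTC_pos v k g :
  (forall t, 0 < t -> is_derive t 1 v (k t)) ->
  (forall t, 0 < t -> {for t, continuous k}) ->
  (forall t, 0 < t -> `|k t| <= g t) -> mu.-integrable pos (EFin \o g) ->
  v t @[t --> 0^'+] --> (0 : R) -> v t @[t --> +oo] --> (0 : R) ->
  \int[mu]_(t in pos) k t = 0.
Proof.
move=> dv ck kg ig v0 voo.
have mk : measurable_fun pos k by exact: measurable_pos_continuous.
have lim0 := cvg_exhaustion v0 voo; rewrite subrr in lim0.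
pose f_ n : R -> \bar R := (EFin \o k) \_ (exhaustion n).
have mA n : measurable (exhaustion n) by exact: measurable_itv.
have mf_ n : measurable_fun pos (f_ n).
  apply/(measurable_restrict _ _ _).1 => //.
  by apply/measurable_EFinP; apply: measurable_funS mk => // t [].
have f_k : {ae mu, forall t, pos t -> f_ n t @[n --> \oo] --> (EFin \o k) t}.
  apply/aeW => t /in_pos/exhaustion_near nt; apply: cvg_near_cst.
  by apply: filterS nt => n nt; rewrite /f_ patchE mem_set.
have f_g : {ae mu, forall t n, pos t -> (`|f_ n t| <= (EFin \o g) t)%E}.
  apply/aeW => t n /in_pos t0; rewrite /f_ patchE.
  case: ifP => _; rewrite /= ?abse0 lee_fin ?kg//.
  by rewrite normr0 (le_trans _ (kg _ t0)).
have mk' : measurable_fun pos (EFin \o k) by exact/measurable_EFinP.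
have [_ _ dc] := @dominated_convergence _ _ _ mu pos (measurable_itv _) f_
  (EFin \o k) (EFin \o g) mf_ mk' f_k ig f_g.
have dc' : (fun n => \int[mu]_(t in pos) f_ n t)%E =
    (fun n => (v n.+2%:R - v (n.+2%:R^-1))%:E).
  apply/funext => n; rewrite -integral_mkcondr setIidr.
    exact: integral_exhaustion.
  by move=> t /exhaustion_gt0/in_pos.
rewrite dc' in dc.
by rewrite /Rintegral (cvg_unique _ dc lim0).
Qed.

(** Monotone convergence here replaces domination, which makes integrability a
    consequence ([ge0_integrable_FTC_pos]) rather than an assumption. *)
Lemma ge0_integral_FTC_pos v k (l0 l1 : R) :
  (forall t, 0 < t -> is_derive t 1 v (k t)) ->
  (forall t, 0 < t -> {for t, continuous k}) ->
  (forall t, 0 < t -> 0 <= k t) ->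
  v t @[t --> 0^'+] --> l0 -> v t @[t --> +oo] --> l1 ->
  (\int[mu]_(t in pos) (k t)%:E)%E = (l1 - l0)%:E.
Proof.
move=> dv ck k0 v0 voo.
have mk : measurable_fun pos k by exact: measurable_pos_continuous.
have lim := cvg_exhaustion v0 voo.
have := @ge0_nondecreasing_set_cvg_integral _ (measurableTypeR R) _ exhaustion (EFin \o k) mu
  exhaustion_homo.
have -> : (fun n => \int[mu]_(t in exhaustion n) (EFin \o k) t)%E =
    (fun n => (v n.+2%:R - v (n.+2%:R^-1))%:E).
  by apply/funext => n; exact: integral_exhaustion.
rewrite exhaustion_cover => h.
apply: cvg_unique lim; first exact: ereal_hausdorff.
apply: h.
- by move=> n; exact: measurable_itv.
- move=> n; apply/measurable_EFinP; apply: measurable_funS mk => //.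
  by move=> t /exhaustion_gt0/in_pos.
- by move=> n t /exhaustion_gt0/k0; rewrite lee_fin.
Qed.

Lemma ge0_integrable_FTC_pos v k (l0 l1 : R) :
  (forall t, 0 < t -> is_derive t 1 v (k t)) ->
  (forall t, 0 < t -> {for t, continuous k}) ->
  (forall t, 0 < t -> 0 <= k t) ->
  v t @[t --> 0^'+] --> l0 -> v t @[t --> +oo] --> l1 ->
  mu.-integrable pos (EFin \o k).
Proof.
move=> dv ck k0 v0 voo; apply/integrableP; split.
  by apply/measurable_EFinP; exact: measurable_pos_continuous.
have -> : (\int[mu]_(t in pos) `|(EFin \o k) t|)%E = (l1 - l0)%:E.
  rewrite -(ge0_integral_FTC_pos dv ck k0 v0 voo); apply: eq_integral => t.
  by rewrite inE => /in_pos t0 /=; rewrite ger0_norm// k0.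
exact: ltry.
Qed.

(** A real form of Cauchy's theorem: differentiating under the integral sign in
    [p] yields the integral of the [t]-derivative of [v p], which vanishes as
    [v p] does at both ends.  For a holomorphic function the Cauchy-Riemann
    equations provide such pairs [u], [v]. *)
Lemma Rintegral_deformation (u v k : R -> R -> R) g (q0 q1 p0 p1 : R) :
  q0 < p0 < q1 -> q0 < p1 < q1 ->
  (forall p t, q0 < p < q1 -> 0 < t -> is_derive p 1 (u ^~ t) (k p t)) ->
  (forall p t, q0 < p < q1 -> 0 < t -> is_derive t 1 (v p) (k p t)) ->
  (forall p t, q0 < p < q1 -> 0 < t -> {for t, continuous (k p)}) ->
  (forall p t, q0 < p < q1 -> 0 < t -> `|k p t| <= g t) ->
  mu.-integrable pos (EFin \o g) ->
  (forall p, q0 < p < q1 -> mu.-integrable pos (EFin \o u p)) ->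
  (forall p, q0 < p < q1 -> v p t @[t --> 0^'+] --> (0 : R)) ->
  (forall p, q0 < p < q1 -> v p t @[t --> +oo] --> (0 : R)) ->
  \int[mu]_(t in pos) u p0 t = \int[mu]_(t in pos) u p1 t.
Proof.
move=> hp0 hp1 du dv ck kg ig iu v0 voo.
pose F p := \int[mu]_(t in pos) u p t.
have dF p : q0 < p < q1 -> is_derive p 1 F 0.
  move=> hp.
  have inI x : `]q0, q1[%classic x -> q0 < x < q1 by rewrite /= in_itv.
  have Ip : `]q0, q1[%classic p by rewrite /= in_itv.
  have iu' x : `]q0, q1[%classic x -> mu.-integrable pos (EFin \o u x).
    by move=> /inI; exact: iu.
  have du' x t : `]q0, q1[%classic x -> pos t -> derivable (u ^~ t) x 1.
    by move=> /inI hx /in_pos t0; have := du x t hx t0; exact: is_derive_derivable.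
  have g0 t : 0 <= `|g t| by [].
  have ig' : mu.-integrable pos (EFin \o (fun t => `|g t|)).
    exact: (integrable_norm ig).
  have d1 x t : `]q0, q1[%classic x -> pos t -> partial1of2 u x t = k x t.
    move=> /inI hx /in_pos t0; rewrite /partial1of2 derive1E.
    by have dd := du x t hx t0; rewrite derive_val.
  have gub x t : `]q0, q1[%classic x -> pos t -> `|partial1of2 u x t| <= `|g t|.
    move=> hx t0; rewrite d1//.
    by rewrite (le_trans _ (ler_norm _))// kg//; move/in_pos: t0.
  apply: DeriveDef.
    exact: (@derivable_under_integral R _ _ mu u pos (measurable_itv _) p q0 q1 Ip iu' du' _ g0 ig' gub).
  rewrite -derive1E.
  rewrite (@differentiation_under_integral R _ _ mu u pos (measurable_itv _) p q0 q1 Ip iu' du' _ g0 ig' gub).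
  transitivity (\int[mu]_(t in pos) k p t).
    by apply: eq_Rintegral => t; rewrite inE => t0; rewrite d1.
  apply: (@Rintegral_FTC_pos (v p) (k p) g) => //.
  - by move=> t; exact: dv.
  - by move=> t; exact: ck.
  - by move=> t; exact: kg.
  - exact: v0.
  - exact: voo.
wlog lt01 : p0 p1 hp0 hp1 / p0 < p1.
  move=> wl; have [lt01|lt10|->//] := ltgtP p0 p1; first exact: wl.
  by apply/esym; exact: wl.
have inq x : x \in `[p0, p1] -> q0 < x < q1.
  move: hp0 hp1 => /andP[h1 _] /andP[_ h2].
  by rewrite in_itv /= => /andP[h3 h4]; rewrite (lt_le_trans h1)//= (le_lt_trans h4).
have [| |c _] := @MVT _ F (fun=> 0) p0 p1 lt01.
- by move=> x /subset_itv_oo_cc/inq; exact: dF.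
- apply: derivable_within_continuous => x /inq hx.
  by have := dF x hx; exact: is_derive_derivable.
by rewrite mul0r => /eqP; rewrite subr_eq0 => /eqP.
Qed.

End HalfLine.

(** * Dominating functions *)

Section Dominating.
Context {R : realType}.
Local Notation mu := (@lebesgue_measure R).
Local Notation pos := (`]0%R, +oo[%classic : set R).
Implicit Types (f g k v : R -> R) (c s t M : R).

Lemma integrable_pos_scale f c : mu.-integrable pos (EFin \o f) ->
  mu.-integrable pos (EFin \o (fun t => c * f t)).
Proof. by move=> fi; exact: (integrableZl _ c fi). Qed.

Lemma integrable_pos_add f g : mu.-integrable pos (EFin \o f) ->
  mu.-integrable pos (EFin \o g) ->
  mu.-integrable pos (EFin \o (fun t => f t + g t)).
Proof. by move=> fi gi; exact: (integrableD _ fi gi). Qed.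

Lemma cvg_expR_scale c : 0 < c -> expR (- (c * t)) @[t --> +oo] --> (0 : R).
Proof.
move=> c0; apply: (cvg_comp (fun t => c * t) (fun t => expR (- t))).
  apply/cvgryPge => M; have : \forall t \near +oo, M / c <= t.
    by apply: nbhs_pinfty_ge; rewrite num_real.
  by apply: filterS => t; rewrite ler_pdivrMr// mulrC.
exact: cvgr_expR.
Qed.

Lemma is_derive_linear c t : is_derive t 1 (fun u => c * u) c.
Proof.
apply: (is_derive_eq (is_derive_mul (is_derive_cst c t 1) (is_derive_id t 1))).
by rewrite /cst; ring.
Qed.

Lemma is_derive_opp f t a : is_derive t 1 f a -> is_derive t 1 (fun u => - f u) (- a).
Proof. by move=> df; exact: is_deriveN. Qed.

Lemma integrable_expR c : 0 < c ->
  mu.-integrable pos (EFin \o (fun t => expR (- (c * t)))).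
Proof.
move=> c0; have c0' : c != 0 by rewrite gt_eqF.
have dE t : is_derive t 1 (fun t => expR (- (c * t))) (expR (- (c * t)) * - c).
  exact: is_derive_compose (is_derive_opp (is_derive_linear c t)) (is_derive_expR _).
apply: (@ge0_integrable_FTC_pos _ (fun t => - c^-1 * expR (- (c * t))) _ (- c^-1 * 1) (- c^-1 * 0)).
- move=> t t0.
  apply: (is_derive_eq (is_derive_mul (is_derive_cst (- c^-1) t 1) (dE t))).
  by rewrite /cst; field.
- by move=> t _; exact: is_derive_continuous (dE t).
- by move=> t _; exact: expR_ge0.
- apply: cvgMr; apply: cvg_at_right_filter.
  have -> : 1 = expR (- (c * 0)) by rewrite mulr0 oppr0 expR0.
  exact: is_derive_continuous (dE 0).
- by apply: cvgMr; exact: cvg_expR_scale.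
Qed.

(** On a vertical line in the right half-plane the modulus of [exp (z ^ 2)],
    multiplied by powers of [z] and logarithms, is at most a constant times a
    function of this form. *)
Definition gaussdom M t : R := expR (M * t - t ^+ 2).

Lemma integrable_gaussdom M : mu.-integrable pos (EFin \o gaussdom M).
Proof.
apply: (@integrable_pos_dominated _ _
  (fun t => expR ((M + 1) ^+ 2 / 4) * expR (- (1 * t)))).
- apply: measurable_pos_continuous => t _.
  have d1 := is_derive_sub (is_derive_linear M t)
    (is_derive_mul (is_derive_id t 1) (is_derive_id t 1)).
  have := is_derive_continuous (is_derive_compose d1 (is_derive_expR _)).
  by rewrite /gaussdom; under [X in _ -> {for _, continuous X}]eq_fun do rewrite expr2.
- move=> t _; rewrite ger0_norm ?expR_ge0// -expRD ler_expR -subr_ge0.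
  have -> : (M + 1) ^+ 2 / 4 + - (1 * t) - (M * t - t ^+ 2) =
    ((M + 1) / 2 - t) ^+ 2 by field.
  exact: sqr_ge0.
- exact: integrable_pos_scale (integrable_expR ltr01).
Qed.

Lemma gaussdom_ge0 M t : 0 <= gaussdom M t. Proof. exact: expR_ge0. Qed.

Lemma cvg_gaussdom M : gaussdom M t @[t --> +oo] --> (0 : R).
Proof.
apply: (@squeeze_cvgr _ _ _ _ (cst 0)
   (fun t => expR ((M + 1) ^+ 2 / 4) * expR (- (1 * t)))).
- apply: nearW => t; rewrite gaussdom_ge0/= -expRD ler_expR -subr_ge0.
  have -> : (M + 1) ^+ 2 / 4 + - (1 * t) - (M * t - t ^+ 2) =
    ((M + 1) / 2 - t) ^+ 2 by field.
  exact: sqr_ge0.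
- exact: cvg_cst.
- rewrite -[X in _ --> X](mulr0 (expR ((M + 1) ^+ 2 / 4))).
  by apply: cvgMr; exact: cvg_expR_scale.
Qed.

Definition euler_integrand s c t : R := t `^ (s - 1) * expR (- (c * t)).

Lemma is_derive_powR s t : 0 < t ->
  is_derive t 1 (fun u => u `^ s) (s * t `^ (s - 1)).
Proof. by move=> t0; exact: is_derive1_powR. Qed.

Lemma euler_integrand_ge0 s c t : 0 <= euler_integrand s c t.
Proof. by rewrite mulr_ge0 ?powR_ge0 ?expR_ge0. Qed.

Lemma continuous_euler_integrand s c t : 0 < t ->
  {for t, continuous (euler_integrand s c)}.
Proof.
move=> t0; apply: is_derive_continuous.
apply: is_derive_mul; first exact: is_derive_powR.
Qed.

(** The maximum, attained at [t = p / c], comes from [ln u <= u - 1] at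
    [u = c * t / p]. *)
Lemma powR_expR_le p c t : 0 < p -> 0 < c -> 0 < t ->
  t `^ p * expR (- (c * t)) <= expR (p * ln (p / c) - p).
Proof.
move=> p0 c0 t0; rewrite /powR gt_eqF// -expRD ler_expR.
have q0 : 0 < p / c by rewrite divr_gt0.
have := le_ln1Dx (_ : -1 < t / (p / c) - 1).
rewrite ltrBrDl subrr divr_gt0// addrC subrK => /(_ isT).
rewrite ln_div ?posrE// => h.
have : p * (ln t - ln (p / c)) <= p * (t / (p / c) - 1) by rewrite ler_pM2l.
have -> : p * (t / (p / c) - 1) = c * t - p by field; rewrite !gt_eqF.
by rewrite mulrBr; lra.
Qed.

(** Comparison with [t ^ (s - 1) * (1 + t) ^ (- (s + 1))], whose primitive
    [(t / (1 + t)) ^ s / s] is explicit: it has the right singularity at 0 and is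
    integrable at infinity. *)
Lemma integrable_euler s c : 0 < s -> 0 < c ->
  mu.-integrable pos (EFin \o euler_integrand s c).
Proof.
move=> s0 c0.
pose k t := t `^ (s - 1) * (1 + t) `^ (- (s + 1)).
pose v t := (t / (1 + t)) `^ s / s.
have d1 t : is_derive t 1 (fun u => 1 + u) 1.
  by apply: (is_derive_eq (is_derive_add (is_derive_cst (1 : R) t (1 : R)) (is_derive_id t (1 : R)))); rewrite add0r.
have t1 t : 0 < t -> 0 < 1 + t by move=> t0; rewrite addr_gt0.
have ik : mu.-integrable pos (EFin \o k).
  apply: (@ge0_integrable_FTC_pos _ v k 0 s^-1).
  - move=> t t0; have h := t1 _ t0; have hn : 1 + t != 0 by rewrite gt_eqF.
    have dq := is_derive_mul (is_derive_id t 1) (is_derive_inv (d1 t) hn).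
    have q0 : 0 < t / (1 + t) by rewrite divr_gt0.
    apply: (is_derive_eq (is_derive_mul (is_derive_compose dq (is_derive_powR s q0)) (is_derive_cst s^-1 t 1))).
    have e1 : (1 + t)^-1 `^ (s - 1) = ((1 + t) `^ (s - 1))^-1.
      by rewrite -[(1 + t)^-1]powR_inv1 ?ltW// -powRrM mulN1r powRN.
    have e2 : (1 + t) `^ (- (s + 1)) =
        ((1 + t) `^ (s - 1))^-1 * (1 + t)^-1 * (1 + t)^-1.
      rewrite powRN (_ : s + 1 = s - 1 + 1 + 1); last by ring.
      by rewrite !powRD ?hn ?implybT// powRr1 ?ltW// !invfM.
    have p0 : (1 + t) `^ (s - 1) != 0 by rewrite gt_eqF// powR_gt0.
    rewrite /cst /k (powRM (s - 1)) ?invr_ge0 ?ltW// e1 e2.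
    by field; rewrite hn p0 gt_eqF.
  - move=> t t0; apply: is_derive_continuous.
    apply: is_derive_mul; first exact: is_derive_powR.
    exact: is_derive_compose (d1 t) (is_derive_powR _ (t1 _ t0)).
  - by move=> t _; rewrite mulr_ge0 ?powR_ge0.
  - rewrite /v -[X in _ --> X](mul0r s^-1); apply: cvgMl.
    apply: (@squeeze_cvgr _ _ _ _ (cst 0) (fun t => t `^ s)).
    + near=> t; have t0 : 0 < t by near: t; exact: nbhs_right_gt.
      have h := t1 _ t0.
      rewrite /= powR_ge0 /=.
      apply: ge0_ler_powR; rewrite ?nnegrE ?divr_ge0 ?(ltW s0) ?(ltW t0) ?(ltW h)//.
      by rewrite ler_pdivrMr// ler_peMr ?(ltW t0)// lerDl ltW.
    + exact: cvg_cst.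
    + exact: powR_cvg0.
  - rewrite /v -[X in _ --> X]mul1r; apply: cvgMl.
    have : {for 1, continuous (fun u : R => u `^ s)}.
      exact: is_derive_continuous (is_derive_powR s ltr01).
    rewrite /prop_for /continuous_at /= powR1 => h; apply: (cvg_comp _ _ _ h).
    apply/cvgrPdist_le => e e0; have := nbhs_pinfty_ge (num_real e^-1).
    apply: filterS2 (nbhs_pinfty_gt (num_real (0 : R))) => t t0 te; have ht := t1 _ t0.
    rewrite (_ : 1 - _ = (1 + t)^-1); last by field; rewrite gt_eqF.
    by rewrite ger0_norm ?invr_ge0 ?(ltW ht)// invf_ple ?posrE// ler_wpDl.
pose K := expR c * expR ((s + 1) * ln ((s + 1) / c) - (s + 1)).
apply: (@integrable_pos_dominated _ _ (fun t => K * k t)).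
- by apply: measurable_pos_continuous => t; exact: continuous_euler_integrand.
- move=> t t0; have h := t1 _ t0.
  rewrite ger0_norm ?euler_integrand_ge0// /euler_integrand /k mulrCA.
  rewrite ler_wpM2l ?powR_ge0// powRN ler_pdivlMr ?powR_gt0//.
  have := powR_expR_le (_ : 0 < s + 1) c0 h.
  rewrite addr_gt0// => /(_ isT) hh.
  rewrite (_ : expR (- (c * t)) = expR c * expR (- (c * (1 + t)))); last first.
    by rewrite -expRD; congr expR; ring.
  by rewrite -mulrA ler_pM2l ?expR_gt0// mulrC.
- exact: integrable_pos_scale.
Unshelve. all: by end_near. Qed.

End Dominating.

(** * Moving a vertical line of integration *)

Section Contour.
Context {R : realType}.
Local Notation C := R[i].
Local Notation mu := (@lebesgue_measure R).
Local Notation pos := (`]0%R, +oo[%classic : set R).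
Implicit Types (a l t x y gam al M : R) (z w : C) (F G : C -> C).

(** Functions holomorphic for [Re z > l], real on the real axis, and with Gaussian
    decay along vertical lines, locally uniformly in the real part.  As [Im F]
    vanishes on the axis, the real parts of integrals over the upper half of a
    vertical line obey Cauchy's theorem without a boundary term.  The second
    derivative serves for the continuity of the first. *)
Record admissible l F F' : Prop := Admissible {
  adm_diff : forall z, l < Re z -> cdiff F z (F' z) ;
  adm_diff2 : forall z, l < Re z -> exists d, cdiff F' z d ;
  adm_real : forall a, l < a -> Im (F a%:C) = 0 ;
  adm_bound : forall q0 q1, l < q0 -> exists A M, forall a y,
    q0 < a < q1 -> 0 < y ->
    cmod (F (a +i* y)) <= A * gaussdom M y /\ cmod (F' (a +i* y)) <= A * gaussdom M y }.

Section Admissible.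
Variables (l : R) (F F' : C -> C).
Hypothesis adm : admissible l F F'.

Let dFy a y : l < a -> cderiv (fun s => F (a +i* s)) y (F' (a +i* y) * 'i%C).
Proof.
move=> la; apply: (adm_diff adm (z := a +i* y)) => //.
exact: cderiv_vertical.
Qed.

Let dFa a y : l < a -> cderiv (fun s => F (s +i* y)) a (F' (a +i* y)).
Proof.
move=> la; rewrite -[F' _]mulr1; apply: (adm_diff adm (z := a +i* y)) => //.
exact: cderiv_horizontal.
Qed.

Let cF' a y : l < a -> {for y, continuous (fun s => Re (F' (a +i* s)))}.
Proof.
move=> la; have [d dF'] := adm_diff2 adm (z := a +i* y) la.
by apply: (@cderiv_continuous_Re _ (fun s => F' (a +i* s))); apply: dF' => //; exact: cderiv_vertical.
Qed.

Let bound a : l < a -> exists A M, forall y, 0 < y ->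
  cmod (F (a +i* y)) <= A * gaussdom M y /\ cmod (F' (a +i* y)) <= A * gaussdom M y.
Proof.
move=> la; have la2 : l < (l + a) / 2 by rewrite midf_lt.
have [A [M h]] := adm_bound adm (a + 1) la2.
by exists A, M => y y0; apply: h => //; rewrite midf_lt//= ltrDl.
Qed.

Lemma integrable_admissible a : l < a ->
  mu.-integrable pos (EFin \o (fun y => Re (F (a +i* y)))).
Proof.
move=> la; have [A [M h]] := bound la.
apply: (@integrable_pos_dominated _ _ (fun y => A * gaussdom M y)).
- apply: measurable_pos_continuous => y y0.
  exact: cderiv_continuous_Re (dFy y la).
- by move=> y y0; rewrite (le_trans (normRe_le _))//; have [] := h y y0.
- exact: integrable_pos_scale (integrable_gaussdom M).
Qed.

Let cvgF0 a : l < a -> Im (F (a +i* y)) @[y --> 0^'+] --> (0 : R).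
Proof.
move=> la; apply: cvg_at_right_filter.
rewrite -[X in _ --> X](adm_real adm la).
exact: is_derive_continuous (dFy 0 la).2.
Qed.

Let cvgFoo a : l < a -> Im (F (a +i* y)) @[y --> +oo] --> (0 : R).
Proof.
move=> la; have [A [M h]] := bound la.
have hh : \forall y \near +oo, `|Im (F (a +i* y))| <= A * gaussdom M y.
  apply: filterS (nbhs_pinfty_gt (num_real (0 : R))) => y y0.
  by rewrite (le_trans (normIm_le _))//; have [] := h y y0.
have lim : A * gaussdom M y @[y --> +oo] --> (0 : R).
  by rewrite -[X in _ --> X](mulr0 A); apply: cvgMr; exact: cvg_gaussdom.
apply: norm_cvg0; apply: (squeeze_cvgr _ (cvg_cst 0) lim).
by apply: filterS hh => y ->; rewrite normr_ge0.
Qed.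

(** By the Cauchy-Riemann equations the [a]-derivative of [Re F] is the
    [y]-derivative of [Im F], which vanishes on the axis and at infinity. *)
Lemma Rintegral_admissible_shift a0 a1 : l < a0 -> l < a1 ->
  \int[mu]_(y in pos) Re (F (a0 +i* y)) = \int[mu]_(y in pos) Re (F (a1 +i* y)).
Proof.
move=> la0 la1.
pose m := Num.min a0 a1; pose q0 := (l + m) / 2; pose q1 := Num.max a0 a1 + 1.
have lm : l < m by rewrite lt_min la0.
have lq0 : l < q0 by rewrite midf_lt.
have q0m : q0 < m by rewrite midf_lt.
have [A [M h]] := adm_bound adm q1 lq0.
have lq p : q0 < p < q1 -> l < p by move=> /andP[q0p _]; exact: lt_trans q0p.
apply: (@Rintegral_deformation _ (fun a y => Re (F (a +i* y)))
  (fun a y => Im (F (a +i* y))) (fun a y => Re (F' (a +i* y)))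
  (fun y => A * gaussdom M y) q0 q1).
- by rewrite (lt_le_trans q0m) ?ge_min ?lexx//= ltr_pwDr// le_max lexx.
- by rewrite (lt_le_trans q0m) ?ge_min ?lexx ?orbT//= ltr_pwDr// le_max lexx orbT.
- by move=> a y /lq la y0; exact: (dFa y la).1.
- move=> a y /lq la y0; apply: (is_derive_eq (dFy y la).2).
  by rewrite ImM /=; ring.
- by move=> a y /lq la y0; exact: cF'.
- move=> a y ha y0; rewrite (le_trans (normRe_le _))//.
  by have [] := h a y ha y0.
- exact: integrable_pos_scale (integrable_gaussdom M).
- by move=> a /lq; exact: integrable_admissible.
- by move=> a /lq; exact: cvgF0.
- by move=> a /lq; exact: cvgFoo.
Qed.

(** The integrand is the [y]-derivative of [Im F], whose end values vanish. *)
Lemma Rintegral_admissible_derivative a : l < a ->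
  \int[mu]_(y in pos) Re (F' (a +i* y)) = 0.
Proof.
move=> la; have [A [M h]] := bound la.
apply: (@Rintegral_FTC_pos _ (fun y => Im (F (a +i* y))) _
  (fun y => A * gaussdom M y)).
- move=> y y0; apply: (is_derive_eq (dFy y la).2).
  by rewrite ImM /=; ring.
- by move=> y y0; exact: cF'.
- move=> y y0; rewrite (le_trans (normRe_le _))//.
  by have [] := h y y0.
- exact: integrable_pos_scale (integrable_gaussdom M).
- exact: cvgF0.
- exact: cvgFoo.
Qed.

End Admissible.

Lemma cos_half_le al (psi : R) : 0 <= al < 1 -> `|psi| <= al * pi ->
  0 < cos (al * pi / 2) <= cos (psi / 2).
Proof.
move=> /andP[al0 al1] hpsi; have pi0 := pi_gt0 R.
have h0 : 0 <= al * pi by rewrite mulr_ge0// ltW.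
have h1 : al * pi < pi by rewrite gtr_pMl.
apply/andP; split; first by apply: cos_gt0_pihalf; lra.
rewrite -[leRHS]cos_norm normrM (ger0_norm (_ : 0 <= 2^-1 :> R)) ?invr_ge0//.
rewrite leNgt ltr_cos ?in_itv/= -?leNgt; have ? := normr_ge0 psi; lra.
Qed.

(** With [cexp z = r e^(i psi)],
    [|r e^(i psi) + x| ^ 2 = (r - x) ^ 2 + 4 r x cos (psi / 2) ^ 2].  This keeps
    the denominators of all kernels below away from 0, uniformly as long as the
    argument stays away from the negative real axis. *)
Lemma cmod_cexpD_ge al x z : 0 <= al < 1 -> 0 <= x -> `|Im z| <= al * pi ->
  cos (al * pi / 2) * (expR (Re z) + x) <= cmod (cexp z + x%:C).
Proof.
move=> hal x0 hz; have /andP[c0 cle] := cos_half_le hal hz.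
set r := expR (Re z); have r0 : 0 <= r by exact: expR_ge0.
rewrite cmodE -[leLHS]ger0_norm ?mulr_ge0 ?addr_ge0 ?(ltW c0)//.
rewrite -sqrtr_sqr ler_wsqrtr// !ReImE /= -/r addr0.
have cosz : cos (Im z) = 2 * cos (Im z / 2) ^+ 2 - 1.
  have {1}-> : Im z = Im z / 2 *+ 2 by rewrite -mulr_natr divfK.
  by rewrite cos_mulr2n mulr_natl.
have s2 := cos2Dsin2 (Im z).
rewrite cosz; set c := cos (Im z / 2) in cosz cle *; set s := sin (Im z) in s2 *; set c0' := cos _ in c0 cle *.
have -> : (r * (2 * c ^+ 2 - 1) + x) ^+ 2 + (r * s) ^+ 2 = (r - x) ^+ 2 + 4 * r * x * c ^+ 2.
  have : (r * s) ^+ 2 = r ^+ 2 * (1 - (2 * c ^+ 2 - 1) ^+ 2).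
    by rewrite exprMn -cosz; congr (_ * _); lra.
  by move=> ->; ring.
have cc : c0' ^+ 2 <= c ^+ 2 by rewrite ler_pXn2r ?nnegrE// ltW// (lt_le_trans c0).
have c1 : c0' ^+ 2 <= 1 by rewrite exprn_ile1 ?(ltW c0)// cos_le1.
rewrite exprMn.
have -> : (r + x) ^+ 2 = (r - x) ^+ 2 + 4 * r * x by ring.
rewrite mulrDr lerD//.
  by rewrite ler_piMl ?sqr_ge0.
by rewrite mulrC ler_wpM2l ?mulr_ge0.
Qed.

End Contour.

(** * Complex powers and the integral kernel *)

Section Kernel.
Context {R : realType}.
Local Notation C := R[i].
Implicit Types (a l t x y g al M : R) (z w : C) (F G : C -> C).

Definition cpow z g : C := cexp (g%:C * clog z).

Lemma cpow0 z : cpow z 0 = 1.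
Proof. by rewrite /cpow mul0r cexp0. Qed.

Lemma cpow1 z : 0 < Re z -> cpow z 1 = z.
Proof. by move=> z0; rewrite /cpow mul1r clogK. Qed.

Lemma cpowD z g h : cpow z (g + h) = cpow z g * cpow z h.
Proof. by rewrite /cpow -cexpD -mulrDl rmorphD. Qed.

Lemma cpowN z g : cpow z (- g) = (cpow z g)^-1.
Proof. by rewrite /cpow -cexpN rmorphN mulNr. Qed.

Lemma cpow_neq0 z g : cpow z g != 0.
Proof. exact: cexp_neq0. Qed.

Lemma cpowX z g n : cpow z g ^+ n = cpow z (g *+ n).
Proof. by rewrite /cpow cexpXn rmorphMn mulrnAl. Qed.

Lemma Re_clog z : 0 < Re z -> Re (clog z) = ln (cmod z).
Proof.
move=> z0; have n0 : 0 < Re z ^+ 2 + Im z ^+ 2.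
  by rewrite ltr_wpDr ?sqr_ge0 ?exprn_gt0.
by rewrite cmodE -powR12_sqrt ?ltW// ln_powR mulrC.
Qed.

Lemma cmod_cpow z g : 0 < Re z -> cmod (cpow z g) = expR (g * ln (cmod z)).
Proof. by move=> z0; rewrite cmod_cexp ReM Re_clog//= mul0r subr0. Qed.

Lemma Im_cpow_arg z g : `|Im (g%:C * clog z)| <= `|g| * (pi / 2).
Proof.
rewrite ImM /= mul0r addr0 normrM ler_wpM2l// ler_norml.
by rewrite ltW ?atan_gtNpi2//= ltW ?atan_ltpi2.
Qed.

Lemma cmod_cpowD_ge al x z : 0 <= al < 1 -> 0 <= x ->
  cos (al * pi / 2) * (cmod (cpow z (2 * al)) + x) <= cmod (cpow z (2 * al) + x%:C).
Proof.
move=> hal x0; rewrite [in leLHS]cmod_cexp; apply: cmod_cexpD_ge => //.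
have /andP[al0 _] := hal.
rewrite (le_trans (Im_cpow_arg _ _))// ger0_norm ?mulr_ge0//.
by rewrite (_ : 2 * al * (pi / 2) = al * pi)//; field.
Qed.

Lemma cos_al_gt0 al : 0 <= al < 1 -> 0 < cos (al * pi / 2 : R).
Proof.
move=> hal; have h0 : `|0 : R| <= al * pi.
  by rewrite normr0 mulr_ge0 ?pi_ge0//; case/andP: hal.
by have /andP[] := cos_half_le hal h0.
Qed.

Lemma cpowD_neq0 al x z : 0 <= al < 1 -> 0 <= x -> cpow z (2 * al) + x%:C != 0.
Proof.
move=> hal x0; rewrite -cmod_gt0 (lt_le_trans _ (cmod_cpowD_ge z hal x0))//.
rewrite mulr_gt0 ?cos_al_gt0// ltr_pwDl//.
by rewrite cmod_gt0 cpow_neq0.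
Qed.

Lemma cdiff_cpow z g : 0 < Re z -> cdiff (cpow ^~ g) z (g%:C / z * cpow z g).
Proof.
move=> z0; have d := cdiff_cexp (cdiffM (cdiff_cst g%:C z) (cdiff_clog z0)).
by apply: (cdiff_eq d); rewrite mulr0 addr0 mulrC.
Qed.

(** With [zeta = z ^ 2], the last factor is the denominator [zeta ^ al + x] of the
    classical contour integral of the Mittag-Leffler function.  In the variable
    [z] the cut plane becomes the half-plane [0 < Re z], and the contour a
    vertical line. *)
Definition kern g al x z : C :=
  cexp (z * z) * cpow z g * (cpow z (2 * al) + x%:C)^-1.

Definition kern_dlog g al x z : C :=
  z + z + g%:C * z^-1 -
  (2 * al)%:C * z^-1 * (cpow z (2 * al) * (cpow z (2 * al) + x%:C)^-1).

Definition kern' g al x z : C := kern g al x z * kern_dlog g al x z.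

Lemma Re_gt0_neq0 z : 0 < Re z -> z != 0.
Proof. by case: z => a b /= a0; rewrite eq_complex /= gt_eqF. Qed.

Lemma cdiff_kern g al x z : 0 <= al < 1 -> 0 <= x -> 0 < Re z ->
  cdiff (kern g al x) z (kern' g al x z).
Proof.
move=> hal x0 z0; have n0 := cpowD_neq0 z hal x0; have zn0 := Re_gt0_neq0 z0.
have d := cdiffM (cdiffM (cdiff_cexp (cdiffM (cdiff_id z) (cdiff_id z)))
  (cdiff_cpow g z0))
  (cdiffV (cdiffD (cdiff_cpow (2 * al) z0) (cdiff_cst x%:C z)) n0).
apply: (cdiff_eq d); rewrite /kern' /kern /kern_dlog /=.
by field; rewrite n0 zn0.
Qed.

Lemma cdiff_kern' g al x z : 0 <= al < 1 -> 0 <= x -> 0 < Re z ->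
  exists d, cdiff (kern' g al x) z d.
Proof.
move=> hal x0 z0; have n0 := cpowD_neq0 z hal x0; have zn0 := Re_gt0_neq0 z0.
have dV : cdiff (fun z => z^-1) z (- (1 / z ^+ 2)) := cdiffV (cdiff_id z) zn0.
have dD := cdiffV (cdiffD (cdiff_cpow (2 * al) z0) (cdiff_cst x%:C z)) n0.
have dI := cdiff_id z.
have := cdiffM (cdiff_kern g hal x0 z0) (cdiffD (cdiffD (cdiffD dI dI)
  (cdiffM (cdiff_cst g%:C z) dV)) (cdiffM (cdiff_cst (-1) z)
   (cdiffM (cdiffM (cdiff_cst (2 * al)%:C z) dV)
     (cdiffM (cdiff_cpow (2 * al) z0) dD)))).
set d := (X in cdiff _ z X) => hd; exists d.
rewrite (_ : kern' g al x = fun s => kern g al x s * (s + s + g%:C / s +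
  -1 * ((2 * al)%:C / s * (cpow s (2 * al) / (cpow s (2 * al) + x%:C))))) //.
by apply/funext => s; rewrite /kern' /kern_dlog mulN1r.
Qed.

Lemma cpow_real a g : cpow a%:C g = (expR (g * (ln (a ^+ 2) / 2)))%:C.
Proof.
apply: complexP; rewrite /= ?mul0r /clog /= ?mul0r ?atan0 ?mulr0 ?addr0 ?mul0r ?subr0 ?cos0 ?sin0 ?mulr1 ?mulr0//.
by rewrite expr0n addr0.
Qed.

Lemma kern_real g al x a : Im (kern g al x a%:C) = 0.
Proof.
have e : cexp (a%:C * a%:C) = (expR (a * a))%:C.
  by apply: complexP; rewrite -rmorphM /= ?cos0 ?sin0 ?mulr1 ?mulr0.
by rewrite /kern e !cpow_real -rmorphD -fmorphV -!rmorphM.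
Qed.

Lemma expR_ge y : y <= expR y.
Proof. by rewrite (le_trans _ (expR_ge1Dx y))// lerDr. Qed.

Lemma ln_cmod_bound q0 q1 a y : 0 < q0 -> q0 < a < q1 -> 0 < y ->
  `|ln (cmod (a +i* y))| <= q1 + q0^-1 + y.
Proof.
move=> q00 /andP[q0a aq1] y0; have a0 : 0 < a by exact: lt_trans q0a.
have am : a <= cmod (a +i* y) by rewrite (le_trans _ (normRe_le _))//= ler_norm.
have m0 : 0 < cmod (a +i* y) by exact: lt_le_trans am.
have lnle (u : R) : 0 < u -> ln u <= u - 1.
  move=> u0; have := @le_ln1Dx R (u - 1); rewrite addrCA subrr addr0; apply.
  by rewrite ltrBrDl subrr.
rewrite ler_norml; apply/andP; split.
  have : ln (cmod (a +i* y))^-1 <= q0^-1.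
    have mV : 0 < (cmod (a +i* y))^-1 by rewrite invr_gt0.
    rewrite (le_trans (lnle _ mV))// lerBlDl ler_wpDl// lef_pV2 ?posrE//.
    exact: le_trans (ltW q0a) am.
  rewrite lnV ?posrE//; have : 0 < q1 by exact: lt_trans a0 aq1.
  by move: y0; lra.
have : cmod (a +i* y) <= a + y.
  by rewrite (le_trans (cmod_le _))//= (ger0_norm (ltW a0)) (ger0_norm (ltW y0)).
have := lnle _ m0; have : 0 < q0^-1 by rewrite invr_gt0.
by move: aq1 y0; lra.
Qed.

(** In a strip [q0 < Re z < q1] the logarithm of [|z|] is at most a constant plus
    [y] in absolute value, so that powers of [z] cost a factor [exp (N * y)],
    while [exp (z ^ 2)] contributes [exp (- y ^ 2)]. *)
Lemma kern_bound g al x : 0 <= al < 1 -> 0 <= x ->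
  forall q0 q1, 0 < q0 -> exists A M, forall a y,
    q0 < a < q1 -> 0 < y ->
    cmod (kern g al x (a +i* y)) <= A * gaussdom M y /\
    cmod (kern' g al x (a +i* y)) <= A * gaussdom M y.
Proof.
move=> hal x0 q0 q1 q00.
set c := cos (al * pi / 2); have c0 : 0 < c := cos_al_gt0 hal.
have al0 : 0 <= al by case/andP: hal.
pose B := q1 + q0^-1; pose N := `|g| + 2 * al.
have N0 : 0 <= N by rewrite addr_ge0// mulr_ge0.
pose A0 := expR (q1 ^+ 2 + N * B) / c.
pose D := 2 * (q1 + 1) + `|g| / q0 + 2 * al / q0 / c.
exists (A0 * (1 + `|D|)), (N + 1) => a y haq y0.
have /andP[q0a aq1] := haq; have a0 : 0 < a by exact: lt_trans q0a.
have q10 : 0 < q1 by exact: lt_trans aq1.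
set z := a +i* y; have z0 : 0 < Re z by [].
set w := cpow z (2 * al).
have lb := ln_cmod_bound q00 haq y0; rewrite -/z -/B in lb.
have By0 : 0 <= B + y by rewrite (le_trans _ lb).
have w0 : 0 < cmod w by rewrite cmod_gt0 cpow_neq0.
have den : c * cmod w <= cmod (w + x%:C).
  apply: le_trans (cmod_cpowD_ge z hal x0).
  by rewrite ler_wpM2l ?(ltW c0)// lerDl.
have den0 : 0 < cmod (w + x%:C) by rewrite cmod_gt0 cpowD_neq0.
have wx : cmod w / cmod (w + x%:C) <= c^-1.
  by rewrite ler_pdivrMr// mulrC ler_pdivlMr// mulrC.
have am : a <= cmod z by rewrite (le_trans _ (normRe_le _))//= ler_norm.
have mz : (cmod z)^-1 <= q0^-1.
  rewrite lef_pV2 ?posrE ?(lt_le_trans a0 am)//.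
  exact: le_trans (ltW q0a) am.
have kb : cmod (kern g al x z) <= A0 * gaussdom N y.
  rewrite /kern !cmodM cmodV -/w cmod_cexp cmod_cpow//.
  have e1 : expR (Re (z * z)) <= expR (q1 ^+ 2) * expR (- y ^+ 2).
    rewrite -expRD ler_expR ReM /= -!expr2 lerD2r.
    by rewrite ler_pXn2r ?nnegrE ?ltW.
  have e2 : expR (g * ln (cmod z)) * (cmod w)^-1 <= expR (N * (B + y)).
    rewrite cmod_cpow// -expRN -expRD ler_expR /N [leRHS]mulrDl.
    apply: lerD.
      by rewrite (le_trans (ler_norm _))// normrM ler_wpM2l.
    by rewrite (le_trans (ler_norm _))// normrN normrM ger0_norm ?mulr_ge0// ler_wpM2l ?mulr_ge0.
  rewrite -mulrA.
  apply: (@le_trans _ _ (expR (q1 ^+ 2) * expR (- y ^+ 2) * (expR (N * (B + y)) * c^-1))).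
    apply: ler_pM => //; rewrite ?expR_ge0 ?mulr_ge0 ?expR_ge0 ?invr_ge0 ?(ltW den0)//.
    apply: le_trans (_ : expR (g * ln (cmod z)) * ((cmod w)^-1 * c^-1) <= _).
      rewrite ler_wpM2l ?expR_ge0// -invfM lef_pV2 ?posrE ?mulr_gt0//.
      by rewrite mulrC.
    by rewrite mulrA ler_wpM2r ?invr_ge0 ?(ltW c0).
  rewrite /A0 /gaussdom le_eqVlt; apply/orP; left; apply/eqP.
  rewrite (_ : _ - y ^+ 2 = N * y - y ^+ 2)// !expRD mulrDr !expRD.
  by ring.
have gm : gaussdom N y <= gaussdom (N + 1) y.
  by rewrite ler_expR lerD2r ler_wpM2r ?(ltW y0)// lerDl.
have gm1 : expR y * gaussdom N y = gaussdom (N + 1) y.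
  by rewrite /gaussdom -expRD; congr expR; ring.
have A00 : 0 <= A0 by rewrite mulr_ge0 ?expR_ge0 ?invr_ge0 ?(ltW c0).
split.
  rewrite (le_trans kb)// -mulrA ler_wpM2l//.
  rewrite -[leLHS]mul1r ler_pM ?gaussdom_ge0//.
  by rewrite lerDl.
rewrite /kern' cmodM.
have ey : 1 <= expR y by rewrite -expR0 ler_expR ltW.
have lb2 : cmod (kern_dlog g al x z) <= (1 + `|D|) * expR y.
  rewrite /kern_dlog.
  have zle : cmod z <= (q1 + 1) * expR y.
    rewrite (le_trans (cmod_le _))//= !ger0_norm ?(ltW a0) ?(ltW y0)//.
    rewrite mulrDl mul1r lerD ?expR_ge//.
    by rewrite (le_trans (ltW aq1))// ler_peMr// ltW.
  apply: (@le_trans _ _ (D * expR y)); last first.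
    rewrite ler_wpM2r ?expR_ge0//.
    by rewrite (le_trans (ler_norm _))// lerDr.
  apply: le_trans (cmodB _ _) _.
  have t1 : cmod (z + z) <= 2 * (q1 + 1) * expR y.
    apply: le_trans (cmodD _ _) _.
    have -> : 2 * (q1 + 1) * expR y = (q1 + 1) * expR y + (q1 + 1) * expR y by ring.
    exact: lerD.
  have t2 : cmod (g%:C * z^-1) <= `|g| / q0 * expR y.
    rewrite cmodM cmod_real cmodV -[leLHS]mulr1 ler_pM// ?mulr_ge0 ?invr_ge0 ?cmod_ge0//.
    by rewrite ler_wpM2l.
  have t3 : cmod ((2 * al)%:C * z^-1 * (w * (w + x%:C)^-1)) <= 2 * al / q0 / c * expR y.
    rewrite 3!cmodM !cmodV cmod_real ger0_norm ?mulr_ge0// -[leLHS]mulr1.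
    rewrite ler_pM ?mulr_ge0 ?invr_ge0 ?cmod_ge0//.
    rewrite ler_pM ?mulr_ge0 ?invr_ge0 ?cmod_ge0//.
    by rewrite ler_wpM2l ?mulr_ge0.
  have -> : D * expR y = 2 * (q1 + 1) * expR y + `|g| / q0 * expR y +
    2 * al / q0 / c * expR y by rewrite /D; ring.
  apply: lerD => //.
  by rewrite (le_trans (cmodD _ _))// lerD.
apply: (@le_trans _ _ (A0 * gaussdom N y * ((1 + `|D|) * expR y))).
  by rewrite ler_pM ?cmod_ge0.
by rewrite -gm1 le_eqVlt; apply/orP; left; apply/eqP; ring.
Qed.

Lemma admissible_kern g al x : 0 <= al < 1 -> 0 <= x ->
  admissible 0 (kern g al x) (kern' g al x).
Proof.
move=> hal x0; split.
- by move=> z; exact: cdiff_kern.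
- by move=> z; exact: cdiff_kern'.
- by move=> a _; exact: kern_real.
- by move=> q0 q1; exact: kern_bound.
Qed.

Lemma admissible_gauss l :
  admissible l (fun z => cexp (z * z)) (fun z => cexp (z * z) * (z + z)).
Proof.
have dI z := @cdiff_id R z.
have dE z : cdiff (fun z => cexp (z * z)) z (cexp (z * z) * (z + z)).
  have := cdiff_cexp (cdiffM (dI z) (dI z)).
  by move=> /cdiff_eq; apply; rewrite /= mulr1.
split.
- by move=> z _; exact: dE.
- by move=> z _; eexists; exact: cdiffM (dE z) (cdiffD (dI z) (dI z)).
- by move=> a _; rewrite -rmorphM /= sin0 mulr0.
- move=> q0 q1 _; pose Q := `|q0| + `|q1| + 1.
  exists (expR (Q ^+ 2) * (2 * Q + 2)), 1 => a y /andP[q0a aq1] y0.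
  have aQ : `|a| <= Q.
    have := ler_norm q1; have := ler_norm (- q0); rewrite normrN => h1 h2.
    have := normr_ge0 q0; have := normr_ge0 q1.
    by rewrite ler_norml /Q => h3 h4; apply/andP; split; lra.
  have Q0 : 0 <= Q by rewrite (le_trans _ aQ).
  have ey : 1 <= expR y by rewrite -expR0 ler_expR ltW.
  have kb : cmod (cexp ((a +i* y) * (a +i* y))) <= expR (Q ^+ 2) * expR (- y ^+ 2).
    rewrite cmod_cexp -expRD ler_expR ReM /= -!expr2 lerD2r.
    by rewrite -real_normK ?num_real// ler_pXn2r ?nnegrE.
  have gE : gaussdom 1 y = expR (- y ^+ 2) * expR y.
    by rewrite /gaussdom -expRD mul1r addrC.
  have zle : cmod (a +i* y + a +i* y) <= (2 * Q + 2) * expR y.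
    apply: le_trans (cmodD _ _) _.
    have -> : (2 * Q + 2) * expR y = (Q + 1) * expR y + (Q + 1) * expR y by ring.
    suff h : cmod (a +i* y) <= (Q + 1) * expR y by exact: lerD.
    rewrite (le_trans (cmod_le _))//= (ger0_norm (ltW y0)).
    rewrite mulrDl mul1r lerD ?expR_ge//.
    by rewrite (le_trans aQ)// ler_peMr.
  have Q1 : 1 <= 2 * Q + 2 by lra.
  split.
    rewrite (le_trans kb)// -mulrA ler_wpM2l ?expR_ge0// gE mulrCA.
    by rewrite ler_peMr ?expR_ge0// mulr_ege1.
  rewrite cmodM.
  apply: (@le_trans _ _ (expR (Q ^+ 2) * expR (- y ^+ 2) * ((2 * Q + 2) * expR y))).
    by rewrite ler_pM ?cmod_ge0.
  by rewrite gE le_eqVlt; apply/orP; left; apply/eqP; ring.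
Qed.

End Kernel.

(** * Substitution and exchange of integrals *)

Section Substitution.
Context {R : realType}.
Local Notation mu := (@lebesgue_measure R).
Local Notation pos := (`]0%R, +oo[%classic : set R).
Implicit Types (f g G phi dphi : R -> R) (t x : R).

(** The integral from the left end of the interval.  Monotonicity and boundedness
    give this primitive limits at the ends, whatever their values, which is what
    the substitution lemmas need. *)
Lemma primitive_ge0 (a : itv_bound R) G :
  (forall x, (a < BRight x)%E -> {for x, continuous G}) ->
  (forall x, x \in Interval a +oo%O -> 0 <= G x) ->
  mu.-integrable [set` Interval a +oo%O] (EFin \o G) ->
  exists v : R -> R,
    [/\ forall x, (a < BRight x)%E -> is_derive x 1 v (G x),
        {homo v : x y / x <= y},
        forall x, 0 <= v x &
        exists M, forall x, v x <= M].
Proof.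
move=> cG G0 iG.
pose v x := \int[mu]_(t in [set` Interval a (BRight x)]) G t.
have iGx x : mu.-integrable [set` Interval a (BRight x)] (EFin \o G).
  by apply: integrableS iG => //; apply: subset_itvl; rewrite bnd_simp.
have G0' (b : itv_bound R) t : [set` Interval a b] t -> (0 <= (G t)%:E)%E.
  move=> tab; rewrite lee_fin; apply: G0; apply: subitvP tab.
  rewrite subitvE lexx /=; by case: b => -[].
have le_int (b b' : itv_bound R) : (b <= b')%O -> (b' <= +oo%O)%O ->
    fine (\int[mu]_(t in [set` Interval a b]) (G t)%:E) <=
    fine (\int[mu]_(t in [set` Interval a b']) (G t)%:E).
  move=> bb' b'oo.
  have ib' : mu.-integrable [set` Interval a b'] (EFin \o G).
    by apply: integrableS iG => //; apply: subset_itvl.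
  have ib : mu.-integrable [set` Interval a b] (EFin \o G).
    by apply: integrableS ib' => //; apply: subset_itvl.
  apply: fine_le; [exact: integrable_fin_num|exact: integrable_fin_num|].
  apply: ge0_subset_integral => //.
  - by case/integrableP : ib'.
  - by move=> t; exact: G0'.
  - exact: subset_itvl.
exists v; split.
- move=> x ax.
  have [d1 d2] := @continuous_FTC1 _ G a x (x + 1) (ltr_pwDr ltr01 (lexx x)) (iGx _) ax (cG x ax).
  by apply: DeriveDef => //; rewrite -derive1E.
- by move=> x y xy; apply: le_int => //; rewrite bnd_simp.
- by move=> x; apply: Rintegral_ge0 => t /G0'; rewrite lee_fin.
- exists (fine (\int[mu]_(t in [set` Interval a +oo%O]) (G t)%:E)) => x.
  by apply: le_int => //; rewrite bnd_simp.
Qed.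

Lemma primitive_pos G : (forall t, 0 < t -> {for t, continuous G}) ->
  (forall t, 0 < t -> 0 <= G t) -> mu.-integrable pos (EFin \o G) ->
  exists v l0 l1, [/\ forall t, 0 < t -> is_derive t 1 v (G t),
    v t @[t --> 0^'+] --> (l0 : R) & v t @[t --> +oo] --> (l1 : R)].
Proof.
move=> cG G0 iG.
have [x|x|v [dv ndv v0 [M vM]]] := @primitive_ge0 (BRight 0) G _ _ iG.
- by rewrite /= lte_fin; exact: cG.
- by rewrite in_itv /= andbT; exact: G0.
exists v, (inf [set v x | x in `]0, +oo[]), (sup (range v)); split.
- by move=> t t0; apply: dv; rewrite /= lte_fin.
- apply: nondecreasing_at_right_cvgr => //.
    by move=> x y _ _; exact: ndv.
  by exists 0 => _ [x _ <-].
- apply: nondecreasing_cvgr => //.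
  by exists M => _ [x _ <-].
Qed.

Lemma cvg_to_right0 (T : Type) (F : set_system T) (FF : Filter F) (phi : T -> R) :
  phi @ F --> (0 : R) -> (\forall t \near F, 0 < phi t) -> phi @ F --> (0 : R)^'+.
Proof.
move=> h0 hp A [e /= e0 hA].
have /cvgrPdist_lt/(_ _ e0) h := h0.
apply: filterS2 hp h => t pt ht; apply: hA => //.
Qed.

(** Both integrals are the total increase of a primitive of [G]: the second one
    after composition with [phi]. *)
Lemma integral_substitution_increasing_pos G phi dphi :
  (forall t, 0 < t -> {for t, continuous G}) ->
  (forall t, 0 < t -> 0 <= G t) -> mu.-integrable pos (EFin \o G) ->
  (forall t, 0 < t -> 0 < phi t) ->
  (forall t, 0 < t -> is_derive t 1 phi (dphi t)) ->
  (forall t, 0 < t -> 0 <= dphi t) ->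
  (forall t, 0 < t -> {for t, continuous dphi}) ->
  phi t @[t --> 0^'+] --> (0 : R) -> phi t @[t --> +oo] --> +oo ->
  (\int[mu]_(t in pos) (G t)%:E = \int[mu]_(t in pos) (G (phi t) * dphi t)%:E)%E.
Proof.
move=> cG G0 iG phi0 hd dphi_ge0 cd lim0 limoo.
have [v [l0 [l1 [dv v0 voo]]]] := primitive_pos cG G0 iG.
rewrite (ge0_integral_FTC_pos dv cG G0 v0 voo).
apply/esym; apply: (@ge0_integral_FTC_pos _ (v \o phi)).
- by move=> t t0; exact: is_derive_compose (hd t t0) (dv _ (phi0 t t0)).
- move=> t t0; apply: continuousM; last exact: cd.
  apply: continuous_comp; last exact: cG (phi0 t t0).
  exact: is_derive_continuous (hd t t0).
- by move=> t t0; rewrite mulr_ge0 ?dphi_ge0// G0// phi0.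
- apply: (cvg_comp _ _ _ v0); apply: cvg_to_right0 => //.
  by apply: filterS (nbhs_right_gt (0 : R)) => t; exact: phi0.
- exact: (cvg_comp _ _ limoo voo).
Qed.

Lemma integral_substitution_decreasing_pos G phi dphi :
  (forall t, 0 < t -> {for t, continuous G}) ->
  (forall t, 0 < t -> 0 <= G t) -> mu.-integrable pos (EFin \o G) ->
  (forall t, 0 < t -> 0 < phi t) ->
  (forall t, 0 < t -> is_derive t 1 phi (- dphi t)) ->
  (forall t, 0 < t -> 0 <= dphi t) ->
  (forall t, 0 < t -> {for t, continuous dphi}) ->
  phi t @[t --> 0^'+] --> +oo -> phi t @[t --> +oo] --> (0 : R) ->
  (\int[mu]_(t in pos) (G t)%:E = \int[mu]_(t in pos) (G (phi t) * dphi t)%:E)%E.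
Proof.
move=> cG G0 iG phi0 hd dphi_ge0 cd lim0 limoo.
have [v [l0 [l1 [dv v0 voo]]]] := primitive_pos cG G0 iG.
rewrite (ge0_integral_FTC_pos dv cG G0 v0 voo).
rewrite -(opprK l1) addrC; apply/esym.
apply: (@ge0_integral_FTC_pos _ (fun t => - v (phi t))).
- move=> t t0.
  apply: (is_derive_eq (is_derive_opp (is_derive_compose (hd t t0) (dv _ (phi0 t t0))))).
  by rewrite mulrN opprK.
- move=> t t0; apply: continuousM; last exact: cd.
  apply: continuous_comp; last exact: cG (phi0 t t0).
  exact: is_derive_continuous (hd t t0).
- by move=> t t0; rewrite mulr_ge0 ?dphi_ge0// G0// phi0.
- by apply: cvgN; exact: (cvg_comp _ _ lim0 voo).
- apply: cvgN; apply: (cvg_comp _ _ _ v0); apply: cvg_to_right0 => //.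
  apply: filterS (nbhs_pinfty_gt (num_real (0 : R))) => t; exact: phi0.
Qed.

(** Extension by 0 from the quadrant to the plane reduces both exchange lemmas to
    the theorems of Tonelli and Fubini on the whole space. *)
Let pos2 := (pos `*` pos : set (measurableTypeR R * measurableTypeR R)).

Let restrict2 (f : R -> R -> R) x : 0 < x ->
  (fun y => ((fun z : R * R => f z.1 z.2) \_ pos2) (x, y)) = (f x) \_ pos.
Proof.
move=> x0; apply/funext => y; rewrite !patchE.
have [/set_mem/in_pos y0|/negP ny] := boolP (y \in pos).
  by rewrite mem_set// /pos2; split; apply/in_pos.
by rewrite memNset// => -[_ /= h]; apply: ny; exact/mem_set.
Qed.

Let restrict2_0 (f : R -> R -> R) x : ~ 0 < x ->
  (fun y => ((fun z : R * R => f z.1 z.2) \_ pos2) (x, y)) = fun=> 0.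
Proof.
move=> x0; apply/funext => y; rewrite patchE memNset// => -[/= h _].
by apply: x0; apply/in_pos.
Qed.

Lemma ge0_integral_swap_pos (f : R -> R -> R) :
  measurable_fun [set: measurableTypeR R * measurableTypeR R]
    (fun z => f z.1 z.2) ->
  (forall x y, 0 < x -> 0 < y -> 0 <= f x y) ->
  (\int[mu]_(x in pos) \int[mu]_(y in pos) (f x y)%:E =
   \int[mu]_(y in pos) \int[mu]_(x in pos) (f x y)%:E)%E.
Proof.
move=> mf f0.
pose F z := (((fun z : R * R => f z.1 z.2) \_ pos2) z)%:E.
have mpos2 : measurable pos2 by apply: measurableX; exact: measurable_itv.
have mF : measurable_fun setT F.
  apply/measurable_EFinP; apply/(measurable_restrict _ _ _).1 => //.
  exact: measurable_funS mf.
have F0 z : (0 <= F z)%E.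
  rewrite /F patchE lee_fin; case: ifPn => // /set_mem[/in_pos h1 /in_pos h2].
  exact: f0.
have := @fubini_tonelli _ _ (measurableTypeR R) (measurableTypeR R) R mu mu F mF F0.
have E1 : (\int[mu]_x \int[mu]_y F (x, y) = \int[mu]_(x in pos) \int[mu]_(y in pos) (f x y)%:E)%E.
  rewrite [RHS]integral_mkcond; apply: eq_integral => x _; rewrite patchE.
  have [/set_mem/in_pos x0|/negP nx] := boolP (x \in pos).
    rewrite [RHS]integral_mkcond; apply: eq_integral => y _.
    by rewrite /F (congr1 (fun g => g y) (restrict2 f x0)) /= !patchE; case: ifP.
  have x0 : ~ 0 < x by move=> /in_pos h; apply: nx; exact/mem_set.
  rewrite integral0_eq// => y _.
  by rewrite /F (congr1 (fun g => g y) (restrict2_0 f x0)).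
have E2 : (\int[mu]_y \int[mu]_x F (x, y) = \int[mu]_(y in pos) \int[mu]_(x in pos) (f x y)%:E)%E.
  rewrite [RHS]integral_mkcond; apply: eq_integral => y _; rewrite patchE.
  have [/set_mem/in_pos y0|/negP ny] := boolP (y \in pos).
    rewrite [RHS]integral_mkcond; apply: eq_integral => x _; rewrite /F !patchE.
    have [/set_mem x0|/negP nx] := boolP (x \in pos).
      by rewrite mem_set//; split => //; apply/in_pos.
    by rewrite memNset// => -[/= h _]; apply: nx; exact/mem_set.
  rewrite integral0_eq// => x _; rewrite /F patchE memNset// => -[_ /= h].
  by apply: ny; exact/mem_set.
by rewrite E1 E2.
Qed.

Lemma Rintegral_swap_pos (f : R -> R -> R) (g1 g2 : R -> R) :
  measurable_fun [set: measurableTypeR R * measurableTypeR R]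
    (fun z => f z.1 z.2) ->
  (forall x y, 0 < x -> 0 < y -> `|f x y| <= g1 x * g2 y) ->
  (forall x, 0 < x -> 0 <= g1 x) -> (forall y, 0 < y -> 0 <= g2 y) ->
  mu.-integrable pos (EFin \o g1) -> mu.-integrable pos (EFin \o g2) ->
  \int[mu]_(x in pos) \int[mu]_(y in pos) f x y =
  \int[mu]_(y in pos) \int[mu]_(x in pos) f x y.
Proof.
move=> mf fg g10 g20 ig1 ig2.
pose F z := (((fun z : R * R => f z.1 z.2) \_ pos2) z)%:E.
have mpos2 : measurable pos2 by apply: measurableX; exact: measurable_itv.
have mF : measurable_fun setT F.
  apply/measurable_EFinP; apply/(measurable_restrict _ _ _).1 => //.
  exact: measurable_funS mf.
have mfx x : measurable_fun pos (f x).
  have : measurable_fun setT (fun y : measurableTypeR R => f (x, y).1 (x, y).2).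
    by apply: (measurableT_comp mf); exact: measurable_pair1.
  exact: measurable_funS.
have mfy y : measurable_fun pos (f ^~ y).
  have : measurable_fun setT (fun x : measurableTypeR R => f (x, y).1 (x, y).2).
    by apply: (measurableT_comp mf); exact: measurable_pair2.
  exact: measurable_funS.
have ifx x : 0 < x -> mu.-integrable pos (EFin \o f x).
  move=> x0; apply: (@integrable_pos_dominated _ _ (fun y => g1 x * g2 y)) => //.
    by move=> y y0; exact: fg.
  exact: integrable_pos_scale.
have ify y : 0 < y -> mu.-integrable pos (EFin \o f ^~ y).
  move=> y0; apply: (@integrable_pos_dominated _ _ (fun x => g2 y * g1 x)) => //.
    by move=> x x0; rewrite mulrC; exact: fg.
  exact: integrable_pos_scale.
have iF : (mu \x mu)%E.-integrable setT F.
  pose c2 := \int[mu]_(y in pos) g2 y.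
  have mabsF : measurable_fun setT (abse \o F) by exact: measurableT_comp.
  have ig : mu.-integrable pos (EFin \o (fun x => c2 * g1 x)) by exact: integrable_pos_scale.
  have /integrableP[mg goo] := ig.
  apply/(@integrable12ltyP _ _ (measurableTypeR R) (measurableTypeR R) R mu mu F mF).
  apply: le_lt_trans goo.
  rewrite [leRHS]integral_mkcond; apply: ge0_le_integral => //.
  - by move=> x _; exact: integral_ge0.
  - exact: (measurable_fun_fubini_tonelli_F (m2 := mu) (abse \o F) mabsF (fun z => abse_ge0 _)).
  - apply/(measurable_restrict _ _ _).1 => //; rewrite setTI.
    exact: measurableT_comp.
  - move=> x _; rewrite patchE.
    have [/set_mem/in_pos x0|/negP nx] := boolP (x \in pos); last first.
      have x0 : ~ 0 < x by move=> /in_pos h; apply: nx; exact/mem_set.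
      rewrite integral0_eq// => y _.
      by rewrite /F (congr1 (fun g => g y) (restrict2_0 f x0)) abse0.
    have c20 : 0 <= c2 by apply: Rintegral_ge0 => y /in_pos; exact: g20.
    rewrite /= ger0_norm ?mulr_ge0 ?g10// mulrC EFinM /c2 /Rintegral.
    rewrite fineK; last exact: integrable_fin_num.
    have -> : (\int[mu]_y `|F (x, y)| = \int[mu]_(y in pos) `|(f x y)%:E|)%E.
      rewrite [RHS]integral_mkcond; apply: eq_integral => y _.
      rewrite /F (congr1 (fun g => g y) (restrict2 f x0)) /= !patchE.
      by case: ifP => // _; rewrite normr0.
    rewrite -integralZl//; apply: ge0_le_integral => //.
    + have /measurable_EFinP h := mfx x; exact: measurableT_comp.
    + have /integrableP[mg2 _] := ig2.
      exact: measurable_funeM.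
    + by move=> y /in_pos y0; rewrite /= -EFinM lee_fin fg.
have := @Fubini _ _ (measurableTypeR R) (measurableTypeR R) R mu mu F iF.
have E1 : (\int[mu]_x \int[mu]_y F (x, y) =
    \int[mu]_(x in pos) (\int[mu]_(y in pos) f x y)%:E)%E.
  rewrite [RHS]integral_mkcond; apply: eq_integral => x _; rewrite patchE.
  have [/set_mem/in_pos x0|/negP nx] := boolP (x \in pos).
    rewrite /Rintegral fineK; last exact: (integrable_fin_num _ (ifx _ x0)).
    rewrite [RHS]integral_mkcond; apply: eq_integral => y _.
    by rewrite /F (congr1 (fun g => g y) (restrict2 f x0)) /= !patchE; case: ifP.
  have x0 : ~ 0 < x by move=> /in_pos h; apply: nx; exact/mem_set.
  rewrite integral0_eq// => y _.
  by rewrite /F (congr1 (fun g => g y) (restrict2_0 f x0)).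
have E2 : (\int[mu]_y \int[mu]_x F (x, y) =
    \int[mu]_(y in pos) (\int[mu]_(x in pos) f x y)%:E)%E.
  rewrite [RHS]integral_mkcond; apply: eq_integral => y _; rewrite patchE.
  have [/set_mem/in_pos y0|/negP ny] := boolP (y \in pos).
    rewrite /Rintegral fineK; last exact: (integrable_fin_num _ (ify _ y0)).
    rewrite [RHS]integral_mkcond; apply: eq_integral => x _; rewrite /F !patchE.
    have [/set_mem x0|/negP nx] := boolP (x \in pos).
      by rewrite mem_set//; split => //; apply/in_pos.
    by rewrite memNset// => -[/= h _]; apply: nx; exact/mem_set.
  rewrite integral0_eq// => x _; rewrite /F patchE memNset// => -[_ /= h].
  by apply: ny; exact/mem_set.
by rewrite E1 E2 => h; rewrite /Rintegral h.
Qed.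

End Substitution.

(** * The gamma function *)

Section Gamma.
Context {R : realType}.
Local Notation mu := (@lebesgue_measure R).
Local Notation pos := (`]0%R, +oo[%classic : set R).
Implicit Types (s t x : R).

Lemma euler_gammaE s : euler_gamma s = \int[mu]_(t in pos) euler_integrand s 1 t.
Proof. by apply: eq_Rintegral => t _; rewrite /euler_integrand mul1r. Qed.

Lemma powRD1 s t : 0 < t -> t `^ s = t `^ (s - 1) * t.
Proof.
move=> t0; have h : (s - 1 + 1 == 0) ==> (t != 0) by apply/implyP => _; rewrite gt_eqF.
by rewrite -[in LHS](subrK 1 s) (powRD h) powRr1 ?ltW.
Qed.

Lemma cvg_powR_expR s c : 0 < s -> 0 < c ->
  t `^ s * expR (- (c * t)) @[t --> +oo] --> (0 : R).
Proof.
move=> s0 c0; have c20 : 0 < c / 2 by rewrite divr_gt0.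
pose K := expR (s * ln (s / (c / 2)) - s).
apply: (@squeeze_cvgr _ _ _ _ (cst 0) (fun t => K * expR (- (c / 2 * t)))).
- apply: filterS (nbhs_pinfty_gt (num_real (0 : R))) => t t0.
  rewrite /= mulr_ge0 ?powR_ge0 ?expR_ge0//=.
  have -> : expR (- (c * t)) = expR (- (c / 2 * t)) * expR (- (c / 2 * t)).
    by rewrite -expRD; congr expR; field.
  by rewrite mulrA ler_wpM2r ?expR_ge0// powR_expR_le.
- exact: cvg_cst.
- by rewrite -[X in _ --> X](mulr0 K); apply: cvgMr; exact: cvg_expR_scale.
Qed.

Lemma cvg_powR_expR0 s c : 0 < s -> 0 < c ->
  t `^ s * expR (- (c * t)) @[t --> 0^'+] --> (0 : R).
Proof.
move=> s0 c0; apply: (@squeeze_cvgr _ _ _ _ (cst 0) (fun t => t `^ s)).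
- apply: filterS (nbhs_right_gt (0 : R)) => t t0.
  rewrite /= mulr_ge0 ?powR_ge0 ?expR_ge0//= ler_piMr ?powR_ge0//.
  by rewrite -expR0 ler_expR oppr_le0 mulr_ge0 ?ltW.
- exact: cvg_cst.
- exact: powR_cvg0.
Qed.

Lemma is_derive_powR_expR s c t : 0 < t ->
  is_derive t 1 (fun t => t `^ s * expR (- (c * t)))
    (s * euler_integrand s c t - c * euler_integrand (s + 1) c t).
Proof.
move=> t0.
have dE := is_derive_compose (is_derive_opp (is_derive_linear c t)) (is_derive_expR _).
apply: (is_derive_eq (is_derive_mul (is_derive_powR s t0) dE)).
by rewrite /euler_integrand addrK; ring.
Qed.

Lemma euler_gammaS s : 0 < s -> euler_gamma (s + 1) = s * euler_gamma s.
Proof.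
move=> s0; rewrite !euler_gammaE.
have s10 : 0 < s + 1 by rewrite addr_gt0.
have i1 := integrable_euler s0 ltr01; have i2 := integrable_euler s10 ltr01.
have c1 t := @continuous_euler_integrand R s 1 t.
have c2 t := @continuous_euler_integrand R (s + 1) 1 t.
have h : \int[mu]_(t in pos) (s * euler_integrand s 1 t - 1 * euler_integrand (s + 1) 1 t) = 0.
  apply: (@Rintegral_FTC_pos _ (fun t => t `^ s * expR (- (1 * t))) _
    (fun t => s * euler_integrand s 1 t + 1 * euler_integrand (s + 1) 1 t)).
  - by move=> t t0; exact: is_derive_powR_expR.
  - move=> t t0; apply: continuousB.
      by apply: continuousM; [exact: cst_continuous|exact: c1].
    by apply: continuousM; [exact: cst_continuous|exact: c2].
  - move=> t t0; rewrite (le_trans (ler_normB _ _))// !normrM normr1.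
    by rewrite !ger0_norm ?powR_ge0 ?(ltW s0).
  - by apply: integrable_pos_add; exact: integrable_pos_scale.
  - exact: cvg_powR_expR0.
  - exact: cvg_powR_expR.
rewrite RintegralB ?RintegralZl // in h; [|exact: integrable_pos_scale..].
by move/eqP: h; rewrite subr_eq0 mul1r => /eqP.
Qed.

(** The integrand is bounded below between 1 and 2. *)
Lemma euler_gamma_gt0 s : 0 < s -> 0 < euler_gamma s.
Proof.
move=> s0; rewrite euler_gammaE.
have i1 := integrable_euler s0 ltr01.
pose c : R := expR (- `|s - 1| - 2).
have c0 : 0 < c by exact: expR_gt0.
suff : (c%:E <= \int[mu]_(t in pos) (euler_integrand s 1 t)%:E)%E.
  move=> h; apply: lt_le_trans c0 _.
  rewrite -lee_fin /Rintegral fineK//; exact: integrable_fin_num.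
apply: (@le_trans _ _ (\int[mu]_(t in `[1%R, 2%R]) (cst c%:E t))%E).
  rewrite integral_cst//= lebesgue_measure_itv /= lte_fin ltr1n.
  by rewrite -EFinB -EFinM (_ : 2 - 1 = 1) ?mulr1//; ring.
apply: (@le_trans _ _ (\int[mu]_(t in `[1%R, 2%R]) (euler_integrand s 1 t)%:E)%E).
  apply: ge0_le_integral => //.
  - by move=> t _; rewrite lee_fin ltW.
  - have /integrableP[m _] := i1; apply: measurable_funS m => //.
    by move=> t; rewrite /= !in_itv /= andbT => /andP[+ _]; exact: lt_le_trans.
  - move=> t; rewrite /= in_itv /= => /andP[t1 t2].
    have t0 : 0 < t by exact: lt_le_trans t1.
    rewrite lee_fin /c /euler_integrand /powR gt_eqF// -expRD ler_expR mul1r.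
    apply: lerB => //.
    have l0 : 0 <= ln t by rewrite ln_ge0.
    have l1 : ln t <= 1.
      have := @le_ln1Dx R (t - 1); rewrite addrCA subrr addr0 => h.
      by rewrite (le_trans (h _))//; lra.
    rewrite lerNl -mulNr (le_trans (ler_norm _))// normrM normrN (ger0_norm l0).
    by rewrite ler_piMr.
apply: ge0_subset_integral => //.
- by have /integrableP[m _] := i1.
- by move=> t _; rewrite lee_fin euler_integrand_ge0.
- by move=> t; rewrite /= !in_itv /= andbT => /andP[+ _]; exact: lt_le_trans.
Qed.

(** For [x <= 0] the product defining [rgamma x] has one factor more than that of
    [rgamma (x + 1)], namely its first one, [x]; for [0 < x] both products are
    empty and this is the functional equation of Euler's integral. *)
Lemma rgammaS x : rgamma x = x * rgamma (x + 1).
Proof.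
rewrite /rgamma /gamma_shift.
have [x0|x0] := ltP 0 x.
  rewrite addr_gt0// !big_ord0 !addr0 !mul1r euler_gammaS// invfM mulrA.
  by rewrite divff ?mul1r// gt_eqF.
have t0 : 0 <= - x by rewrite oppr_ge0.
rewrite big_ord_recl /= addr0 -mulrA; congr (_ * _).
have [x1|x1] := ltP 0 (x + 1).
  rewrite (_ : Num.truncn (- x) = 0%N); last first.
    by apply: truncn_def; lra.
  by rewrite !big_ord0 !addr0.
have -> : Num.truncn (- x) = (Num.truncn (- (x + 1))).+1.
  have x10 : 0 <= - (x + 1) by lra.
  have /andP[h1 h2] := truncn_itv x10.
  by apply: truncn_def; rewrite -!natr1 in h2 *; apply/andP; split; lra.
rewrite -[in RHS]addrA nat1r; congr (_ / _).
by apply: eq_bigr => i _; rewrite /bump add1n -addrA nat1r.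
Qed.

Lemma integral_gauss_pos : (\int[mu]_(t in pos) (expR (- t ^+ 2))%:E = (Num.sqrt pi / 2)%:E)%E.
Proof.
rewrite -integral0y_gauss integral_itv_obnd_cbnd//.
by apply/measurable_EFinP; apply: measurable_funTS; exact: measurable_gauss_fun.
Qed.

End Gamma.

(** * The duplication formula *)

Section Duplication.
Context {R : realType}.
Local Notation mu := (@lebesgue_measure R).
Local Notation pos := (`]0%R, +oo[%classic : set R).
Implicit Types (s t x P : R).

Lemma is_derive_gauss x :
  is_derive x 1 (fun u : R => expR (- u ^+ 2)) (expR (- x ^+ 2) * - (x + x)).
Proof.
have dsq : is_derive x 1 (fun u : R => u ^+ 2) (x + x).
  apply: (is_derive_eq (is_derive_mul (is_derive_id x (1 : R)) (is_derive_id x (1 : R)))).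
  by rewrite !mulr1.
exact: is_derive_compose (is_derive_opp dsq) (is_derive_expR _).
Qed.

Lemma continuous_gauss x : {for x, continuous (fun u : R => expR (- u ^+ 2))}.
Proof. exact: is_derive_continuous (is_derive_gauss x). Qed.

(** Each half-line contributes [sqrt pi / 2].  The limits [l] and [m] depend on the
    additive constant in [v], their sum does not. *)
Lemma erf_exists : exists (v : R -> R) (l m : R),
  [/\ forall x, is_derive x 1 v (expR (- x ^+ 2)),
      v x @[x --> +oo] --> l, (- v (- x)) @[x --> +oo] --> m &
      l + m = Num.sqrt pi].
Proof.
have iG : mu.-integrable [set` Interval -oo%O +oo%O] (EFin \o (fun u : R => expR (- u ^+ 2))).
  by rewrite set_itvNyy; exact: integrableT_gauss.
have [x _|x _|v [dv ndv v0 [M vM]]] := @primitive_ge0 R -oo%O _ _ _ iG.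
- exact: continuous_gauss.
- exact: expR_ge0.
have dv' x : is_derive x 1 v (expR (- x ^+ 2)) by apply: dv; rewrite /= ltNyr.
pose w x := - v (- x).
have dw x : is_derive x 1 w (expR (- x ^+ 2)).
  apply: (is_derive_eq (is_derive_opp (is_derive_compose (is_derive_opp (is_derive_id x (1 : R))) (dv' (- x))))).
  by rewrite mulrN1 opprK sqrrN.
have vl : v x @[x --> +oo] --> sup (range v).
  apply: nondecreasing_cvgr; first by move=> x y; exact: ndv.
  by exists M => _ [x _ <-].
have wm : w x @[x --> +oo] --> sup (range w).
  apply: nondecreasing_cvgr; first by move=> x y xy; rewrite lerN2 ndv// lerN2.
  by exists 0 => _ [x _ <-]; rewrite oppr_le0.
exists v, (sup (range v)), (sup (range w)); split => //.
have half (f : R -> R) (l : R) : (forall x, is_derive x 1 f (expR (- x ^+ 2))) ->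
    f x @[x --> +oo] --> l -> l - f 0 = Num.sqrt pi / 2.
  move=> df fl.
  have h : (\int[mu]_(t in pos) (expR (- t ^+ 2))%:E = (l - f 0)%:E)%E.
    apply: (@ge0_integral_FTC_pos R f (fun t => expR (- t ^+ 2)) (f 0) l) => //.
    - by move=> t _; exact: continuous_gauss.
    - by apply: cvg_at_right_filter; exact: is_derive_continuous (df 0).
  by move: h; rewrite integral_gauss_pos => -[].
have := half _ _ dv' vl; have := half _ _ dw wm; rewrite /w oppr0.
by move=> h1 h2; lra.
Qed.

Lemma cvg_divr_right0 P : 0 < P -> P / t @[t --> 0^'+] --> +oo.
Proof.
move=> P0; apply/cvgryPge => M.
have M1 : 0 < `|M| + 1 by rewrite ltr_wpDl.
have PM : 0 < P / (`|M| + 1) by rewrite divr_gt0.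
apply: filterS2 (nbhs_right_lt PM) (nbhs_right_gt (0 : R)) => t tP t0.
rewrite ler_pdivlMr//; rewrite ltr_pdivlMr// in tP.
apply: le_trans (ltW tP); rewrite mulrC ler_wpM2l ?(ltW t0)//.
by rewrite (le_trans (ler_norm _))// lerDl.
Qed.

Lemma cvg_divr_pinfty P : 0 < P -> P / t @[t --> +oo] --> (0 : R).
Proof.
move=> P0; apply/cvgrPdist_le => e e0.
apply: filterS2 (nbhs_pinfty_ge (num_real (P / e))) (nbhs_pinfty_gt (num_real (0 : R))).
move=> t te t0; rewrite sub0r normrN ger0_norm ?divr_ge0 ?(ltW P0) ?(ltW t0)//.
by rewrite ler_pdivrMr// mulrC -ler_pdivrMr.
Qed.

Lemma is_derive_divr P t : t != 0 -> is_derive t 1 (fun u : R => P / u) (- (P / t ^+ 2)).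
Proof.
move=> t0.
apply: (is_derive_eq (is_derive_mul (is_derive_cst P t (1 : R)) (is_derive_inv (is_derive_id t (1 : R)) t0))).
by rewrite /cst; field.
Qed.

Let bump P t := expR (- (t / 2 - P / t) ^+ 2).

Let dbump P t : 0 < t -> is_derive t 1 (fun u : R => u / 2 - P / u) (2^-1 + P / t ^+ 2).
Proof.
move=> t0; have tn0 : t != 0 by rewrite gt_eqF.
apply: (is_derive_eq (is_derive_sub
  (is_derive_mul (is_derive_id t (1 : R)) (is_derive_cst (2^-1 : R) t (1 : R))) (is_derive_divr P tn0))).
by rewrite /cst; field.
Qed.

Let cbump P t : 0 < t -> {for t, continuous (bump P)}.
Proof.
move=> t0; have h := is_derive_compose (dbump P t0) (is_derive_gauss _).
exact: is_derive_continuous h.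
Qed.

Let cweight P t : 0 < t -> {for t, continuous (fun u : R => P / u ^+ 2)}.
Proof.
move=> t0; have tn0 : t ^+ 2 != 0 by rewrite expf_neq0// gt_eqF.
have dsq := is_derive_mul (is_derive_id t (1 : R)) (is_derive_id t (1 : R)).
exact: is_derive_continuous (is_derive_mul (is_derive_cst P t (1 : R)) (is_derive_inv dsq tn0)).
Qed.

(** The substitution of Cauchy and Schlomilch.  The map [t |-> 2 * P / t] turns the
    integral of [exp (- (t / 2 - P / t) ^ 2)] into this one, and their sum is twice
    the integral of [exp (- x ^ 2)] over the line, for [x = t / 2 - P / t]. *)
Lemma integral_cauchy_schlomilch P : 0 < P ->
  (\int[mu]_(t in pos) (2 * P / t ^+ 2 * expR (- (t / 2 - P / t) ^+ 2))%:E =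
   (Num.sqrt pi)%:E)%E.
Proof.
move=> P0; have P20 : 0 < 2 * P by rewrite mulr_gt0.
have ib : mu.-integrable pos (EFin \o bump P).
  apply: (@integrable_pos_dominated _ _ (fun t => expR (P + 1) * expR (- (1 * t)))).
  - by apply: measurable_pos_continuous => t; exact: cbump.
  - move=> t t0; rewrite ger0_norm ?expR_ge0// -expRD ler_expR -subr_ge0.
    have -> : P + 1 + - (1 * t) - - (t / 2 - P / t) ^+ 2 = (t / 2 - 1) ^+ 2 + (P / t) ^+ 2.
      by field; rewrite gt_eqF.
    by rewrite addr_ge0 ?sqr_ge0.
  - exact: integrable_pos_scale (integrable_expR ltr01).
have S1 : (\int[mu]_(t in pos) (bump P t)%:E =
    \int[mu]_(t in pos) (2 * P / t ^+ 2 * bump P t)%:E)%E.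
  transitivity (\int[mu]_(t in pos) (bump P (2 * P / t) * (2 * P / t ^+ 2))%:E)%E.
    apply: (@integral_substitution_decreasing_pos R (bump P)
      (fun t => 2 * P / t) (fun t => 2 * P / t ^+ 2)) => //.
    - by move=> t; exact: cbump.
    - by move=> t _; exact: expR_ge0.
    - by move=> t t0; rewrite divr_gt0.
    - by move=> t t0; apply: is_derive_divr; rewrite gt_eqF.
    - by move=> t t0; rewrite divr_ge0 ?(ltW P20) ?sqr_ge0.
    - by move=> t; exact: cweight.
    - exact: cvg_divr_right0.
    - exact: cvg_divr_pinfty.
  apply: eq_integral => t; rewrite inE => /in_pos t0; congr EFin.
  rewrite mulrC /bump; congr (_ * expR (- _)); rewrite -sqrrN; congr (_ ^+ 2).
  by field; rewrite !gt_eqF.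
have [v [l [m [dv vl vm lm]]]] := erf_exists.
have S2 : (\int[mu]_(t in pos) ((1 + 2 * P / t ^+ 2) * bump P t)%:E =
    (2 * l - (- (2 * m)))%:E)%E.
  apply: (@ge0_integral_FTC_pos R (fun t => 2 * v (t / 2 - P / t))
    (fun t => (1 + 2 * P / t ^+ 2) * bump P t) (- (2 * m)) (2 * l)).
  - move=> t t0.
    apply: (is_derive_eq (is_derive_mul (is_derive_cst (2 : R) t (1 : R))
      (is_derive_compose (dbump P t0) (dv _)))).
    by rewrite /cst /bump; field; rewrite gt_eqF.
  - move=> t t0; apply: continuousM; last exact: cbump.
    by apply: continuousD; [exact: cst_continuous|exact: cweight].
  - move=> t t0; rewrite mulr_ge0 ?expR_ge0// addr_ge0//.
    by rewrite divr_ge0 ?(ltW P20) ?sqr_ge0.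
  - have -> : (fun t => 2 * v (t / 2 - P / t)) = (fun t => - (2 * - v (- (P / t - t / 2)))).
      by apply/funext => t; rewrite opprB mulrN opprK.
    apply: cvgN; apply: cvgMr; apply: (cvg_comp _ _ _ vm).
    apply/cvgryPge => M; have /cvgryPge/(_ (M + 1)) h := cvg_divr_right0 P0.
    apply: filterS2 h (nbhs_right_lt (ltr01 : 0 < (1 : R))) => t hM t1; lra.
  - apply: cvgMr; apply: (cvg_comp _ _ _ vl).
    apply/cvgryPge => M.
    have /cvgrPdist_le/(_ _ ltr01) h := cvg_divr_pinfty P0.
    apply: filterS2 h (nbhs_pinfty_ge (num_real (2 * (M + 1)))) => t.
    rewrite sub0r normrN => /(le_trans (ler_norm _)) h1 h2; lra.
have bm : measurable_fun pos (bump P).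
  by apply: measurable_pos_continuous => t; exact: cbump.
have wm : measurable_fun pos (fun t => 2 * P / t ^+ 2 * bump P t).
  apply: measurable_pos_continuous => t t0.
  by apply: continuousM; [exact: cweight|exact: cbump].
have S3 : (\int[mu]_(t in pos) ((1 + 2 * P / t ^+ 2) * bump P t)%:E =
  \int[mu]_(t in pos) (bump P t)%:E + \int[mu]_(t in pos) (2 * P / t ^+ 2 * bump P t)%:E)%E.
  rewrite -ge0_integralD//.
  - by apply: eq_integral => t _; rewrite -EFinD mulrDl mul1r.
  - by move=> t _; rewrite lee_fin expR_ge0.
  - exact/measurable_EFinP.
  - by move=> t _; rewrite lee_fin mulr_ge0 ?expR_ge0// divr_ge0 ?sqr_ge0// ltW.
  - exact/measurable_EFinP.
have fin : (\int[mu]_(t in pos) (2 * P / t ^+ 2 * bump P t)%:E)%E \is a fin_num.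
  by rewrite -S1; exact: integrable_fin_num.
move: S3; rewrite S1 S2 -(fineK fin) -EFinD => -[h].
congr EFin; rewrite -lm; lra.
Qed.

(** Legendre's duplication formula: the integral on the left is
    [2 ^ (s - 1) * Gamma (s / 2)].  Substituting [P ^ 2 / t ^ 2] in the integral for
    [Gamma ((s + 1) / 2)] and completing the square gives a double integral in [t]
    and [P]; integrated in [t] first, it is the previous lemma times the
    integrand of [Gamma s]. *)
Lemma euler_gamma_duplication s : 0 < s ->
  ((euler_gamma ((s + 1) / 2))%:E *
   \int[mu]_(t in pos) (t `^ (s - 1) * expR (- (t ^+ 2 / 4)))%:E =
   (Num.sqrt pi * euler_gamma s)%:E)%E.
Proof.
move=> s0; set b := (s + 1) / 2; have b0 : 0 < b by rewrite divr_gt0// addr_gt0.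
have Gfin r : 0 < r -> (\int[mu]_(t in pos) (euler_integrand r 1 t)%:E)%E =
    (euler_gamma r)%:E.
  move=> r0; rewrite euler_gammaE /Rintegral fineK//.
  exact: (integrable_fin_num _ (integrable_euler r0 ltr01)).
(* [t `^ (-1)] rather than [t^-1]: joint measurability reduces to that of powers *)
pose f t P := euler_integrand s 1 P *
  (2 * P * (t `^ (-1)) ^+ 2 * expR (- (t / 2 - P * t `^ (-1)) ^+ 2)).
have f0 t P : 0 < t -> 0 < P -> 0 <= f t P.
  move=> t0 P0; rewrite mulr_ge0 ?euler_integrand_ge0// mulr_ge0 ?expR_ge0//.
  by rewrite mulr_ge0 ?sqr_ge0// mulr_ge0// ltW.
have inner t : 0 < t -> ((euler_gamma b)%:E * (t `^ (s - 1) * expR (- (t ^+ 2 / 4)))%:E =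
    \int[mu]_(P in pos) (f t P)%:E)%E.
  move=> t0; have tn0 : t != 0 by rewrite gt_eqF.
  have sq x : is_derive x 1 (fun P : R => P ^+ 2 / t ^+ 2) (2 * x / t ^+ 2).
    apply: (is_derive_eq (is_derive_mul (is_derive_mul (is_derive_id x (1 : R)) (is_derive_id x (1 : R)))
      (is_derive_cst ((t ^+ 2)^-1) x (1 : R)))).
    by rewrite /cst; field.
  rewrite -Gfin//.
  transitivity ((\int[mu]_(P in pos) (euler_integrand b 1 (P ^+ 2 / t ^+ 2) * (2 * P / t ^+ 2))%:E) *
     (t `^ (s - 1) * expR (- (t ^+ 2 / 4)))%:E)%E.
    congr (_ * _)%E; apply: (@integral_substitution_increasing_pos R (euler_integrand b 1)
      (fun P => P ^+ 2 / t ^+ 2) (fun P => 2 * P / t ^+ 2)).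
    - by move=> x; exact: continuous_euler_integrand.
    - by move=> x _; exact: euler_integrand_ge0.
    - exact: integrable_euler.
    - by move=> P P0; rewrite divr_gt0 ?exprn_gt0.
    - by move=> P P0; rewrite divr_ge0 ?sqr_ge0// mulr_ge0// ltW.
    - move=> P P0.
      exact: is_derive_continuous (is_derive_mul (is_derive_mul (is_derive_cst (2 : R) P (1 : R))
          (is_derive_id P (1 : R))) (is_derive_cst ((t ^+ 2)^-1) P (1 : R))).
    - apply: cvg_at_right_filter.
      have := is_derive_continuous (sq 0); rewrite /prop_for /continuous_at /=.
      by rewrite expr0n /= mul0r.
    - apply/cvgryPge => M.
      apply: filterS2 (nbhs_pinfty_ge (num_real (1 : R))) (nbhs_pinfty_ge (num_real (M * t ^+ 2))).
      move=> P P1 PM; rewrite ler_pdivlMr ?exprn_gt0//.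
      by rewrite (le_trans PM)// expr2 ler_peMr// (le_trans _ P1).
  rewrite muleC -ge0_integralZl//.
  + apply: eq_integral => P; rewrite inE => /in_pos P0; rewrite -EFinM; congr EFin.
    rewrite /f /euler_integrand powR_inv1 ?ltW//.
    have -> : P ^+ 2 / t ^+ 2 = (P / t) `^ 2%:R.
      by rewrite powR_mulrn ?divr_ge0 ?ltW// expr_div_n.
    rewrite -powRrM (_ : 2 * (b - 1) = s - 1); last by rewrite /b; field.
    rewrite powRM ?invr_ge0 ?ltW// powR_mulrn ?divr_ge0 ?ltW//.
    have e1 : t `^ (s - 1) * t^-1 `^ (s - 1) = 1.
      by rewrite -powRM ?invr_ge0 ?ltW// divff// powR1.
    have e2 : expR (- (t ^+ 2 / 4)) * expR (- (1 * (P / t) ^+ 2)) =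
        expR (- (1 * P)) * expR (- (t / 2 - P / t) ^+ 2).
      by rewrite -!expRD; congr expR; field.
    transitivity ((t `^ (s - 1) * t^-1 `^ (s - 1)) * P `^ (s - 1) *
      (expR (- (t ^+ 2 / 4)) * expR (- (1 * (P / t) ^+ 2))) * (2 * P / t ^+ 2)).
      by ring.
    by rewrite e1 e2 exprVn; ring.
  + apply/measurable_EFinP; apply: measurable_pos_continuous => P P0.
    apply: continuousM.
      apply: continuous_comp; first exact: is_derive_continuous (sq P).
      by apply: continuous_euler_integrand; rewrite divr_gt0// exprn_gt0.
    exact: is_derive_continuous (is_derive_mul (is_derive_mul (is_derive_cst (2 : R) P (1 : R))
      (is_derive_id P (1 : R))) (is_derive_cst ((t ^+ 2)^-1) P (1 : R))).
  + move=> P /in_pos P0; rewrite lee_fin mulr_ge0 ?euler_integrand_ge0//.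
    by rewrite divr_ge0 ?sqr_ge0// mulr_ge0// ltW.
  + by rewrite lee_fin mulr_ge0 ?powR_ge0 ?expR_ge0.
have mf : measurable_fun [set: measurableTypeR R * measurableTypeR R] (fun z => f z.1 z.2).
  have m1 := @measurable_fst _ _ (measurableTypeR R) (measurableTypeR R).
  have m2 := @measurable_snd _ _ (measurableTypeR R) (measurableTypeR R).
  have mp r : measurable_fun [set: measurableTypeR R * measurableTypeR R] (fun z => z.1 `^ r).
    exact: (measurableT_comp (measurable_powR r) m1).
  have mp2 r : measurable_fun [set: measurableTypeR R * measurableTypeR R] (fun z => z.2 `^ r).
    exact: (measurableT_comp (measurable_powR r) m2).
  rewrite /f /euler_integrand.
  apply: measurable_funM.
    apply: measurable_funM => //.
    apply: (measurableT_comp (@measurable_expR R)); apply: measurableT_comp => //.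
    exact: measurable_funM.
  apply: measurable_funM.
    apply: measurable_funM; first exact: measurable_funM.
    exact: measurable_funX.
  apply: (measurableT_comp (@measurable_expR R)); apply: measurableT_comp => //.
  apply: measurable_funX; apply: measurable_funB; first exact: measurable_funM.
  exact: measurable_funM.
transitivity (\int[mu]_(t in pos) \int[mu]_(P in pos) (f t P)%:E)%E.
  rewrite -ge0_integralZl//.
  - by apply: eq_integral => t; rewrite inE => /in_pos; exact: inner.
  - apply/measurable_EFinP; apply: measurable_pos_continuous => t t0.
    apply: continuousM; first exact: is_derive_continuous (is_derive_powR _ t0).
    have dsq := is_derive_mul (is_derive_mul (is_derive_id t (1 : R)) (is_derive_id t (1 : R)))
      (is_derive_cst (4^-1 : R) t (1 : R)).
    exact: is_derive_continuous (is_derive_compose (is_derive_opp dsq) (is_derive_expR _)).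
  - by move=> t _; rewrite lee_fin mulr_ge0 ?powR_ge0 ?expR_ge0.
  - by rewrite lee_fin ltW// euler_gamma_gt0.
rewrite ge0_integral_swap_pos//.
transitivity (\int[mu]_(P in pos) ((Num.sqrt pi)%:E * (euler_integrand s 1 P)%:E))%E.
  apply: eq_integral => P; rewrite inE => /in_pos P0.
  rewrite muleC -(integral_cauchy_schlomilch P0) -ge0_integralZl//.
  - apply: eq_integral => t; rewrite inE => /in_pos t0; rewrite -EFinM; congr EFin.
    by rewrite /f powR_inv1 ?ltW// exprVn.
  - apply/measurable_EFinP; apply: measurable_pos_continuous => t t0.
    by apply: continuousM; [exact: cweight|exact: cbump].
  - move=> t /in_pos t0; rewrite lee_fin mulr_ge0 ?expR_ge0//.
    by rewrite divr_ge0 ?sqr_ge0// mulr_ge0// ltW.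
  - by rewrite lee_fin euler_integrand_ge0.
rewrite ge0_integralZl//.
- by rewrite Gfin.
- apply/measurable_EFinP; apply: measurable_pos_continuous => t.
  exact: continuous_euler_integrand.
- by move=> t _; rewrite lee_fin euler_integrand_ge0.
Qed.

End Duplication.

(** * Hankel's integral for the reciprocal gamma function *)

Section Hankel.
Context {R : realType}.
Local Notation C := R[i].
Local Notation mu := (@lebesgue_measure R).
Local Notation pos := (`]0%R, +oo[%classic : set R).
Implicit Types (a s t x y g b : R) (z : C).

Lemma Re_realM a z : Re (a%:C * z) = a * Re z.
Proof. by case: z => x y /=; rewrite mul0r subr0. Qed.

Lemma cexp_real a : cexp a%:C = (expR a)%:C.
Proof. by apply: complexP; rewrite /= ?cos0 ?sin0 ?mulr1 ?mulr0. Qed.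

Lemma cderiv_real (f : R -> R) t a : is_derive t 1 f a ->
  cderiv (fun u => (f u)%:C) t a%:C.
Proof. by move=> df; split => //=; exact: is_derive_cst. Qed.

Lemma cdiff_scale (c : C) z : cdiff (fun w => c * w) z c.
Proof.
by apply: (cdiff_eq (cdiffM (cdiff_cst c z) (cdiff_id z))); rewrite mulr1 mulr0 addr0.
Qed.

Lemma cderiv_scale (c : C) t : cderiv (fun u : R => (- u)%:C * c) t (- c).
Proof.
have dN : is_derive t 1 (fun u : R => - u) (-1) := is_derive_opp (is_derive_id t (1 : R)).
have := cderivM (cderiv_real dN) (cderiv_cst c t).
by move=> /cderiv_eq; apply; rewrite mulr0 add0r rmorphN mulrN mulr1.
Qed.

(** Laplace's integral for [Gamma (s) z ^ (- s)] at [z = 1 + i y], multiplied by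
    [exp (z ^ 2)] in view of the integration in [y] that follows.  The
    [z]-derivative of [z ^ s t ^ (s - 1) exp (- t z)] is the [t]-derivative of
    [z ^ (s - 1) t ^ s exp (- t z)], so that [z] can be moved
    vertically to 1, where the integral is Euler's. *)
Lemma laplace_cpow s y : 0 < s -> 0 < y ->
  \int[mu]_(t in pos) (t `^ (s - 1) *
    Re (cexp ((1 +i* y) * (1 +i* y) + (- t)%:C * (1 +i* y)))) =
  euler_gamma s * Re (cexp ((1 +i* y) * (1 +i* y)) * cpow (1 +i* y) (- s)).
Proof.
move=> s0 y0; set z0 : C := 1 +i* y.
(* the factor frozen at [y] while the height of the other factors moves to 0 *)
have [c0 c0E] : exists c, c = cexp (z0 * z0) * cpow z0 (- s) by eexists.
rewrite -c0E.
pose Z p : C := 1 +i* p.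
have Z0 p : 0 < Re (Z p) by rewrite /= ltr01.
have Zn p : Z p != 0 by exact: Re_gt0_neq0.
pose u p t := Re (c0 * (cpow (Z p) s * ((t `^ (s - 1))%:C * cexp ((- t)%:C * Z p)))).
pose v p t := Re (c0 * 'i%C * (Z p)^-1 * cpow (Z p) s * ((t `^ s)%:C * cexp ((- t)%:C * Z p))).
pose k p t := Re (c0 * 'i%C * cpow (Z p) s * ((s%:C * (Z p)^-1 * (t `^ (s - 1))%:C - (t `^ s)%:C) *
   cexp ((- t)%:C * Z p))).
pose Q := y + 2.
pose K := cmod c0 * expR (s * Q).
have K0 : 0 <= K by rewrite mulr_ge0 ?cmod_ge0 ?expR_ge0.
have pQ p : -1 < p < y + 1 -> `|p| <= y + 1.
  by move=> /andP[h1 h2]; rewrite ler_norml; apply/andP; split; lra.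
have cmodZ p : -1 < p < y + 1 -> 1 <= cmod (Z p) <= Q.
  move=> hp; apply/andP; split.
    by rewrite (le_trans _ (normRe_le _))//= normr1.
  by rewrite (le_trans (cmod_le _))//= normr1; have := pQ p hp; rewrite /Q; lra.
have cmodE' p t : cmod (cexp ((- t)%:C * Z p)) = expR (- (1 * t)).
  by rewrite cmod_cexp ReM /=; congr expR; ring.
have cmodP p : -1 < p < y + 1 -> cmod (cpow (Z p) s) <= expR (s * Q).
  move=> hp; rewrite cmod_cpow// ler_expR ler_wpM2l ?(ltW s0)//.
  have /andP[h1 h2] := cmodZ p hp.
  have := @le_ln1Dx R (cmod (Z p) - 1); rewrite addrCA subrr addr0 => h.
  by rewrite (le_trans (h _))//; lra.
have cmodi : cmod 'i%C = 1 :> R by rewrite cmodE /= expr0n expr1n add0r sqrtr1.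
have vbound p t : -1 < p < y + 1 -> 0 < t ->
    `|v p t| <= K * (t `^ s * expR (- (1 * t))).
  move=> hp t0; have /andP[h1 h2] := cmodZ p hp.
  rewrite (le_trans (normRe_le _))// !cmodM cmodi mulr1 cmodV cmod_real cmodE'.
  rewrite ger0_norm ?powR_ge0// ler_wpM2r ?mulr_ge0 ?powR_ge0 ?expR_ge0//.
  rewrite /K -mulrA ler_wpM2l ?cmod_ge0// (le_trans _ (cmodP p hp))//.
  by rewrite ler_piMl ?cmod_ge0// invf_le1// (lt_le_trans ltr01).
have int_u p : -1 < p < y + 1 -> mu.-integrable pos (EFin \o u p).
  move=> hp; apply: (@integrable_pos_dominated _ _ (fun t => K * euler_integrand s 1 t)).
  - apply: measurable_pos_continuous => t t0.
    have dp := cderiv_real (is_derive_powR (s - 1) t0).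
    exact: cderiv_continuous_Re (cderivM (cderiv_cst c0 t) (cderivM (cderiv_cst _ t)
      (cderivM dp (cderiv_cexp (cderiv_scale (Z p) t))))).
  - move=> t t0; rewrite (le_trans (normRe_le _))// !cmodM cmod_real cmodE'.
    rewrite ger0_norm ?powR_ge0// mulrA ler_wpM2r ?euler_integrand_ge0//.
    by rewrite ler_wpM2l ?cmod_ge0// cmodP.
  - exact: integrable_pos_scale (integrable_euler s0 ltr01).
have s10 : 0 < s + 1 by rewrite addr_gt0.
transitivity (\int[mu]_(t in pos) u y t).
  apply: eq_Rintegral => t _; rewrite /u c0E /Z -/z0.
  have -> : cexp (z0 * z0) * cpow z0 (- s) *
      (cpow z0 s * ((t `^ (s - 1))%:C * cexp ((- t)%:C * z0))) =
      (t `^ (s - 1))%:C * cexp (z0 * z0 + (- t)%:C * z0).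
    by rewrite cpowN cexpD; field; exact: cpow_neq0.
  by rewrite Re_realM.
transitivity (\int[mu]_(t in pos) u 0 t); last first.
  have e1 : Z 0 = 1 by [].
  have -> : euler_gamma s * Re c0 = \int[mu]_(t in pos) (Re c0 * euler_integrand s 1 t).
    rewrite RintegralZl//; last exact: integrable_euler.
    by rewrite mulrC euler_gammaE.
  apply: eq_Rintegral => t _; rewrite /u e1.
  have -> : cpow 1 s = 1.
    by rewrite -(rmorph1 (real_complex R)) cpow_real expr1n ln1 mul0r mulr0 expR0.
  have -> : cexp ((- t)%:C * 1) = (expR (- (1 * t)))%:C.
    by apply: complexP; rewrite mulr1 /= ?cos0 ?sin0 ?mulr1 ?mulr0 ?mul1r.
  by rewrite mul1r -rmorphM mulrC Re_realM mulrC.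
apply: (@Rintegral_deformation _ u v k
  (fun t => K * (s * euler_integrand s 1 t + euler_integrand (s + 1) 1 t)) (-1) (y + 1)).
- by rewrite ltr_pwDr// (lt_trans _ y0)//; lra.
- by apply/andP; split; lra.
- move=> p t hp t0.
  have d1 : cdiff (fun w => c0 * (cpow w s * ((t `^ (s - 1))%:C * cexp ((- t)%:C * w)))) (Z p)
     (c0 * cpow (Z p) s * ((s%:C * (Z p)^-1 * (t `^ (s - 1))%:C - (t `^ s)%:C) * cexp ((- t)%:C * Z p))).
    have h := cdiffM (cdiff_cst c0 (Z p)) (cdiffM (cdiff_cpow s (Z0 p))
      (cdiffM (cdiff_cst (t `^ (s - 1))%:C (Z p)) (cdiff_cexp (@cdiff_scale (- t)%:C (Z p))))).
    apply: (cdiff_eq h); rewrite /= (powRD1 s t0) rmorphM rmorphN /=.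
    by field; rewrite Zn.
  have [h _] := d1 Z p 'i%C erefl (cderiv_vertical p 1).
  apply: (is_derive_eq h); rewrite /k; congr Re; ring.
- move=> p t hp t0.
  have h := cderivM (cderiv_cst (c0 * 'i%C * (Z p)^-1 * cpow (Z p) s) t)
    (cderivM (cderiv_real (is_derive_powR s t0)) (cderiv_cexp (cderiv_scale (Z p) t))).
  apply: (is_derive_eq h.1); rewrite /k; congr Re.
  rewrite rmorphM /=; field; exact: Zn.
- move=> p t hp t0.
  have d1 := cderiv_real (is_derive_powR (s - 1) t0).
  have d2 := cderiv_real (is_derive_powR s t0).
  have dE := cderiv_cexp (cderiv_scale (Z p) t).
  have h := cderivM (cderiv_cst (c0 * 'i%C * cpow (Z p) s) t) (cderivM (cderivD
     (cderivM (cderiv_cst (s%:C * (Z p)^-1) t) d1) (cderivM (cderiv_cst (-1) t) d2)) dE).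
  have := cderiv_continuous_Re h; rewrite /k.
  by under [X in {for _, continuous X} -> _]eq_fun do rewrite mulN1r.
- move=> p t hp t0; have /andP[h1 h2] := cmodZ p hp.
  rewrite /k (le_trans (normRe_le _))// !cmodM cmodi mulr1 cmodE'.
  apply: (@le_trans _ _ (K * ((s * t `^ (s - 1) + t `^ s) * expR (- (1 * t))))).
    apply: ler_pM; rewrite ?mulr_ge0 ?cmod_ge0 ?expR_ge0//.
      by rewrite ler_wpM2l ?cmod_ge0 ?cmodP.
    rewrite ler_wpM2r ?expR_ge0// (le_trans (cmodB _ _))// !cmodM cmodV !cmod_real.
    rewrite (ger0_norm (ltW s0)) !ger0_norm ?powR_ge0// lerD2r ler_wpM2r ?powR_ge0//.
    by rewrite ler_piMr ?(ltW s0)// invf_le1// (lt_le_trans ltr01).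
  rewrite ler_wpM2l// /euler_integrand addrK le_eqVlt; apply/orP; left; apply/eqP; ring.
- apply: integrable_pos_scale; apply: integrable_pos_add.
    exact: integrable_pos_scale (integrable_euler s0 ltr01).
  exact: integrable_euler.
- by move=> p hp; exact: int_u.
- move=> p hp; apply: norm_cvg0.
  apply: (@squeeze_cvgr _ _ _ _ (cst 0) (fun t => K * (t `^ s * expR (- (1 * t))))).
  + by apply: filterS (nbhs_right_gt (0 : R)) => t t0; rewrite normr_ge0 vbound.
  + exact: cvg_cst.
  + by rewrite -[X in _ --> X](mulr0 K); apply: cvgMr; exact: cvg_powR_expR0.
- move=> p hp; apply: norm_cvg0.
  apply: (@squeeze_cvgr _ _ _ _ (cst 0) (fun t => K * (t `^ s * expR (- (1 * t))))).
  + by apply: filterS (nbhs_pinfty_gt (num_real (0 : R))) => t t0; rewrite normr_ge0 vbound.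
  + exact: cvg_cst.
  + by rewrite -[X in _ --> X](mulr0 K); apply: cvgMr; exact: cvg_powR_expR.
Qed.

(** Completing the square turns the integrand into [exp (- t ^ 2 / 4)] times
    [exp (z ^ 2)] on the line [Re z = 1 - t / 2], which is then moved to
    [Re z = 0]. *)
Lemma integral_gauss_line t :
  \int[mu]_(y in pos) Re (cexp ((1 +i* y) * (1 +i* y) + (- t)%:C * (1 +i* y))) =
  expR (- (t ^+ 2 / 4)) * (Num.sqrt pi / 2).
Proof.
pose a := 1 - t / 2.
pose l := Num.min a 0 - 1.
have la : l < a by rewrite /l ltrBlDr (le_lt_trans (_ : _ <= a)) ?ge_min ?lexx// ltrDl.
have l0 : l < 0 by rewrite /l ltrBlDr (le_lt_trans (_ : _ <= 0)) ?ge_min ?lexx ?orbT// ltrDl.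
have sh := Rintegral_admissible_shift (admissible_gauss l) la l0.
have i1 := integrable_admissible (admissible_gauss l) la.
transitivity (\int[mu]_(y in pos) (expR (- (t ^+ 2 / 4)) * Re (cexp ((a +i* y) * (a +i* y))))).
  apply: eq_Rintegral => y _.
  have -> : (1 +i* y) * (1 +i* y) + (- t)%:C * (1 +i* y) =
      (- (t ^+ 2 / 4))%:C + (a +i* y) * (a +i* y) :> C.
    by apply: complexP; rewrite !ReImE /= /a; field.
  rewrite cexpD.
  by rewrite cexp_real Re_realM.
rewrite RintegralZl// sh; congr (_ * _).
transitivity (\int[mu]_(y in pos) expR (- y ^+ 2)).
  apply: eq_Rintegral => y _.
  have -> : (0 +i* y) * (0 +i* y) = (- y ^+ 2)%:C :> C.
    by apply: complexP; rewrite !ReImE /=; ring.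
  by rewrite cexp_real.
by rewrite /Rintegral integral_gauss_pos.
Qed.

(** Hankel's contour integral after [zeta = z ^ 2]; the conjugate halves of the
    contour are combined into a real part. *)
Definition hankel g : R := \int[mu]_(y in pos) Re (cexp ((1 +i* y) * (1 +i* y)) * cpow (1 +i* y) g).

Lemma kern00 g z : kern g 0 0 z = cexp (z * z) * cpow z g.
Proof. by rewrite /kern mulr0 cpow0 addr0 invr1 mulr1. Qed.

Lemma integrable_hankel g : mu.-integrable pos
  (EFin \o (fun y => Re (cexp ((1 +i* y) * (1 +i* y)) * cpow (1 +i* y) g))).
Proof.
have h01 : 0 <= (0 : R) < 1 by rewrite lexx ltr01.
have := integrable_admissible (admissible_kern g h01 (lexx 0)) ltr01.
by under [X in mu.-integrable _ (_ \o X) -> _]eq_fun do rewrite kern00.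
Qed.

(** Writing [Gamma (s) z ^ (- s)] as a Laplace integral and exchanging the two
    integrals leaves a Gaussian integral along the line. *)
Lemma euler_gamma_hankel s : 0 < s ->
  euler_gamma s * hankel (- s) =
  Num.sqrt pi / 2 * \int[mu]_(t in pos) (t `^ (s - 1) * expR (- (t ^+ 2 / 4))).
Proof.
move=> s0; rewrite /hankel -RintegralZl//; last exact: integrable_hankel.
pose f y t := t `^ (s - 1) * (expR (1 - y ^+ 2 - t) * cos (2 * y - t * y)).
have fE y t : f y t = t `^ (s - 1) *
    Re (cexp ((1 +i* y) * (1 +i* y) + (- t)%:C * (1 +i* y))).
  rewrite /f /=; congr (_ * (expR _ * cos _)); ring.
transitivity (\int[mu]_(y in pos) \int[mu]_(t in pos) f y t).
  apply: eq_Rintegral => y; rewrite inE => /in_pos y0.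
  by rewrite -laplace_cpow//; apply: eq_Rintegral => t _; rewrite fE.
rewrite (@Rintegral_swap_pos _ f (fun y => expR 1 * gaussdom 0 y) (euler_integrand s 1)).
- have iJ : mu.-integrable pos (EFin \o (fun t => t `^ (s - 1) * expR (- (t ^+ 2 / 4)))).
    apply: (@integrable_pos_dominated _ _ (fun t => expR 1 * euler_integrand s 1 t)).
    + apply: measurable_pos_continuous => t t0.
      apply: continuousM; first exact: is_derive_continuous (is_derive_powR _ t0).
      have dsq := is_derive_mul (is_derive_mul (is_derive_id t (1 : R)) (is_derive_id t (1 : R)))
        (is_derive_cst (4^-1 : R) t (1 : R)).
      exact: is_derive_continuous (is_derive_compose (is_derive_opp dsq) (is_derive_expR _)).
    + move=> t t0; rewrite ger0_norm ?mulr_ge0 ?powR_ge0 ?expR_ge0//.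
      rewrite /euler_integrand mulrCA ler_wpM2l ?powR_ge0// -expRD ler_expR -subr_ge0.
      have -> : 1 + - (1 * t) - - (t ^+ 2 / 4) = (t / 2 - 1) ^+ 2 by field.
      exact: sqr_ge0.
    + exact: integrable_pos_scale (integrable_euler s0 ltr01).
  rewrite mulrC -RintegralZr//; apply: eq_Rintegral => t _.
  transitivity (t `^ (s - 1) * (expR (- (t ^+ 2 / 4)) * (Num.sqrt pi / 2))); last by ring.
  rewrite -integral_gauss_line -RintegralZl//.
    by apply: eq_Rintegral => y _; rewrite fE.
  pose e y := Re (cexp ((1 +i* y) * (1 +i* y) + (- t)%:C * (1 +i* y))).
  apply: (@integrable_pos_dominated _ e (fun y => expR (1 - t) * gaussdom 0 y)).
  + apply: measurable_pos_continuous => y y0.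
    have dI := cderiv_vertical y (1 : R).
    exact: cderiv_continuous_Re (cderiv_cexp (cderivD (cderivM dI dI) (cderivM (cderiv_cst (- t)%:C y) dI))).
  + move=> y y0; rewrite (le_trans (normRe_le _))// cmod_cexp /gaussdom -expRD ler_expR.
    by rewrite !ReImE /= le_eqVlt; apply/orP; left; apply/eqP; ring.
  + exact: integrable_pos_scale (integrable_gaussdom 0).
- have m1 := @measurable_fst _ _ (measurableTypeR R) (measurableTypeR R).
  have m2 := @measurable_snd _ _ (measurableTypeR R) (measurableTypeR R).
  rewrite /f; apply: measurable_funM.
    exact: (measurableT_comp (measurable_powR _) m2).
  apply: measurable_funM.
    apply: (measurableT_comp (@measurable_expR R)).
    apply: measurable_funB => //; apply: measurable_funB => //.
    exact: measurable_funX.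
  apply: (measurableT_comp (continuous_measurable_fun (@continuous_cos R))).
  by apply: measurable_funB; apply: measurable_funM.
- move=> y t y0 t0; rewrite /f !normrM (ger0_norm (powR_ge0 _ _)) (ger0_norm (expR_ge0 _)).
  rewrite /euler_integrand [leRHS]mulrCA ler_wpM2l ?powR_ge0//.
  apply: (@le_trans _ _ (expR (1 - y ^+ 2 - t))).
    by rewrite ler_piMr ?expR_ge0// cos_max.
  by rewrite /gaussdom -!expRD ler_expR le_eqVlt; apply/orP; left; apply/eqP; ring.
- by move=> y _; rewrite mulr_ge0 ?expR_ge0 ?gaussdom_ge0.
- by move=> t _; exact: euler_integrand_ge0.
- exact: integrable_pos_scale (integrable_gaussdom 0).
- exact: integrable_euler.
Qed.

(** The integral of the derivative of [exp (z ^ 2) z ^ g] vanishes. *)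
Lemma hankel_rec g : 2 * hankel (g + 1) + g * hankel (g - 1) = 0.
Proof.
have h01 : 0 <= (0 : R) < 1 by rewrite lexx ltr01.
have h := Rintegral_admissible_derivative (admissible_kern g h01 (lexx 0)) ltr01.
rewrite -RintegralZl//; last exact: integrable_hankel.
rewrite -RintegralZl//; last exact: integrable_hankel.
rewrite -RintegralD//; [|exact: integrable_pos_scale (integrable_hankel _)..].
rewrite -[RHS]h; apply: eq_Rintegral => y _.
set z : C := 1 +i* y; have z0 : 0 < Re z by rewrite /= ltr01.
have zn : z != 0 by exact: Re_gt0_neq0.
rewrite /kern' kern00 /kern_dlog mulr0 (_ : (0 : R)%:C = 0)// !mul0r subr0.
rewrite !cpowD cpowN cpow1//.
have -> : cexp (z * z) * cpow z g * (z + z + g%:C / z) =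
   2%:C * (cexp (z * z) * (cpow z g * z)) + g%:C * (cexp (z * z) * (cpow z g / z)).
  rewrite (_ : 2%:C = 1 + 1); last by rewrite -(rmorph1 (real_complex R)) -rmorphD.
  by field.
by rewrite ReD !Re_realM.
Qed.

(** For [1 / 2 < b] this combines [euler_gamma_hankel], at [s = 2 * b - 1], with the
    duplication formula.  Both sides satisfy the same recursion in [b], which
    leads from there to every real [b]. *)
Theorem rgamma_hankel b : rgamma b = 2 / pi * hankel (1 - 2 * b).
Proof.
have pi0 : pi != 0 :> R by rewrite gt_eqF ?pi_gt0.
have base b' : 1 / 2 < b' -> rgamma b' = 2 / pi * hankel (1 - 2 * b').
  move=> hb; pose s := 2 * b' - 1; have s0 : 0 < s by rewrite /s; lra.
  have hb0 : 0 < b' by lra.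
  have h1 := euler_gamma_hankel s0; have h2 := euler_gamma_duplication s0.
  rewrite (_ : (s + 1) / 2 = b') in h2; last by rewrite /s; field.
  rewrite (_ : - s = 1 - 2 * b') in h1; last by rewrite /s; ring.
  set J := (X in (_ * X)%E = _) in h2.
  have Jfin : J = (\int[mu]_(t in pos) (t `^ (s - 1) * expR (- (t ^+ 2 / 4))))%:E.
    rewrite /Rintegral -/J fineK//.
    have G0 := euler_gamma_gt0 hb0.
    have J0 : (0 <= J)%E.
      by apply: integral_ge0 => t _; rewrite lee_fin mulr_ge0 ?powR_ge0 ?expR_ge0.
    rewrite ge0_fin_numE//; case: J h2 J0 => [r| |]//; rewrite ?ltry//.
    by rewrite mulry gtr0_sg// mul1e.
  rewrite Jfin -EFinM in h2; case: h2; set J' := Rintegral _ _ _ => h2.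
  rewrite -/J' in h1.
  have Gs := lt0r_neq0 (euler_gamma_gt0 s0); have Gb := lt0r_neq0 (euler_gamma_gt0 hb0).
  rewrite /rgamma /gamma_shift hb0 big_ord0 addr0 mul1r.
  have sq : Num.sqrt pi * Num.sqrt pi = pi :> R by rewrite -expr2 sqr_sqrtr ?pi_ge0.
  have h3 : euler_gamma b' * hankel (1 - 2 * b') = pi / 2.
    apply: (mulfI Gs); rewrite mulrCA h1.
    transitivity (Num.sqrt pi / 2 * (euler_gamma b' * J')); first by ring.
    rewrite h2; transitivity (Num.sqrt pi * Num.sqrt pi / 2 * euler_gamma s).
      by ring.
    by rewrite sq; ring.
  have -> : hankel (1 - 2 * b') = pi / 2 / euler_gamma b'.
    by apply: (mulfI Gb); rewrite h3; field.
  by move: (pi : R) pi0 => q q0; field; rewrite q0 Gb.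
have [n hn] : exists n : nat, 1 / 2 < b + n%:R.
  exists (Num.truncn (1 - b)).+1.
  by have := truncnS_gt (1 - b); lra.
elim: n b hn => [|n IHn] b hn; first by apply: base; rewrite addr0 in hn.
rewrite rgammaS IHn; last by rewrite -addrA nat1r.
have := hankel_rec (- 2 * b).
rewrite (_ : - 2 * b + 1 = 1 - 2 * b); last by ring.
rewrite (_ : - 2 * b - 1 = 1 - 2 * (b + 1)); last by ring.
move=> h; have -> : hankel (1 - 2 * b) = b * hankel (1 - 2 * (b + 1)) by lra.
by ring.
Qed.

End Hankel.

(** * Integral representation of the Mittag-Leffler function *)

Section MittagLeffler.
Context {R : realType}.
Local Notation C := R[i].
Local Notation mu := (@lebesgue_measure R).
Local Notation pos := (`]0%R, +oo[%classic : set R).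
Implicit Types (a al t x y g b : R) (z : C) (m n : nat).

(** With [w = z ^ (2 * al)], the integrand is
    [exp (z ^ 2) z ^ (- 1) w ^ (m + 1) / (w + x)].  For [0 < al < 1] and [0 < x] it
    is, at [m = 0], the
    Mittag-Leffler function at [- x], and in general the remainder after [m]
    terms of its expansion at infinity, rescaled by [(- x) ^ m]. *)
Definition mlg m al x : R := 2 / pi *
  \int[mu]_(y in pos) Re (kern (2 * al * m.+1%:R - 1) al x (1 +i* y)).

Lemma integrable_kern a g al x : 0 <= al < 1 -> 0 <= x -> 0 < a ->
  mu.-integrable pos (EFin \o (fun y => Re (kern g al x (a +i* y)))).
Proof. by move=> hal x0 a0; exact: (integrable_admissible (admissible_kern g hal x0) a0). Qed.

Lemma hankelE a g : 0 < a ->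
  hankel g = \int[mu]_(y in pos) Re (kern g 0 0 (a +i* y)).
Proof.
move=> a0; have h01 : 0 <= (0 : R) < 1 by rewrite lexx ltr01.
rewrite (Rintegral_admissible_shift (admissible_kern g h01 (lexx 0)) a0 ltr01).
by apply: eq_Rintegral => y _; rewrite kern00.
Qed.

(** Under the integral,
    [w ^ (m + 1) / (w + x) = (w ^ (m + 1) - w ^ (m + 2) / (w + x)) / x]. *)
Lemma mlg_rec m al x : 0 < al < 1 -> 0 < x ->
  mlg m al x = (rgamma (1 - m.+1%:R * al) - mlg m.+1 al x) / x.
Proof.
move=> /andP[al0 al1] x0; have hal : 0 <= al < 1 by rewrite ltW.
have xn : x != 0 by rewrite gt_eqF.
rewrite rgamma_hankel /mlg (hankelE _ (ltr01 : 0 < (1 : R))).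
rewrite -mulrBr -RintegralB//; last 2 first.
- by apply: integrable_kern => //; rewrite lexx ltr01.
- by apply: integrable_kern => //; exact: ltW.
rewrite -[RHS]mulrA -RintegralZr//; last first.
  have h01 : 0 <= (0 : R) < 1 by rewrite lexx ltr01.
  exact: (integrableB _ (integrable_kern _ h01 (lexx 0) ltr01) (integrable_kern _ hal (ltW x0) ltr01)).
congr (_ * _); apply: eq_Rintegral => y _.
apply: (mulIf xn); rewrite divfK//.
rewrite mulrC -Re_realM -ReN -ReD; congr Re.
rewrite kern00 /kern.
set z : C := 1 +i* y; have n0 := cpowD_neq0 z hal (ltW x0).
rewrite (_ : 1 - 2 * (1 - m.+1%:R * al) = 2 * al * m.+1%:R - 1); last by ring.
rewrite (_ : 2 * al * m.+2%:R - 1 = 2 * al * m.+1%:R - 1 + 2 * al); last first.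
  by rewrite -[m.+2%:R]natr1; ring.
rewrite (cpowD _ _ (2 * al)).
by field.
Qed.

Lemma mlg_expansion m al x : 0 < al < 1 -> 0 < x ->
  mlg 0 al x = \sum_(k < m) (-1) ^+ k * rgamma (1 - k.+1%:R * al) / x ^+ k.+1 +
    (-1) ^+ m * mlg m al x / x ^+ m.
Proof.
move=> hal x0; have xn : x != 0 by rewrite gt_eqF.
elim: m => [|m ->]; first by rewrite big_ord0 add0r expr0 mul1r divr1.
rewrite big_ord_recr /= -addrA; congr (_ + _).
rewrite (mlg_rec m hal x0) !exprS; field.
by rewrite xn expf_neq0.
Qed.

(** The coefficients of the power series are Hankel integrals, which makes its
    partial sums integrals of geometric sums of ratio [- x / w].  They converge
    on a line so far to the right that [2 * x <= |w|]; the sum is then moved back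
    to [Re z = 1]. *)
Lemma mittag_lefflerE al x : 0 < al < 1 -> 0 < x ->
  mittag_leffler al 1 (- x) = mlg 0 al x.
Proof.
move=> /andP[al0 al1] x0; have hal : 0 <= al < 1 by rewrite ltW.
have pi0 : (pi : R) != 0 by rewrite gt_eqF ?pi_gt0.
(* the least [a >= 1] with [2 * x <= a ^ (2 * al)] *)
pose a := expR (Num.max 0 (ln (2 * x) / (2 * al))).
have a0 : 0 < a by exact: expR_gt0.
have ha : 2 * x <= expR (2 * al * ln a).
  rewrite /a expRK -[leLHS]lnK ?posrE ?mulr_gt0// ler_expR [leRHS]mulrC.
  by rewrite -ler_pdivrMr ?mulr_gt0// le_max lexx orbT.
pose z y : C := a +i* y.
pose K y := kern (2 * al - 1) al x (z y).
pose q y : C := - x%:C * (cpow (z y) (2 * al))^-1.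
pose T n y := Re (K y * q y ^+ n).
pose g n := - 1 - 2 * al * n%:R.
have Tdiff n y : T n y - T n.+1 y = (- x) ^+ n * Re (kern (g n) 0 0 (z y)).
  rewrite /T -ReN -ReD -Re_realM; congr Re.
  rewrite kern00 /K /kern /q exprS; set w := cpow (z y) (2 * al).
  have n0 : w + x%:C != 0 := cpowD_neq0 (z y) hal (ltW x0).
  have wn : w != 0 by exact: cpow_neq0.
  have -> : cpow (z y) (2 * al - 1) = w * cpow (z y) (-1) by rewrite cpowD.
  have -> : cpow (z y) (g n) = cpow (z y) (-1) * (w ^+ n)^-1.
    by rewrite /g cpowD cpowN cpowX mulr_natr.
  rewrite rmorphXn rmorphN exprMn exprVn.
  by field; rewrite n0 wn expf_neq0.
have h01 : 0 <= (0 : R) < 1 by rewrite lexx ltr01.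
have iT n : mu.-integrable pos (EFin \o T n).
  elim: n => [|n IHn].
    have := integrable_kern (2 * al - 1) hal (ltW x0) a0.
    by under [X in mu.-integrable _ (_ \o X) -> _]eq_fun do rewrite -[kern _ _ _ _]mulr1.
  have -> : T n.+1 = (fun y => T n y - (- x) ^+ n * Re (kern (g n) 0 0 (z y))).
    by apply/funext => y; rewrite -Tdiff opprB addrC subrK.
  have i2 := integrable_kern (g n) h01 (lexx 0) a0.
  exact: (integrableB _ IHn (integrable_pos_scale ((- x) ^+ n) i2)).
pose I n := \int[mu]_(y in pos) T n y.
have Idiff n : I n - I n.+1 = pi / 2 * ((- x) ^+ n * rgamma (al * n%:R + 1)).
  rewrite /I -RintegralB//; under eq_Rintegral do rewrite Tdiff.
  rewrite RintegralZl//; last exact: integrable_kern.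
  rewrite -(hankelE _ a0) rgamma_hankel (_ : 1 - 2 * (al * n%:R + 1) = g n); last first.
    by rewrite /g; ring.
  by move: (pi : R) pi0 => p p0; field.
have Sn n : series (fun i => (- x) ^+ i * rgamma (al * i%:R + 1)) n = 2 / pi * (I 0%N - I n).
  elim: n => [|n IHn]; first by rewrite seriesEnat /= big_geq// subrr mulr0.
  rewrite seriesSr IHn (_ : I 0%N - I n.+1 = (I 0%N - I n) + (I n - I n.+1)); last by ring.
  by rewrite Idiff [RHS]mulrDr; congr (_ + _); move: (pi : R) pi0 => p p0; field.
have [A [M hAM]] := kern_bound (2 * al - 1) hal (ltW x0) (a + 1) (divr_gt0 a0 (ltr0n _ 2)).
pose B := \int[mu]_(y in pos) (A * gaussdom M y).
have iB : mu.-integrable pos (EFin \o (fun y => A * gaussdom M y)).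
  exact: integrable_pos_scale (integrable_gaussdom M).
have qle y : 0 < y -> cmod (q y) <= 2^-1.
  move=> y0; rewrite /q cmodM cmodN cmodV cmod_real (gtr0_norm x0).
  rewrite cmod_cpow// ler_pdivrMr ?expR_gt0// mulrC ler_pdivlMr// mulrC.
  apply: (le_trans ha); rewrite ler_expR ler_wpM2l ?mulr_ge0 ?(ltW al0)//.
  rewrite ler_ln ?posrE//.
    by rewrite (le_trans _ (normRe_le _))//= ler_norm.
  by rewrite cmod_gt0 Re_gt0_neq0.
have Ile n : `|I n| <= 2^-1 ^+ n * B.
  rewrite (le_trans (le_normr_Rintegral _ (iT n)))// -RintegralZl//.
  apply: le_Rintegral => //; [exact: integrable_norm (iT n)|exact: integrable_pos_scale|].
  move=> y /in_pos y0; rewrite (le_trans (normRe_le _))// cmodM cmodX mulrC.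
  apply: ler_pM; rewrite ?exprn_ge0 ?cmod_ge0//.
    by rewrite lerXn2r ?nnegrE ?cmod_ge0// qle.
  have [] // := hAM a y _ y0.
  by apply/andP; split; [rewrite ltr_pdivrMr// ltr_pMr// ltr1n|rewrite ltrDl].
have I0 : I n @[n --> \oo] --> (0 : R).
  apply: norm_cvg0; apply: (@squeeze_cvgr _ _ _ _ (cst 0) (fun n => 2^-1 ^+ n * B)).
  - by apply: nearW => n; rewrite normr_ge0 Ile.
  - exact: cvg_cst.
  - rewrite -[X in _ --> X](mul0r B); apply: cvgMl; apply: cvg_expr.
    by rewrite ger0_norm ?invr_ge0// invf_lt1// ltr1n.
rewrite /mittag_leffler; apply/cvg_lim => //.
rewrite [X in X @ _ --> _](_ : _ = fun n => 2 / pi * (I 0%N - I n)); last first.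
  by apply/funext => n; exact: Sn.
have -> : mlg 0 al x = 2 / pi * (I 0%N - 0).
  rewrite subr0 /mlg mulr1; congr (_ * _).
  rewrite (Rintegral_admissible_shift (admissible_kern _ hal (ltW x0)) ltr01 a0).
  by apply: eq_Rintegral => y _; rewrite /T expr0 mulr1.
by apply: cvgMr; apply: cvgB => //; exact: cvg_cst.
Qed.

End MittagLeffler.

(** * Estimates uniform in the order of the equation *)

Section Estimates.
Context {R : realType}.
Local Notation C := R[i].
Local Notation mu := (@lebesgue_measure R).
Local Notation pos := (`]0%R, +oo[%classic : set R).
Implicit Types (a al be t x y g b : R) (z : C) (m n : nat).

(** The mean value theorem for every [y], followed by integration of the bound. *)
Lemma Rintegral_lipschitz (u D : R -> R -> R) (g : R -> R) (l r a b : R) :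
  (forall p y, l <= p <= r -> 0 < y -> is_derive p 1 (u ^~ y) (D p y)) ->
  (forall p y, l <= p <= r -> 0 < y -> `|D p y| <= g y) ->
  (forall p, l <= p <= r -> mu.-integrable pos (EFin \o u p)) ->
  mu.-integrable pos (EFin \o g) ->
  l <= a <= r -> l <= b <= r ->
  `| \int[mu]_(y in pos) u a y - \int[mu]_(y in pos) u b y | <=
    `|a - b| * \int[mu]_(y in pos) g y.
Proof.
move=> du Dg iu ig.
wlog ab : a b / a <= b.
  move=> wl ha hb; have [ab|/ltW ba] := leP a b; first exact: wl.
  by rewrite distrC (distrC a); exact: wl.
move=> ha hb; rewrite -RintegralB//; [|exact: iu|exact: iu].
have iab : mu.-integrable pos (EFin \o (fun y => u a y - u b y)).
  exact: (integrableB _ (iu _ ha) (iu _ hb)).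
rewrite (le_trans (le_normr_Rintegral _ iab))// -RintegralZl//.
apply: le_Rintegral => //; [exact: integrable_norm iab|exact: integrable_pos_scale|].
move=> y /in_pos y0.
have inlr p : p \in `[a, b] -> l <= p <= r.
  move: ha hb => /andP[la _] /andP[_ br].
  by rewrite in_itv /= => /andP[ap pb]; rewrite (le_trans la)//= (le_trans pb).
have [||p /inlr hp] := @MVT_segment R (u ^~ y) (D ^~ y) a b ab.
- by move=> p /subset_itv_oo_cc/inlr hp; exact: du.
- apply: derivable_within_continuous => p /inlr hp.
  exact: is_derive_derivable (du p y hp y0).
by rewrite distrC => ->; rewrite normrM mulrC (distrC a) ler_wpM2l// Dg.
Qed.

Section PointBounds.
Variable y : R.
Hypothesis y0 : 0 < y.
Let z : C := 1 +i* y.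

Let z0 : 0 < Re z. Proof. by rewrite /= ltr01. Qed.

Let ln_cmod : 0 <= ln (cmod z) <= y.
Proof.
have m1 : 1 <= cmod z by rewrite (le_trans _ (normRe_le _))//= normr1.
apply/andP; split; first by rewrite ln_ge0.
have := @le_ln1Dx R (cmod z - 1); rewrite addrCA subrr addr0 => h.
rewrite (le_trans (h _))//; first by lra.
by rewrite lerBlDl (le_trans (cmod_le _))//= normr1 ger0_norm// ltW.
Qed.

Lemma cmod_clog_line : cmod (clog z) <= (1 + pi) * expR y.
Proof.
have /andP[l0 l1] := ln_cmod; have ey : 1 <= expR y by rewrite -expR0 ler_expR ltW.
rewrite (le_trans (cmod_le _))// Re_clog// ger0_norm// mulrDl mul1r.
apply: lerD; first by rewrite (le_trans l1)// expR_ge.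
rewrite (@le_trans _ _ (pi / 2))//.
  by rewrite ler_norml /= ltW ?atan_gtNpi2//= ltW ?atan_ltpi2.
rewrite (@le_trans _ _ pi)//; first by have := pi_ge0 R; lra.
by rewrite ler_peMr// pi_ge0.
Qed.

Lemma cmod_cexp_cpow_line g N : g <= N -> 0 <= N ->
  cmod (cexp (z * z) * cpow z g) <= expR 1 * gaussdom N y.
Proof.
move=> gN N0; have /andP[l0 l1] := ln_cmod.
rewrite cmodM cmod_cexp cmod_cpow// /gaussdom -!expRD ler_expR ReM /=.
have : g * ln (cmod z) <= N * y.
  by rewrite (le_trans (ler_wpM2r l0 gN))// ler_wpM2l.
by rewrite !expr2; lra.
Qed.

End PointBounds.

Lemma cos_pi_antitone al al1 : 0 <= al -> al <= al1 -> al1 < 1 ->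
  0 < cos (al1 * pi / 2 : R) <= cos (al * pi / 2).
Proof.
move=> al0 le1 lt1; have pi0 := pi_gt0 R.
have h : 0 <= al1 < 1 by rewrite (le_trans al0).
have a1 : 0 <= al * pi by rewrite mulr_ge0// ltW.
have a2 : al * pi <= al1 * pi by rewrite ler_wpM2r// ltW.
have a3 : al1 * pi < pi by rewrite gtr_pMl.
by rewrite cos_al_gt0//= leNgt ltr_cos ?in_itv/= -?leNgt; lra.
Qed.

(** The derivative in [al] at fixed [t], where [al] enters the kernel through its
    two exponents and through [x = lam * t ^ al]. *)
Let kernD (e : R) (lam t al : R) z : C :=
  kern (2 * al * e - 1) al (lam * t `^ al) z *
  ((2 * e)%:C * clog z - (2%:C * clog z * cpow z (2 * al) + (ln t * (lam * t `^ al))%:C) *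
     (cpow z (2 * al) + (lam * t `^ al)%:C)^-1).

Let cderiv_cpow_exponent z p q al :
  cderiv (fun s => cpow z (p * s + q)) al (cpow z (p * al + q) * (p%:C * clog z)).
Proof.
have d1 : is_derive al 1 (fun s : R => p * s + q) p.
  apply: (is_derive_eq (is_derive_add (is_derive_linear p al) (is_derive_cst q al (1 : R)))).
  by rewrite addr0.
have d2 := cderiv_cexp (cderivM (cderiv_real d1) (cderiv_cst (clog z) al)).
by apply: (cderiv_eq d2); rewrite mulr0 add0r (mulrC (clog z)).
Qed.

Let is_derive_expo lam t al : 0 < t ->
  is_derive al 1 (fun s => lam * t `^ s) (ln t * (lam * t `^ al)).
Proof.
move=> t0.
have e s : t `^ s = expR (ln t * s) by rewrite /powR gt_eqF// mulrC.
under eq_fun do rewrite e.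
rewrite e.
apply: (is_derive_eq (is_derive_mul (is_derive_cst lam al (1 : R))
   (is_derive_compose (is_derive_linear (ln t) al) (is_derive_expR _)))).
by rewrite /cst; ring.
Qed.

Let cderiv_kern_alpha e lam t al z : 0 <= al < 1 -> 0 < lam -> 0 < t ->
  cderiv (fun s => kern (2 * s * e - 1) s (lam * t `^ s) z) al (kernD e lam t al z).
Proof.
move=> hal lam0 t0; have x0 : 0 <= lam * t `^ al by rewrite mulr_ge0 ?powR_ge0 ?ltW.
have n0 := cpowD_neq0 z hal x0.
have d1 := cderiv_cpow_exponent z (2 * e) (-1) al.
have d2 := cderiv_cpow_exponent z 2 0 al.
have e2 : (fun s : R => cpow z (2 * s + 0)) = (fun s => cpow z (2 * s)).
  by apply/funext => s; rewrite addr0.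
rewrite e2 addr0 in d2.
have e1 : (fun s : R => cpow z (2 * e * s + -1)) = (fun s => cpow z (2 * s * e - 1)).
  by apply/funext => s; congr cpow; ring.
rewrite e1 in d1.
have d3 := cderivD d2 (cderiv_real (is_derive_expo lam al t0)).
have d4 := cderivM (cderivM (cderiv_cst (cexp (z * z)) al) d1) (cderivV n0 d3).
apply: (cderiv_eq d4); rewrite /kernD /kern (_ : 2 * e * al + -1 = 2 * al * e - 1); last by ring.
by move: (lam * t `^ al) n0 => X n0; field.
Qed.

(** The decay comes from the denominator, at least a constant times
    [lam * t ^ al >= mu0 * t ^ al0].  Differentiation in [al] inserts logarithms of
    [z], absorbed by the Gaussian, and a factor [ln t] from [t ^ al]; it also
    produces [w] and [x] in a numerator, but over [w + x], hence bounded. *)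
Theorem mlg_estimates m (al0 al1 mu0 : R) : 0 < al0 -> al1 < 1 -> 0 < mu0 ->
  exists2 K, 0 <= K & forall lam t, mu0 <= lam -> 1 <= t ->
    (forall al, al0 <= al <= al1 -> `|mlg m al (lam * t `^ al)| <= K * t `^ (- al0)) /\
    (forall al be, al0 <= al <= al1 -> al0 <= be <= al1 ->
      `|mlg m al (lam * t `^ al) - mlg m be (lam * t `^ be)| <=
      K * (1 + ln t) * t `^ (- al0) * `|al - be|).
Proof.
move=> al00 al11 mu00.
pose e : R := m.+1%:R; have e0 : 0 <= e by [].
set c := cos (al1 * pi / 2).
have pi0 := pi_gt0 R.
pose L : R := (2 * e + 2 / c + c^-1) * (1 + pi).
pose A := expR 1 / (c * mu0).
pose I := \int[mu]_(y in pos) gaussdom (2 * e + 1) y.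
have [al01|al10] := leP al0 al1; last first.
  exists 0 => // lam t _ _; split=> [al|al be] /andP[h1 h2];
    by have := le_trans h1 h2; rewrite leNgt al10.
have /andP[c0 _] := cos_pi_antitone (ltW al00) al01 al11; rewrite -/c in c0.
have cV : 0 <= c^-1 by rewrite invr_ge0 ltW.
have L0 : 0 <= L.
  by rewrite mulr_ge0//; [rewrite !addr_ge0// mulr_ge0|rewrite addr_ge0// ltW].
have A0 : 0 <= A by rewrite divr_ge0 ?expR_ge0// mulr_ge0 ?(ltW c0) ?(ltW mu00).
have I0 : 0 <= I by apply: Rintegral_ge0 => y _; exact: gaussdom_ge0.
have iI k : mu.-integrable pos (EFin \o (fun y => k * gaussdom (2 * e + 1) y)).
  exact: integrable_pos_scale (integrable_gaussdom _).
have p2 : 0 <= 2 / pi :> R by rewrite divr_ge0// ltW.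
exists (2 / pi * (A * (1 + L) * I)).
  by rewrite mulr_ge0// mulr_ge0// mulr_ge0// addr_ge0.
move=> lam t mulam t1.
have t0 : 0 < t by exact: lt_le_trans t1.
have lam0 : 0 < lam by exact: lt_le_trans mulam.
have tau0 : 0 <= ln t by rewrite ln_ge0.
have D0 : 0 <= t `^ (- al0) by exact: powR_ge0.
have hal al : al0 <= al <= al1 -> 0 <= al < 1.
  by move=> /andP[h1 h2]; rewrite (le_trans (ltW al00) h1) (le_lt_trans h2).
have x0 al : 0 < lam * t `^ al by rewrite mulr_gt0 ?powR_gt0.
have gle y : 0 < y -> gaussdom (2 * e) y <= gaussdom (2 * e + 1) y.
  by move=> y0; rewrite ler_expR lerD2r ler_wpM2r ?(ltW y0)// lerDl.
have den al y : al0 <= al <= al1 -> c * (cmod (cpow (1 +i* y) (2 * al)) + lam * t `^ al) <=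
    cmod (cpow (1 +i* y) (2 * al) + (lam * t `^ al)%:C).
  move=> h; apply: le_trans (cmod_cpowD_ge _ (hal _ h) (ltW (x0 al))).
  have /andP[h1 h2] := h.
  have /andP[_ cc] := cos_pi_antitone (le_trans (ltW al00) h1) h2 al11.
  by rewrite ler_wpM2r// addr_ge0 ?cmod_ge0 ?(ltW (x0 _)).
have den0 al y : al0 <= al <= al1 -> 0 < cmod (cpow (1 +i* y) (2 * al) + (lam * t `^ al)%:C).
  by move=> h; rewrite cmod_gt0 cpowD_neq0 ?hal// ltW.
have xbig al : al0 <= al <= al1 -> (lam * t `^ al)^-1 <= mu0^-1 * t `^ (- al0).
  move=> /andP[h1 _]; rewrite powRN -invfM lef_pV2 ?posrE ?mulr_gt0 ?powR_gt0//.
  by rewrite ler_pM ?powR_ge0 ?(ltW mu00)// ler_powR.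
have kb al y : al0 <= al <= al1 -> 0 < y ->
    cmod (kern (2 * al * e - 1) al (lam * t `^ al) (1 +i* y)) <=
    A * t `^ (- al0) * gaussdom (2 * e) y.
  move=> h y0; have /andP[hal0 hal1] := hal _ h.
  rewrite /kern cmodM cmodV.
  have h1 : cmod (cexp ((1 +i* y) * (1 +i* y)) * cpow (1 +i* y) (2 * al * e - 1)) <=
      expR 1 * gaussdom (2 * e) y.
    apply: cmod_cexp_cpow_line => //; last by rewrite mulr_ge0.
    rewrite lerBlDl (@le_trans _ _ (2 * e))// ?lerDr//.
    by rewrite ler_wpM2r// ler_piMr// ltW.
  have h2 : (cmod (cpow (1 +i* y) (2 * al) + (lam * t `^ al)%:C))^-1 <=
      c^-1 * (mu0^-1 * t `^ (- al0)).
    apply: (@le_trans _ _ (c^-1 * (lam * t `^ al)^-1)); last first.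
      by rewrite ler_wpM2l ?invr_ge0 ?(ltW c0)// xbig.
    rewrite -invfM lef_pV2 ?posrE ?den0 ?(mulr_gt0 c0 (x0 al))//.
    apply: le_trans (den _ y h); rewrite ler_wpM2l ?(ltW c0)// lerDr.
    exact: cmod_ge0.
  apply: (@le_trans _ _ (expR 1 * gaussdom (2 * e) y * (c^-1 * (mu0^-1 * t `^ (- al0))))).
    by rewrite ler_pM ?cmod_ge0 ?invr_ge0 ?cmod_ge0.
  by rewrite /A invfM le_eqVlt; apply/orP; left; apply/eqP; ring.
have ik al : al0 <= al <= al1 -> mu.-integrable pos
    (EFin \o (fun y => Re (kern (2 * al * e - 1) al (lam * t `^ al) (1 +i* y)))).
  by move=> h; apply: integrable_kern => //; [exact: hal|exact: ltW].
split=> [al h|al be h h'].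
  rewrite /mlg normrM (ger0_norm p2) -[leRHS]mulrA ler_wpM2l//.
  rewrite (le_trans (le_normr_Rintegral _ (ik _ h)))//.
  apply: (@le_trans _ _ (A * t `^ (- al0) * I)); last first.
    rewrite [leLHS]mulrAC ler_wpM2r// ler_wpM2r// ler_peMr// lerDl//.
  rewrite -RintegralZl//; last exact: integrable_gaussdom.
  apply: le_Rintegral => //; first exact: integrable_norm (ik _ h).
  move=> y /in_pos y0; rewrite (le_trans (normRe_le _))// (le_trans (kb _ _ h y0))//.
  by apply: ler_wpM2l; [exact: mulr_ge0|exact: gle].
rewrite /mlg -mulrBr normrM (ger0_norm p2).
pose X := A * I * (1 + ln t) * t `^ (- al0) * `|al - be|.
have T0 : 0 <= 1 + ln t by rewrite addr_ge0.
have X0 : 0 <= X by rewrite mulr_ge0// mulr_ge0// mulr_ge0// mulr_ge0.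
have -> : 2 / pi * (A * (1 + L) * I) * (1 + ln t) * t `^ (- al0) * `|al - be| =
  2 / pi * (X * (1 + L)) by rewrite /X; ring.
rewrite ler_wpM2l//.
apply: (@le_trans _ _ (`|al - be| *
   \int[mu]_(y in pos) (A * t `^ (- al0) * (L * (1 + ln t)) * gaussdom (2 * e + 1) y))); last first.
  rewrite RintegralZl//; last exact: integrable_gaussdom.
  rewrite -/I [leLHS](_ : _ = X * L); last by rewrite /X; ring.
  by rewrite ler_wpM2l// lerDr.
pose g y := A * t `^ (- al0) * (L * (1 + ln t)) * gaussdom (2 * e + 1) y.
have du p y : al0 <= p <= al1 -> 0 < y -> is_derive p 1
    (fun al => Re (kern (2 * al * e - 1) al (lam * t `^ al) (1 +i* y)))
    (Re (kernD e lam t p (1 +i* y))).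
  move=> hp y0; exact: (cderiv_kern_alpha e (1 +i* y) (hal _ hp) lam0 t0).1.
have Dg p y : al0 <= p <= al1 -> 0 < y -> `|Re (kernD e lam t p (1 +i* y))| <= g y.
  move=> hp y0; rewrite (le_trans (normRe_le _))// /kernD cmodM.
  set w := cpow (1 +i* y) (2 * p); set x := lam * t `^ p.
  have dn := den p y hp; have dn0 := den0 p y hp; rewrite -/w -/x in dn dn0.
  have ey : 1 <= expR y by rewrite -expR0 ler_expR ltW.
  have lg := cmod_clog_line y0.
  have wb : cmod w / cmod (w + x%:C) <= c^-1.
    rewrite ler_pdivrMr// mulrC ler_pdivlMr// mulrC (le_trans _ dn)//.
    by rewrite ler_wpM2l ?(ltW c0)// lerDl ltW// x0.
  have xb : x / cmod (w + x%:C) <= c^-1.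
    rewrite ler_pdivrMr// mulrC ler_pdivlMr// mulrC (le_trans _ dn)//.
    by rewrite ler_wpM2l ?(ltW c0)// lerDr cmod_ge0.
  pose l := cmod (clog (1 +i* y)); have l0 : 0 <= l := cmod_ge0 _.
  have br : cmod ((2 * e)%:C * clog (1 +i* y) - (2%:C * clog (1 +i* y) * w + (ln t * x)%:C) / (w + x%:C)) <=
      2 * e * l + 2 * l * c^-1 + ln t * c^-1.
    rewrite (le_trans (cmodB _ _))// -addrA; apply: lerD.
      by rewrite cmodM cmod_real ger0_norm// mulr_ge0.
    rewrite cmodM cmodV.
    apply: (@le_trans _ _ ((2 * l * cmod w + ln t * x) / cmod (w + x%:C))).
      rewrite ler_wpM2r ?invr_ge0 ?cmod_ge0// (le_trans (cmodD _ _))//.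
      by rewrite !cmodM !cmod_real !ger0_norm// mulr_ge0// ltW// x0.
    rewrite [leLHS]mulrDl; apply: lerD.
      by rewrite -!mulrA ler_wpM2l// ler_wpM2l.
    by rewrite -[leLHS]mulrA ler_wpM2l.
  apply: (@le_trans _ _ (A * t `^ (- al0) * gaussdom (2 * e) y *
     ((L * (1 + ln t)) * expR y))).
    rewrite ler_pM ?cmod_ge0 ?kb// (le_trans br)//.
    have tau1 : 1 <= 1 + ln t by rewrite lerDl.
    have E1 : l <= (1 + pi) * expR y by exact: lg.
    have P1 : 1 <= (1 + pi) * expR y.
      by rewrite (le_trans ey)// ler_peMl ?expR_ge0// lerDl ltW.
    have B1 : (2 * e + 2 / c) * l <= (2 * e + 2 / c) * ((1 + pi) * expR y) * (1 + ln t).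
      rewrite (@le_trans _ _ ((2 * e + 2 / c) * ((1 + pi) * expR y)))//.
        by rewrite ler_wpM2l// addr_ge0 ?mulr_ge0 ?invr_ge0 ?(ltW c0).
      have Pp : 0 <= (1 + pi) * expR y by exact: le_trans ler01 P1.
      by apply: ler_peMr => //; rewrite mulr_ge0// addr_ge0 ?mulr_ge0.
    have B2 : ln t / c <= c^-1 * ((1 + pi) * expR y) * (1 + ln t).
      rewrite mulrC -mulrA ler_wpM2l ?invr_ge0 ?(ltW c0)//.
      rewrite (@le_trans _ _ (1 + ln t)) ?lerDr//.
      by apply: ler_peMl => //; exact: le_trans ler01 tau1.
    rewrite (_ : _ + _ + _ = (2 * e + 2 / c) * l + ln t / c); last by ring.
    rewrite (_ : L * _ * _ = (2 * e + 2 / c) * ((1 + pi) * expR y) * (1 + ln t) +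
       c^-1 * ((1 + pi) * expR y) * (1 + ln t)); last by rewrite /L; ring.
    exact: lerD.
  rewrite le_eqVlt; apply/orP; left; apply/eqP; rewrite /g /gaussdom.
  rewrite (_ : (2 * e + 1) * y - y ^+ 2 = 2 * e * y - y ^+ 2 + y); last by ring.
  by rewrite [in RHS]expRD; ring.
exact: (Rintegral_lipschitz du Dg ik (iI _) h h').
Qed.

(** In Hankel's integral on a fixed line the derivative in [al] only inserts a
    multiple of the logarithm of [z]. *)
Theorem rgamma_lipschitz m : exists2 K, 0 <= K &
  forall al be, 0 <= al <= 1 -> 0 <= be <= 1 ->
    `|rgamma (1 - m%:R * al) - rgamma (1 - m%:R * be)| <= K * `|al - be|.
Proof.
have pi0 := pi_gt0 R; pose e : R := m%:R; have e0 : 0 <= e by [].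
pose K := expR 1 * (2 * e * (1 + pi)); pose I := \int[mu]_(y in pos) gaussdom (2 * e + 1) y.
have Pp : 0 <= 1 + pi :> R by rewrite addr_ge0// ltW.
have K0 : 0 <= K by rewrite mulr_ge0 ?expR_ge0// mulr_ge0// mulr_ge0.
have I0 : 0 <= I by apply: Rintegral_ge0 => y _; exact: gaussdom_ge0.
have p2 : 0 <= 2 / pi :> R by rewrite divr_ge0// ltW.
exists (2 / pi * (K * I)); first by rewrite mulr_ge0// mulr_ge0.
move=> al be hal hbe; rewrite !rgamma_hankel -mulrBr normrM (ger0_norm p2).
rewrite -[leRHS]mulrA ler_wpM2l//.
have -> : K * I * `|al - be| = `|al - be| * \int[mu]_(y in pos) (K * gaussdom (2 * e + 1) y).
  by rewrite RintegralZl ?/I; [ring|exact: measurable_itv|exact: integrable_gaussdom].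
pose u al y := Re (cexp ((1 +i* y) * (1 +i* y)) *
  cpow (1 +i* y) (1 - 2 * (1 - m%:R * al))).
pose D al y := Re (cexp ((1 +i* y) * (1 +i* y)) * (cpow (1 +i* y) (2 * e * al + -1) *
  ((2 * e)%:C * clog (1 +i* y)))).
have du (p y : R) : 0 <= p <= 1 -> 0 < y -> is_derive p 1 (u ^~ y) (D p y).
  move=> hp y0.
  have [h _] := cderivM (cderiv_cst (cexp ((1 +i* y) * (1 +i* y))) p)
    (cderiv_cpow_exponent (1 +i* y) (2 * e) (-1) p).
  rewrite mulr0 addr0 in h.
  rewrite /u (_ : (fun al => _) =
    (fun al => Re (cexp ((1 +i* y) * (1 +i* y)) * cpow (1 +i* y) (2 * e * al + -1)))).
    exact: h.
  by apply/funext => s; congr (Re (_ * cpow _ _)); rewrite /e; ring.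
have Dg (p y : R) : 0 <= p <= 1 -> 0 < y -> `|D p y| <= K * gaussdom (2 * e + 1) y.
  move=> /andP[p0 p1] y0; rewrite /D (le_trans (normRe_le _))// mulrA cmodM.
  have h1 : cmod (cexp ((1 +i* y) * (1 +i* y)) * cpow (1 +i* y) (2 * e * p + -1)) <=
      expR 1 * gaussdom (2 * e) y.
    apply: cmod_cexp_cpow_line => //; last by rewrite mulr_ge0.
    by rewrite lerBlDl (@le_trans _ _ (2 * e))// ?lerDr// ler_piMr// mulr_ge0.
  have h2 : cmod ((2 * e)%:C * clog (1 +i* y)) <= 2 * e * ((1 + pi) * expR y).
    by rewrite cmodM cmod_real ger0_norm ?mulr_ge0// ler_wpM2l ?mulr_ge0// cmod_clog_line.
  apply: (@le_trans _ _ (expR 1 * gaussdom (2 * e) y * (2 * e * ((1 + pi) * expR y)))).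
    by rewrite ler_pM ?cmod_ge0.
  rewrite le_eqVlt; apply/orP; left; apply/eqP; rewrite /K /gaussdom.
  rewrite (_ : (2 * e + 1) * y - y ^+ 2 = 2 * e * y - y ^+ 2 + y); last by ring.
  by rewrite [in RHS]expRD; ring.
have iu (p : R) : 0 <= p <= 1 -> mu.-integrable pos (EFin \o u p).
  by move=> _; exact: integrable_hankel.
exact: (Rintegral_lipschitz du Dg iu (integrable_pos_scale K (integrable_gaussdom _)) hal hbe).
Qed.

End Estimates.

(** * Spectral expansions *)

Section HilbertSpace.
Context {R : realType} {H : completeNormedModType R}.
Variable dot : {dot H for (idfun : R -> R)}.
Hypothesis Hdot : norm_induced dot.
Implicit Types (x y z : H) (a b : R) (m n k : nat).

Lemma dotC x y : dot x y = dot y x.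
Proof. by have := hermC dot x y; rewrite expr0 mul1r. Qed.

Lemma dotDl x y z : dot (x + y) z = dot x z + dot y z.
Proof. exact: linearDl. Qed.

Lemma dotZl a x z : dot (a *: x) z = a * dot x z.
Proof. by rewrite linearZl_LR. Qed.

Lemma dot0l z : dot 0 z = 0.
Proof. exact: linear0l. Qed.

Lemma dotBl x y z : dot (x - y) z = dot x z - dot y z.
Proof. by rewrite dotDl -scaleN1r dotZl mulN1r. Qed.

Lemma dotDr x y z : dot z (x + y) = dot z x + dot z y.
Proof. by rewrite dotC dotDl !(dotC z). Qed.

Lemma dotZr a x z : dot z (a *: x) = a * dot z x.
Proof. by rewrite dotC dotZl (dotC z). Qed.

Lemma cauchy_schwarz x y : `|dot x y| <= `|x| * `|y|.
Proof.
have [->|y0] := eqVneq y 0; first by rewrite dotC dot0l !normr0 mulr0.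
have ny0 : 0 < `|y| ^+ 2 by rewrite exprn_gt0// normr_gt0.
pose w := `|y| ^+ 2 *: x - dot x y *: y.
have : 0 <= `|w| ^+ 2 by rewrite sqr_ge0.
have -> : `|w| ^+ 2 = `|y| ^+ 2 * (`|x| ^+ 2 * `|y| ^+ 2 - dot x y ^+ 2).
  rewrite -(Hdot w) /w -scaleNr !(dotDl, dotDr, dotZl, dotZr) !Hdot (dotC y x); ring.
rewrite pmulr_rge0// subr_ge0 -exprMn => h.
rewrite -ler_sqr ?nnegrE ?mulr_ge0//.
by rewrite real_normK ?num_real.
Qed.

Lemma cvg_dot (s : nat -> H) x y : s n @[n --> \oo] --> x ->
  dot (s n) y @[n --> \oo] --> dot x y.
Proof.
move=> sx; apply/cvgrPdist_le => e e0.
have e1 : 0 < e / (`|y| + 1) by rewrite divr_gt0// ltr_wpDl.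
move/cvgrPdist_le : sx => /(_ _ e1); apply: filterS => n hn.
rewrite -dotBl (le_trans (cauchy_schwarz _ _))//.
have y1 : 0 < `|y| + 1 by rewrite ltr_wpDl.
apply: (@le_trans _ _ (e / (`|y| + 1) * (`|y| + 1))); last by rewrite divfK// gt_eqF.
by rewrite ler_pM// lerDl.
Qed.

Section Basis.
Variables (N : option nat) (v : nat -> H).
Hypothesis basis : orthonormal_basis dot N v.

(** Zero off the index set: spectral sums become ordinary series in every
    dimension. *)
Definition coef x n : R := if eigen_index N n then dot x (v n) else 0.

Lemma dot_spectral_series (c : nat -> R) y n :
  dot (spectral_series N v c n) y =
  series (fun k => if eigen_index N k then c k * dot y (v k) else 0) n.
Proof.
rewrite /spectral_series !seriesEnat /=.
elim: n => [|n IHn]; first by rewrite !big_geq// dot0l.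
rewrite !big_nat_recr//= dotDl IHn; congr (_ + _).
by case: ifP => _; rewrite ?dot0l// dotZl dotC.
Qed.

Lemma parseval x y :
  series (fun n => coef x n * coef y n) n @[n --> \oo] --> dot x y.
Proof.
have [_ /(_ x) h] := basis; have := cvg_dot (y := y) h.
rewrite (_ : (fun n => _) = series (fun n => coef x n * coef y n))//.
apply/funext => n; rewrite dot_spectral_series; congr series.
by apply/funext => k; rewrite /coef; case: ifP; rewrite ?mul0r.
Qed.

Lemma series_sqr_le x n : series (fun n => coef x n ^+ 2) n <= `|x| ^+ 2.
Proof.
rewrite -Hdot; have h := @parseval x x.
have -> : (fun n => coef x n ^+ 2) = (fun n => coef x n * coef x n).
  by apply/funext => k; rewrite expr2.
rewrite -(cvg_lim (@Rhausdorff R) h); apply: nondecreasing_cvgn_le; last first.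
  by apply/cvg_ex; eexists; exact: h.
by apply: nondecreasing_series => k _ _; rewrite -expr2 sqr_ge0.
Qed.

(** From Bessel's inequality and [|a * b| <= a ^ 2 + b ^ 2]. *)
Lemma series_coef_le x y n :
  series (fun n => `|coef x n * coef y n|) n <= `|x| ^+ 2 + `|y| ^+ 2.
Proof.
apply: (@le_trans _ _ (series (fun n => coef x n ^+ 2) n + series (fun n => coef y n ^+ 2) n)).
  rewrite !seriesEnat /= -big_split /=; apply: ler_sum => k _.
  rewrite normrM; have := sqr_ge0 (`|coef x k| - `|coef y k|).
  rewrite sqrrB !real_normK ?num_real//.
  have := sqr_ge0 (coef x k); have := sqr_ge0 (coef y k).
  have : 0 <= `|coef x k| * `|coef y k| by rewrite mulr_ge0.
  by rewrite -mulr_natl; lra.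
by rewrite lerD ?series_sqr_le.
Qed.

Lemma sqr_norm_orthonormal_sum (c : nat -> R) m n :
  `|\sum_(m <= k < n) (if eigen_index N k then c k *: v k else 0)| ^+ 2 =
  \sum_(m <= k < n) (if eigen_index N k then c k ^+ 2 else 0).
Proof.
have [orth _] := basis.
have ort j : eigen_index N j -> forall n', (n' <= j)%N ->
    dot (\sum_(m <= k < n') (if eigen_index N k then c k *: v k else 0)) (v j) = 0.
  move=> Nj; elim=> [_|n' IH n'j]; first by rewrite big_geq// dot0l.
  have [mn|nm] := leqP m n'; last by rewrite big_geq// dot0l.
  rewrite big_nat_recr//= dotDl IH ?(ltnW n'j)// add0r.
  case: ifP => Nn; last by rewrite dot0l.
  by rewrite dotZl orth// ltn_eqF// mulr0.
elim: n => [|n IHn]; first by rewrite !big_geq// normr0 expr0n.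
have [mn|nm] := leqP m n; last by rewrite !big_geq// normr0 expr0n.
rewrite !big_nat_recr//= -IHn -!Hdot.
case: ifP => Nn; last by rewrite !addr0.
rewrite !(dotDl, dotDr, dotZl, dotZr) (dotC (v n) (\sum_(_ <= _ < _) _)) ort// orth// eqxx.
by rewrite (_ : true%:R = 1 :> R)//; ring.
Qed.

(** By orthogonality the Cauchy criterion reduces to that of Parseval's series. *)
Lemma cvg_spectral_multiplier x (b : nat -> R) (B : R) :
  (forall n, eigen_index N n -> `|b n| <= B) ->
  cvg (spectral_series N v (fun n => dot x (v n) * b n) n @[n --> \oo]).
Proof.
move=> hb; apply: cauchy_cvg; apply/cauchy_seriesP => e e0.
have B1 : 0 < (B ^+ 2 + 1) by rewrite ltr_wpDl ?sqr_ge0.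
have ee : 0 < e ^+ 2 / (B ^+ 2 + 1) by rewrite divr_gt0// exprn_gt0.
have cs : cvg (series (fun n => coef x n * coef x n) n @[n --> \oo]).
  by apply/cvg_ex; eexists; exact: parseval.
have /cauchy_cvgP/cauchy_seriesP/(_ _ ee) := cs.
apply: filterS => -[m n] /= hmn.
rewrite -ltr_sqr ?nnegrE ?(ltW e0)// sqr_norm_orthonormal_sum.
apply: (@le_lt_trans _ _ (B ^+ 2 * `|\sum_(m <= k < n) coef x k * coef x k|)).
  apply: (@le_trans _ _ (B ^+ 2 * \sum_(m <= k < n) coef x k * coef x k)); last first.
    by rewrite ler_wpM2l ?sqr_ge0// ler_norm.
  rewrite big_distrr /=; apply: ler_sum => k _; rewrite /coef.
  case: ifP => Nk; last by rewrite mul0r mulr0.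
  rewrite exprMn mulrC -expr2 ler_wpM2r ?sqr_ge0//.
  by rewrite -real_normK ?num_real// lerXn2r ?nnegrE ?(le_trans (normr_ge0 _) (hb _ Nk))// hb.
have : B ^+ 2 * `|\sum_(m <= k < n) coef x k * coef x k| <= B ^+ 2 * (e ^+ 2 / (B ^+ 2 + 1)).
  by rewrite ler_wpM2l ?sqr_ge0// ltW.
move=> /le_lt_trans; apply.
by rewrite mulrCA gtr_pMr ?exprn_gt0// ltr_pdivrMr// mul1r ltrDl.
Qed.

End Basis.

Section Operator.
Variables (D : set H) (A : H -> H).
Hypothesis Hsa : self_adjoint dot D A.
Variables (N : option nat) (lambda : nat -> R) (v : nat -> H).
Hypothesis Hspec : spectral_decomposition dot D A N lambda v.

Let basis : orthonormal_basis dot N v. Proof. by case: Hspec. Qed.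
Let eigen n : eigen_index N n -> D (v n) /\ A (v n) = lambda n *: v n.
Proof. by case: Hspec => _ + _ _ _; apply. Qed.
Let lambda_gt0 n : eigen_index N n -> 0 < lambda n.
Proof. by case: Hspec => _ _ + _ _; apply. Qed.

Lemma eigen_index_0 n : eigen_index N n -> eigen_index N 0.
Proof. by case: N => //= d; case: d. Qed.

Lemma lambda_ge_first n : eigen_index N n -> lambda 0 <= lambda n.
Proof. by move=> Nn; case: Hspec => _ _ _ + _; apply. Qed.

Lemma dot_A x n : D x -> eigen_index N n -> dot (A x) (v n) = lambda n * dot x (v n).
Proof.
move=> Dx Nn; case: Hsa => _ _ /(_ (v n) (lambda n *: v n))[_ h].
by rewrite (h (eigen Nn)) // dotZr.
Qed.

(** Dividing the coefficients of [x] by the eigenvalues defines a vector [y] with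
    [dot (A u) y = dot u x] on the domain; by self-adjointness [y] lies in the
    domain and [A y = x]. *)
Lemma A_surjective x : exists y, D y /\ A y = x.
Proof.
pose b n := (lambda n)^-1.
have hb n : eigen_index N n -> `|b n| <= (lambda 0)^-1.
  move=> Nn; have l0 := lambda_gt0 (eigen_index_0 Nn).
  rewrite ger0_norm ?invr_ge0 ?(ltW (lambda_gt0 Nn))//.
  by rewrite lef_pV2 ?posrE ?(lambda_gt0 Nn)// lambda_ge_first.
have /cvg_ex[y hy] := cvg_spectral_multiplier basis (x := x) hb.
exists y; case: Hsa => _ _ /(_ y x)[+ _]; apply => u Du.
have h1 := cvg_dot (y := A u) hy; have h2 := parseval basis (x := u) (y := x).
rewrite dotC; apply: (cvg_unique (@Rhausdorff R) h1).
rewrite (_ : (fun n => _) = series (fun n => coef N v u n * coef N v x n))//.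
apply/funext => n; rewrite dot_spectral_series; congr series.
apply/funext => k; rewrite /coef; case: ifP => Nk; last by rewrite mul0r.
by rewrite dot_A// /b; field; rewrite gt_eqF// lambda_gt0.
Qed.

Lemma dot_inv_op x n : eigen_index N n ->
  dot (inv_op D A x) (v n) = dot x (v n) / lambda n.
Proof.
move=> Nn; have [y Dy] := A_surjective x.
have [Dz Az] : [set y | D y /\ A y = x] (inv_op D A x).
  by rewrite /inv_op; apply: (xgetPex 0 (ex_intro _ y Dy)).
by rewrite -{2}Az dot_A//; field; rewrite gt_eqF// lambda_gt0.
Qed.

Lemma dot_inv_pow k x n : eigen_index N n ->
  dot (inv_pow D A k x) (v n) = dot x (v n) / lambda n ^+ k.
Proof.
move=> Nn; elim: k => [|k IHk]; first by rewrite expr0 divr1.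
rewrite /inv_pow iterS dot_inv_op// IHk exprS.
by field; rewrite expf_neq0 gt_eqF// lambda_gt0.
Qed.

(** The value 1 off the index set makes one positive lower bound valid for all [n]. *)
Definition eigval n : R := if eigen_index N n then lambda n else 1.

Lemma eigval_bound : exists2 mu0 : R, 0 < mu0 & forall n, mu0 <= eigval n.
Proof.
exists (if eigen_index N 0 then Num.min 1 (lambda 0) else 1).
  by case: ifP => // N0; rewrite lt_min ltr01 lambda_gt0.
move=> n; rewrite /eigval; case: (boolP (eigen_index N n)) => Nn.
  by rewrite (eigen_index_0 Nn) ge_min lambda_ge_first// orbT.
by case: ifP => //; rewrite ge_min lexx.
Qed.

Lemma cvg_moment k x y :
  series (fun n => coef N v x n * coef N v y n / eigval n ^+ k) n @[n --> \oo] -->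
  dot (inv_pow D A k x) y.
Proof.
have := parseval basis (x := inv_pow D A k x) (y := y).
rewrite (_ : series _ = series (fun n => coef N v x n * coef N v y n / eigval n ^+ k))//.
congr series; apply/funext => n; rewrite /coef /eigval.
by case: ifP => Nn; [rewrite dot_inv_pow// mulrAC|rewrite !mul0r].
Qed.

Lemma cvg_mild_solution (phi y : H) al t (B : R) :
  (forall n, `|mittag_leffler al 1 (- eigval n * t `^ al)| <= B) ->
  series (fun n => coef N v phi n * coef N v y n *
    mittag_leffler al 1 (- eigval n * t `^ al)) n @[n --> \oo] -->
  dot (mild_solution dot N lambda v phi al t) y.
Proof.
move=> hB; have hb n : eigen_index N n -> `|mittag_leffler al 1 (- lambda n * t `^ al)| <= B.
  by move=> Nn; have := hB n; rewrite /eigval Nn.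
have h := cvg_spectral_multiplier basis (x := phi) hb.
have := cvg_dot (y := y) h.
rewrite -/(mild_solution dot N lambda v phi al t).
rewrite (_ : (fun n => _) = series (fun n => coef N v phi n * coef N v y n *
    mittag_leffler al 1 (- eigval n * t `^ al)))//.
apply/funext => n; rewrite dot_spectral_series; congr series.
apply/funext => k; rewrite /coef /eigval.
by case: ifP => Nk; [rewrite mulrAC|rewrite !mul0r].
Qed.

End Operator.
End HilbertSpace.

(** * Late values determine the order *)

Section Injectivity.
Context {R : realType}.
Implicit Types (a al be t x : R) (m n k : nat).

Lemma norm_cvg_le (u : nat -> R) (L B : R) : u n @[n --> \oo] --> L ->
  (forall n, `|u n| <= B) -> `|L| <= B.
Proof.
move=> uL uB; rewrite ler_norml; apply/andP; split.
  apply: (cvgr_to_ge uL); apply: nearW => n.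
  by have := uB n; rewrite ler_norml => /andP[].
apply: (cvgr_to_le uL); apply: nearW => n.
by have := uB n; rewrite ler_norml => /andP[].
Qed.

(** A continuous function without zeros on a compact interval. *)
Lemma rgamma_away_from_0 m (al0 al1 : R) : 0 < al0 -> al0 <= al1 -> al1 < 1 ->
  (forall al, al0 <= al <= al1 -> rgamma (1 - m%:R * al) != 0) ->
  exists2 delta : R, 0 < delta &
    forall al, al0 <= al <= al1 -> delta <= `|rgamma (1 - m%:R * al)|.
Proof.
move=> al00 al01 al11 hne.
have [L L0 hL] := rgamma_lipschitz (R := R) m.
pose f al := `|rgamma (1 - m%:R * al)|.
have cf : {within `[al0, al1], continuous f}.
  apply: continuous_in_subspaceT => p; rewrite inE /= in_itv /= => /andP[p0 p1].
  have pp0 : 0 < p by exact: lt_le_trans p0.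
  have pp1 : p < 1 by exact: le_lt_trans al11.
  apply: (@continuous_comp _ _ _ (fun al => rgamma (1 - m%:R * al)) Num.norm); last first.
    exact: norm_continuous.
  apply/cvgrPdist_le => e e0.
  have e1 : 0 < e / (L + 1) by rewrite divr_gt0// ltr_wpDl.
  have h0 : \forall x \near p, 0 < x by exact: lt_nbhsr.
  have h1 : \forall x \near p, x < 1 by exact: lt_nbhsl.
  have h2 : \forall x \near p, `|p - x| < e / (L + 1).
    by have := @cvg_id _ (nbhs p); move=> /cvgrPdist_lt/(_ _ e1).
  apply: filterS3 h0 h1 h2 => x x0 x1 px.
  apply: le_trans (hL _ _ _ _) _; rewrite ?(ltW pp0) ?(ltW pp1) ?(ltW x0) ?(ltW x1)//.
  have L1 : 0 < L + 1 by rewrite ltr_wpDl.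
  apply: (@le_trans _ _ ((L + 1) * (e / (L + 1)))); last by rewrite mulrC divfK// gt_eqF.
  by apply: ler_pM => //; [rewrite lerDl|exact: ltW].
have [c cI hc] := EVT_min al01 cf.
have cI' : al0 <= c <= al1 by move: cI; rewrite in_itv.
exists (f c); first by rewrite normr_gt0 hne.
by move=> al hal; apply: hc; rewrite in_itv.
Qed.

Section Spectrum.
(* [q n] stands for [dot phi (v n) * dot h (v n)], [l n] for the [n]-th eigenvalue,
   [b k] for the pairing of the [k]-th inverse power with [h], and [F al t] for
   the value observed at time [t]. *)
Variables (q l : nat -> R) (mu0 Kq : R) (m : nat) (b : nat -> R).
Hypothesis mu0_gt0 : 0 < mu0.
Hypothesis l_ge : forall n, mu0 <= l n.
Hypothesis q_summable : forall n, series (fun k => `|q k|) n <= Kq.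
Hypothesis moments : forall k,
  series (fun n => q n / l n ^+ k) n @[n --> \oo] --> b k.

Let l_gt0 n : 0 < l n. Proof. exact: lt_le_trans mu0_gt0 (l_ge n). Qed.

Let Kq_ge0 : 0 <= Kq.
Proof. by rewrite (le_trans _ (q_summable 0))// seriesEnat /= big_geq. Qed.

Lemma cvg_weighted_le (c : nat -> R) (L B : R) :
  series (fun n => q n * c n) n @[n --> \oo] --> L ->
  (forall n, `|c n| <= B) -> `|L| <= Kq * B.
Proof.
move=> hL hc; have B0 : 0 <= B by rewrite (le_trans _ (hc 0%N)).
apply: (norm_cvg_le hL) => n.
rewrite (@le_trans _ _ (series (fun k => `|q k|) n * B))//; last by rewrite ler_wpM2r.
rewrite !seriesEnat /= (le_trans (ler_norm_sum _ _ _))// big_distrl /=.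
by apply: ler_sum => k _; rewrite normrM ler_wpM2l.
Qed.

Lemma cvg_weighted_sum (c : nat -> R) M :
  series (fun n => q n * \sum_(k < M) c k / l n ^+ k.+1) n @[n --> \oo] -->
  \sum_(k < M) c k * b k.+1.
Proof.
elim: M => [|M IHM].
  rewrite big_ord0 (_ : series _ = fun=> 0); first exact: cvg_cst.
  by apply/funext => n; rewrite seriesEnat /= big1// => k _; rewrite big_ord0 mulr0.
rewrite big_ord_recr /=.
rewrite (_ : series _ = series (fun n => q n * \sum_(k < M) c k / l n ^+ k.+1) +
   (fun n => c M * series (fun n => q n / l n ^+ M.+1) n)); last first.
  apply/funext => n; rewrite /= fctE !seriesEnat /= big_distrr /= -big_split /=.
  by apply: eq_bigr => k _; rewrite big_ord_recr /= mulrDr; congr (_ + _); ring.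
by apply: cvgD => //; exact: cvgMr.
Qed.

Hypothesis m_gt0 : (0 < m)%N.
Hypothesis vanish : forall k, (1 <= k <= m - 1)%N -> b k = 0.
Hypothesis nonzero : b m != 0.
Variables (al0 al1 : R) (F : R -> R -> R).
Hypothesis al0_gt0 : 0 < al0.
Hypothesis al01 : al0 <= al1.
Hypothesis al1_lt1 : al1 < 1.
Hypothesis cm_neq0 : forall al, al0 <= al <= al1 -> rgamma (1 - m%:R * al) != 0.
Hypothesis cvgF : forall al t, al0 <= al <= al1 -> 1 <= t ->
  series (fun n => q n * mittag_leffler al 1 (- l n * t `^ al)) n @[n --> \oo] --> F al t.

Let hal al : al0 <= al <= al1 -> 0 < al < 1.
Proof.
by move=> /andP[h1 h2]; rewrite (lt_le_trans al0_gt0 h1) (le_lt_trans h2 al1_lt1).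
Qed.

(** What remains of [F al t], rescaled by [(- t ^ al) ^ m], after the first [m] terms
    of its expansion in powers of [t ^ (- al)], of which only the [m]-th one is not
    zero. *)
Let G al t := rgamma (1 - m%:R * al) * b m + (-1) ^+ m * (t `^ al) ^+ m * F al t.

Lemma cvg_remainder al t : al0 <= al <= al1 -> 1 <= t ->
  series (fun n => q n * (mlg m al (l n * t `^ al) / l n ^+ m)) n @[n --> \oo] --> G al t.
Proof.
move=> h t1; have t0 : 0 < t by exact: lt_le_trans t1.
set s := t `^ al; have s0 : 0 < s by exact: powR_gt0.
have sn : s != 0 by rewrite gt_eqF.
pose c k := (-1) ^+ k * rgamma (1 - k.+1%:R * al) / s ^+ k.+1.
have hc := @cvg_weighted_sum c m.
have -> : G al t = (-1) ^+ m * s ^+ m * (F al t - \sum_(k < m) c k * b k.+1).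
  rewrite /G -/s mulrBr addrC; congr (_ + _).
  have -> : \sum_(k < m) c k * b k.+1 = c m.-1 * b m.
    move: hc vanish nonzero m_gt0; case: m => // m' _ van _ _.
    rewrite big_ord_recr /= big1 ?add0r// => k _.
    by rewrite van ?mulr0// subn1 /= ltn_ord.
  rewrite /c prednK//; have -> : (-1) ^+ m.-1 = - (-1) ^+ m :> R.
    by rewrite -{2}(prednK m_gt0) exprS mulN1r opprK.
  have e1 : (-1) ^+ m * (-1) ^+ m = 1 :> R by rewrite -exprMn mulrNN mulr1 expr1n.
  transitivity (((-1) ^+ m * (-1) ^+ m) * (s ^+ m / s ^+ m) * rgamma (1 - m%:R * al) * b m).
    by rewrite e1 divff ?expf_neq0// !mul1r.
  by ring.
rewrite (_ : series _ = (fun n => (-1) ^+ m * s ^+ m *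
    (series (fun n => q n * mittag_leffler al 1 (- l n * s)) n -
     series (fun n => q n * \sum_(k < m) c k / l n ^+ k.+1) n))).
  by apply: cvgMr; apply: cvgB => //; exact: cvgF.
apply/funext => n; rewrite !seriesEnat /= -sumrB big_distrr /=; apply: eq_bigr => k _.
have x0 : 0 < l k * s by rewrite mulr_gt0.
rewrite mulNr mittag_lefflerE ?hal// (mlg_expansion m (hal h) x0).
have -> : \sum_(j < m) (-1) ^+ j * rgamma (1 - j.+1%:R * al) / (l k * s) ^+ j.+1 =
    \sum_(j < m) c j / l k ^+ j.+1.
  apply: eq_bigr => j _; rewrite /c exprMn invfM; ring.
rewrite -mulrBr addrAC subrr add0r exprMn.
have e1 : (-1) ^+ m * (-1) ^+ m = 1 :> R by rewrite -exprMn mulrNN mulr1 expr1n.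
have sm : s ^+ m / s ^+ m = 1 by rewrite divff// expf_neq0.
transitivity (((-1) ^+ m * (-1) ^+ m) * (s ^+ m / s ^+ m) * q k * mlg m al (l k * s) / l k ^+ m).
  by rewrite e1 sm !mul1r mulrA.
by rewrite invfM; ring.
Qed.

(** Let [P al = - (- t ^ al) ^ m * F al t], which is [b m / Gamma (1 - m * al)] up to
    the remainder.  Equal observations at [al < be] give
    [P be = P al * t ^ (m * (be - al))], a relative increase of at least
    [(be - al) * ln t].  But [P] is bounded away from 0, and its Lipschitz constant
    in [al] stays bounded as [t] grows. *)
Theorem observation_injective : exists T : R, 1 < T /\
  forall t, T <= t -> forall al be, al0 <= al <= al1 -> al0 <= be <= al1 ->
  F al t = F be t -> al = be.
Proof.
have [delta delta0 hdelta] := rgamma_away_from_0 al0_gt0 al01 al1_lt1 cm_neq0.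
have [L L0 hL] := rgamma_lipschitz (R := R) m.
have [C C0 hC] := mlg_estimates m al0_gt0 al1_lt1 mu0_gt0.
pose B := `|b m| * delta; have B0 : 0 < B by rewrite mulr_gt0// normr_gt0.
pose K := Kq * (C / mu0 ^+ m).
have K0 : 0 <= K by rewrite mulr_ge0 ?Kq_ge0// divr_ge0// exprn_ge0// ltW.
(* the last term makes [K * D <= B / 4] below; the comparison of increases then
   reads [ln t * (B / 2) <= `|b m| * L + B / 4], against the first two terms *)
pose tau0 := 1 + 2 / B * (`|b m| * L + B / 4) + 4 * K / (al0 * B).
have p1 : 0 <= 2 / B * (`|b m| * L + B / 4).
  have B0' := ltW B0; apply: mulr_ge0; first exact: divr_ge0.
  by apply: addr_ge0; [exact: mulr_ge0|exact: divr_ge0].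
have p2 : 0 <= 4 * K / (al0 * B).
  by apply: divr_ge0; [exact: mulr_ge0|exact/ltW/mulr_gt0].
have tau01 : 1 <= tau0 by rewrite /tau0 -addrA lerDl addr_ge0.
exists (expR tau0); split.
  by rewrite -expR0 ltr_expR (lt_le_trans ltr01).
move=> t Tt al be.
wlog albe : al be / al < be.
  move=> wl hal1 hbe1 e; have [lt|gt|//] := ltgtP al be; first exact: wl.
  by apply/esym; exact: wl.
move=> hal1 hbe1 FF.
have t0 : 0 < t by exact: lt_le_trans (expR_gt0 _) Tt.
have tau : tau0 <= ln t by rewrite -[leLHS]expRK ler_ln ?posrE ?expR_gt0.
have tau1 : 1 <= ln t by exact: le_trans tau.
have t1 : 1 <= t by rewrite (le_trans _ Tt)// -expR0 ler_expR (le_trans ler01).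
set D := t `^ (- al0).
have D0 : 0 <= D by exact: powR_ge0.
have KD : K * D <= B / 4.
  have x0 : 0 < al0 * ln t by rewrite mulr_gt0// (lt_le_trans ltr01).
  have hD : D <= (al0 * ln t)^-1.
    rewrite /D powRN lef_pV2 ?posrE ?powR_gt0// /powR gt_eqF//.
    exact: expR_ge.
  apply: (@le_trans _ _ (K / (al0 * ln t))); first by rewrite ler_wpM2l.
  rewrite ler_pdivrMr//.
  have : 4 * K / (al0 * B) <= ln t by rewrite (le_trans _ tau)// /tau0; lra.
  by rewrite ler_pdivrMr ?(mulr_gt0 al0_gt0 B0)//; lra.
have [Gle Glip] : (forall a, al0 <= a <= al1 -> `|G a t| <= K * D) /\
    `|G al t - G be t| <= K * ((1 + ln t) * D * `|al - be|).
  have lm n : 0 < l n ^+ m by rewrite exprn_gt0.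
  have lV n : (l n ^+ m)^-1 <= (mu0 ^+ m)^-1.
    by rewrite lef_pV2 ?posrE ?exprn_gt0// lerXn2r ?nnegrE ?(ltW mu0_gt0) ?(ltW (l_gt0 n)).
  split.
    move=> a ha; rewrite /K -mulrA.
    apply: (cvg_weighted_le (cvg_remainder ha t1)) => n.
    have [h _] := hC (l n) t (l_ge n) t1.
    rewrite normrM (ger0_norm (_ : 0 <= (l n ^+ m)^-1)) ?invr_ge0 ?(ltW (lm n))//.
    rewrite (_ : C / mu0 ^+ m * D = C * D * (mu0 ^+ m)^-1); last by ring.
    by rewrite ler_pM ?invr_ge0 ?(ltW (lm n))// h.
  rewrite /K -mulrA.
  have cG : series (fun n => q n * (mlg m al (l n * t `^ al) / l n ^+ m -
      mlg m be (l n * t `^ be) / l n ^+ m)) n @[n --> \oo] --> G al t - G be t.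
    rewrite (_ : series _ = series (fun n => q n * (mlg m al (l n * t `^ al) / l n ^+ m)) -
      series (fun n => q n * (mlg m be (l n * t `^ be) / l n ^+ m))).
      by apply: cvgB; exact: cvg_remainder.
    apply/funext => n; rewrite fctE !seriesEnat /= -sumrB; apply: eq_bigr => k _.
    by rewrite mulrBr.
  apply: (cvg_weighted_le cG) => n.
  have [_ h] := hC (l n) t (l_ge n) t1.
  rewrite -mulrBl normrM (ger0_norm (_ : 0 <= (l n ^+ m)^-1)) ?invr_ge0 ?(ltW (lm n))//.
  rewrite (_ : C / mu0 ^+ m * _ = C * (1 + ln t) * D * `|al - be| * (mu0 ^+ m)^-1); last by ring.
  by rewrite ler_pM ?invr_ge0 ?(ltW (lm n))// h.
pose P a := rgamma (1 - m%:R * a) * b m - G a t.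
have PE a : P a = - ((-1) ^+ m * (t `^ a) ^+ m * F a t) by rewrite /P /G; ring.
set d := be - al; have d0 : 0 < d by rewrite subr_gt0.
pose rho := t `^ d.
have rho_ge : 1 + d * ln t <= rho by rewrite /rho /powR gt_eqF// expR_ge1Dx.
have rho1 : 1 <= rho by rewrite (le_trans _ rho_ge)// lerDl mulr_ge0 ?(ltW d0)// (le_trans ler01).
have Pbe : P be = P al * rho ^+ m.
  have e : t `^ be = t `^ al * rho.
    rewrite /rho -powRD; last by apply/implyP => _; rewrite gt_eqF.
    by congr (_ `^ _); rewrite /d; ring.
  by rewrite !PE e exprMn FF; ring.
have rhom : 1 + d * ln t <= rho ^+ m.
  rewrite (le_trans rho_ge)// -{1}(expr1 rho).
  by rewrite ler_weXn2l.
have Pge : B - K * D <= `|P al|.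
  have h1 : B <= `|rgamma (1 - m%:R * al) * b m|.
    by rewrite normrM /B mulrC ler_wpM2r// hdelta.
  have h2 := Gle _ hal1.
  have := lerB_dist (rgamma (1 - m%:R * al) * b m) (G al t).
  by rewrite /P; lra.
have Plow : d * ln t * `|P al| <= `|P al - P be|.
  rewrite Pbe -{2}(mulr1 (P al)) -mulrBr normrM (distrC 1) mulrC ler_wpM2l//.
  have dt : d * ln t <= rho ^+ m - 1 by rewrite lerBrDl.
  have dt0 : 0 <= d * ln t by apply: mulr_ge0; [exact: ltW|exact: le_trans tau1].
  by rewrite ger0_norm ?(le_trans dt0).
have dE : `|al - be| = d by rewrite distrC ger0_norm// ltW.
have Pup : `|P al - P be| <= (`|b m| * L + K * D * (1 + ln t)) * d.
  have -> : P al - P be = (rgamma (1 - m%:R * al) - rgamma (1 - m%:R * be)) * b m - (G al t - G be t).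
    by rewrite /P; ring.
  rewrite (le_trans (ler_normB _ _))// [leRHS]mulrDl; apply: lerD.
    rewrite normrM mulrC -mulrA ler_wpM2l// -dE.
    have /andP[/ltW a0 /ltW a1] := hal hal1; have /andP[/ltW b0 /ltW b1] := hal hbe1.
    by apply: hL; apply/andP.
  by rewrite (le_trans Glip)// dE le_eqVlt; apply/orP; left; apply/eqP; ring.
have key : ln t * `|P al| <= `|b m| * L + K * D * (1 + ln t).
  rewrite -(ler_pM2l d0) mulrA (le_trans Plow)// (le_trans Pup)//.
  by rewrite mulrC.
have key2 : ln t * (B - K * D) <= ln t * `|P al|.
  by rewrite ler_wpM2l// (le_trans ler01).
have tau2 : 2 / B * (`|b m| * L + B / 4) + 1 <= ln t.
  by rewrite (le_trans _ tau)// /tau0; lra.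
have tau3 : 2 * (`|b m| * L + B / 4) + B <= ln t * B.
  have := ler_wpM2r (ltW B0) tau2; rewrite mulrDl mul1r => h.
  by apply: le_trans h; rewrite lerD2r le_eqVlt; apply/orP; left; apply/eqP; field; rewrite gt_eqF.
exfalso; nra.
Qed.

End Spectrum.
End Injectivity.

(** * Fractional evolution equations *)

Theorem corollary4p4 (R : realType) (H : completeNormedModType R)
    (dot : {dot H for (idfun : R -> R)}) (Hdot : norm_induced dot)
    (Hsep : separable_space H)
    (D : set H) (A : H -> H)
    (Hsa : self_adjoint dot D A) (Hpos : strictly_positive dot D A)
    (Hres : compact_resolvent D A)
    (N : option nat) (lambda : nat -> R) (v : nat -> H)
    (Hspec : spectral_decomposition dot D A N lambda v)
    (alpha0 alpha1 : R) (Ha0 : 0 < alpha0) (Ha01 : alpha0 <= alpha1)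
    (Ha1 : alpha1 < 1)
    (phi h : H) (m : nat) (Hm : (1 <= m)%N)
    (Hvanish : forall k : nat, (1 <= k <= m - 1)%N ->
       dot (inv_pow D A k phi) h = 0)
    (Hnonzero : dot (inv_pow D A m phi) h != 0)
    (Hcm : forall alpha : R, alpha0 <= alpha <= alpha1 ->
       (-1) ^+ m.+1 * rgamma (1 - m%:R * alpha) != 0) :
  exists T : R, 1 < T /\
    forall t0 : R, T <= t0 -> forall d0 : R, forall alpha beta : R,
      alpha0 <= alpha <= alpha1 -> alpha0 <= beta <= alpha1 ->
      dot (mild_solution dot N lambda v phi alpha t0) h = d0 ->
      dot (mild_solution dot N lambda v phi beta t0) h = d0 ->
      alpha = beta.
Proof.
have [mu0 mu00 hmu] := eigval_bound Hspec.
have [C C0 hC] := mlg_estimates 0 Ha0 Ha1 mu00.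
pose q n := coef dot N v phi n * coef dot N v h n.
have q_summable n : series (fun k => `|q k|) n <= `|phi| ^+ 2 + `|h| ^+ 2.
  by apply: series_coef_le => //; case: Hspec.
have cvgF al t : alpha0 <= al <= alpha1 -> 1 <= t ->
    series (fun n => q n * mittag_leffler al 1 (- eigval N lambda n * t `^ al)) n
      @[n --> \oo] --> dot (mild_solution dot N lambda v phi al t) h.
  move=> hal t1.
  apply: (cvg_mild_solution Hdot Hspec (B := C * t `^ (- alpha0))) => n.
  have [+ _] := hC _ _ (hmu n) t1 => /(_ _ hal).
  have /andP[h0 h1] := hal.
  rewrite mulNr mittag_lefflerE//.
    by rewrite (lt_le_trans Ha0 h0) (le_lt_trans h1 Ha1).
  rewrite mulr_gt0 ?(lt_le_trans mu00 (hmu n))// powR_gt0//.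
  exact: lt_le_trans t1.
have hcm al : alpha0 <= al <= alpha1 -> rgamma (1 - m%:R * al) != 0.
  by move=> /Hcm; rewrite mulf_eq0 negb_or => /andP[].
have moments k : series (fun n => q n / eigval N lambda n ^+ k) n @[n --> \oo] -->
    dot (inv_pow D A k phi) h by exact: cvg_moment.
have [T [T1 hT]] := @observation_injective R q (eigval N lambda) mu0 _ m
  (fun k => dot (inv_pow D A k phi) h) mu00 hmu q_summable moments Hm Hvanish Hnonzero
  alpha0 alpha1 (fun al t => dot (mild_solution dot N lambda v phi al t) h)
  Ha0 Ha01 Ha1 hcm cvgF.
exists T; split=> // t0 Tt d0 al be hal hbe e1 e2.
exact: (hT t0 Tt al be hal hbe (etrans e1 (esym e2))).
Qed.
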